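(* Every graph $G$ admits a path odd-cover of size at most $\max \left\{\frac{v_{\mathrm{odd}}(G)}{2}, \left \lceil\frac{v_{\mathrm{odd}}(G)/2 + 3\Delta_e(G)}{4} \right \rceil\right\}$. Moreover, if $G$ is Eulerian, then $G$ admits a path odd-cover of size at most $\lceil\frac34\Delta(G)\rceil$ and a cycle odd-cover of size at most $\lceil\frac34\Delta(G)\rceil$.
   Context: Graphs are finite, simple and undirected, assumed to have no isolated vertices. $\Delta(G)$ is the maximum degree of $G$, $\Delta_e(G) := 2\lceil \Delta(G)/2\rceil$, and $v_{\mathrm{odd}}(G)$ is the number of vertices of odd degree in $G$. A graph is called Eulerian if every vertex has even degree (connectedness is not required). The symmetric difference $H_1\oplus\cdots\oplus H_k$ of graphs is the graph whose edges are those belonging to an odd number of the edge sets $E(H_1),\dots,E(H_k)$; graphs are identified with their edge sets. A path odd-cover (resp. cycle odd-cover) of $G$ is a collection $\mathcal{H}=\{H_1,\dots,H_k\}$ of paths (resp. cycles, of length at least $3$) that are subgraphs of the complete graph on the vertex set $V(G)$ (they may use edges not in $G$), such that $G=H_1\oplus\cdots\oplus H_k$. Its size is $k$. *)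

(* Defs.v *)
From HB Require Import structures.
From mathcomp Require Import all_boot all_order all_algebra.

Set Implicit Arguments.
Unset Strict Implicit.
Unset Printing Implicit Defensive.

(* A simple graph on the vertex set T is a symmetric irreflexive relation
   G : rel T.  An edge is the two-element set of its endpoints, and the members
   of an odd-cover are given by their edge sets. *)
Definition edges (T : finType) (G : rel T) : {set {set T}} :=
  [set [set p.1; p.2] | p : T * T & G p.1 p.2].

Definition no_isolated (T : finType) (G : rel T) : Prop :=
  forall x : T, exists y : T, G x y.

Definition deg (T : finType) (G : rel T) (x : T) : nat := #|[set y | G x y]|.

Definition max_deg (T : finType) (G : rel T) : nat := \max_(x : T) deg G x.

(* uphalf n is the ceiling of n / 2 *)
Definition max_deg_even (T : finType) (G : rel T) : nat :=
  2 * uphalf (max_deg G).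

Definition v_odd (T : finType) (G : rel T) : nat := #|[set x | odd (deg G x)]|.

Definition eulerian (T : finType) (G : rel T) : Prop :=
  forall x : T, ~~ odd (deg G x).

Definition symdiff (T : finType) (H : {set {set {set T}}}) : {set {set T}} :=
  [set e | odd #|[set F in H | e \in F]|].

(* The edges x_1 x_2, ..., x_(k-1) x_k of the walk s = x_1 ... x_k;
   zip drops the unmatched last item. *)
Definition path_edges (T : finType) (s : seq T) : {set {set T}} :=
  [set e in [seq [set p.1; p.2] | p <- zip s (behead s)]].

(* As path_edges, together with the closing edge x_k x_1. *)
Definition cycle_edges (T : finType) (s : seq T) : {set {set T}} :=
  [set e in [seq [set p.1; p.2] | p <- zip s (rot 1 s)]].

(* Any sequence of distinct vertices is a path of the complete graph on T, so
   no adjacency condition appears.  A path has at least one edge and a cycle at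
   least three. *)
Definition is_path (T : finType) (F : {set {set T}}) : Prop :=
  exists s : seq T, [/\ uniq s, 2 <= size s & F = path_edges s].

Definition is_cycle (T : finType) (F : {set {set T}}) : Prop :=
  exists s : seq T, [/\ uniq s, 3 <= size s & F = cycle_edges s].

Definition path_odd_cover (T : finType) (G : rel T)
    (H : {set {set {set T}}}) : Prop :=
  (forall F, F \in H -> is_path F) /\ edges G = symdiff H.

Definition cycle_odd_cover (T : finType) (G : rel T)
    (H : {set {set {set T}}}) : Prop :=
  (forall F, F \in H -> is_cycle F) /\ edges G = symdiff H.

(* Main.v *)
(* By Petersen's theorem an Eulerian graph of maximum degree 2k splits into k
   edge-disjoint families of disjoint cycles (orient it evenly and apply Hall's
   theorem k times).  The point is that two such families CC and DD are the sum
   of three paths, and of three cycles: cut every cycle at one edge, so that the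
   cut cycles of CC, those of DD, and the removed edges form three linear forests,
   every end of which lies in exactly two of them.  If the first two forests share
   an odd number of ends, each forest can be linked into one path by edges that
   are added to two of them at once, until three ends a, b, c remain and the
   paths are a-b, b-c, c-a.  For cycles the number of shared ends is made even
   and the forests are split into two parts of the odd kind, each of which gives
   a triangle of paths; corresponding paths close up to three cycles.  Treating
   the families in pairs gives ceil(3k/2).

   With 2m vertices of odd degree, m <= 2k, two new vertices are joined to them so
   that all degrees become even and at most 2k, and are then deleted from the k
   families, which leaves m paths in all, at most two in each family.  A family
   with two paths is a sum of two paths.  Of two families with one path each, the
   second path is closed by an edge, and the first family with that edge added is
   a sum of two paths.  The families without paths are treated together by the
   Eulerian case, as their sum is an even graph.  If m > 2k, edges between odd
   vertices are taken as paths of the cover until m = 2k. *)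

Require Import Defs.
From HB Require Import structures.
From mathcomp Require Import all_boot all_order all_algebra.
From Stdlib Require Import Ring.
From mathcomp Require Import zify.

Set Implicit Arguments.
Unset Strict Implicit.
Unset Printing Implicit Defensive.

(** The difficulty is parity. A forest has an even number of ends, so the three numbers of ends
    shared by two forests have the same parity; linking lowers them by two, so one shared end per
    pair of forests is reached only from the odd case. The parity is steered by the choice of the
    cuts: a cycle cut at the edge [xy] raises the number of ends shared by the first two forests by
    the number of vertices among [x], [y] that already lie on removed edges. A cut is admissible
    only if the removed edges stay acyclic. An end that lies on cycles of one family only may also
    be counted as a one-vertex cycle of the other family, which changes the parity and adds no edge.
    In the even case, a component of the removed edges whose two ends belong to different families
    separates the system: the part attached to it and the rest are both odd. Such a component exists
    by counting as long as the parity is odd, so the last cycle is cut away from it. This needs two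
    cycles of different families that cross. Without such a pair, cycles that meet are nested, and
    the two families split into two vertex-disjoint pairs. *)

Lemma addb_ring_theory : ring_theory false true addb andb addb id (@eq bool).
Proof. by split => //; do 3?case. Qed.

Lemma eqb_ok (a b : bool) : a == b = true -> a = b.
Proof. by move/eqP. Qed.

Add Ring addb_ring : addb_ring_theory (decidable eqb_ok).

Ltac abstract_atom t :=
  lazymatch t with
  | addb _ _ => fail
  | true => fail
  | false => fail
  | _ => tryif is_var t then fail else (let v := fresh "v" in move: (t) => v)
  end.

(* The atoms are generalized first because ring compares them syntactically,
   while they often differ by canonical structure projections. *)
Ltac xring :=
  repeat match goal with
  | |- context [addb ?a ?b] => first [abstract_atom a | abstract_atom b]
  end; ring.

(** * Sums of paths and closed walks *)

Section EdgeSums.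

Variable T : finType.
Implicit Types (s t : seq T) (P Q L : seq (seq T)) (e : {set T}) (a b x y : T).

(** A degenerate pair counts as no edge, so that one-vertex walks and their closing steps contribute
    nothing. *)
Definition xe a b e : bool := (a != b) && (e == [set a; b]).

Lemma xeC a b e : xe a b e = xe b a e.
Proof. by rewrite /xe eq_sym setUC. Qed.

Lemma xexx a e : xe a a e = false.
Proof. by rewrite /xe eqxx. Qed.

(* pth, pe and ce count edges modulo 2, so that ce vanishes on a closed walk with
   two vertices. *)
Fixpoint pth x s e : bool := if s is y :: s' then xe x y e (+) pth y s' e else false.

Definition pe s e : bool := if s is x :: s' then pth x s' e else false.

Definition ce s e : bool :=
  if s is x :: s' then pth x s' e (+) xe (last x s') x e else false.

Definition pes P e : bool := \big[addb/false]_(s <- P) pe s e.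
Definition ces P e : bool := \big[addb/false]_(s <- P) ce s e.

(** A one-vertex sequence lists its vertex twice, so every nonempty component has exactly two ends,
    counted with multiplicity. *)
Definition ends s : seq T := if s is x :: s' then [:: x; last x s'] else [::].
Definition endss P : seq T := flatten [seq ends s | s <- P].

Lemma pth_cat x s t e : pth x (s ++ t) e = pth x s e (+) pth (last x s) t e.
Proof. by elim: s x => [|y s IH] x //=; rewrite IH; ring. Qed.

Lemma pe_cat s x t e : pe (s ++ x :: t) e = pe (rcons s x) e (+) pe (x :: t) e.
Proof. by case: s => [|y s] //=; rewrite -cats1 !pth_cat /=; ring. Qed.

Lemma pe_cat2 x s y t e :
  pe ((x :: s) ++ y :: t) e = pe (x :: s) e (+) xe (last x s) y e (+) pe (y :: t) e.
Proof. by rewrite /= pth_cat /=; ring. Qed.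

Lemma pe_rcons x s y e : pe (rcons (x :: s) y) e = pe (x :: s) e (+) xe (last x s) y e.
Proof. by rewrite -cats1 pe_cat2 /=; ring. Qed.

Lemma pe_rcat s x y t e :
  pe (rcons s x ++ y :: t) e = pe (rcons s x) e (+) xe x y e (+) pe (y :: t) e.
Proof. by case: s => [|z s] //; rewrite rcons_cons pe_cat2 last_rcons. Qed.

Lemma pe_rev s e : pe (rev s) e = pe s e.
Proof.
elim: s => [|x s IH] //; rewrite rev_cons.
case: s IH => [|y s] // IH; rewrite rev_cons -cats1 cat_rcons pe_cat -rev_cons IH.
by rewrite /= (xeC y); ring.
Qed.

Lemma ceE x s e : ce (x :: s) e = pe (x :: s) e (+) xe (last x s) x e.
Proof. by []. Qed.

Lemma ce_rcons x s e : ce (rcons s x) e = ce (x :: s) e.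
Proof. by case: s => [|y s] //=; rewrite last_rcons -cats1 pth_cat /=; ring. Qed.

Lemma ce_cat s t e : ce (s ++ t) e = ce (t ++ s) e.
Proof.
elim: s t => [|x s IH] t; first by rewrite cats0.
by rewrite -cat_rcons -IH -rcons_cat ce_rcons.
Qed.

Lemma ce_rot n s e : ce (rot n s) e = ce s e.
Proof. by rewrite /rot ce_cat cat_take_drop. Qed.

Lemma ceEr x s e : ce (x :: s) e = pe (rcons (x :: s) x) e.
Proof. by rewrite pe_rcons. Qed.

Lemma ce_rev s e : ce (rev s) e = ce s e.
Proof.
case: s => [|x s] //; rewrite rev_cons ce_rcons !ceEr.
by rewrite -[RHS]pe_rev rev_rcons rev_cons.
Qed.

Lemma pes_cons s P e : pes (s :: P) e = pe s e (+) pes P e.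
Proof. by rewrite /pes big_cons. Qed.

Lemma pes_nil e : pes [::] e = false.
Proof. by rewrite /pes big_nil. Qed.

Lemma pes_cat P Q e : pes (P ++ Q) e = pes P e (+) pes Q e.
Proof. by rewrite /pes big_cat. Qed.

Lemma pes_perm P Q e : perm_eq P Q -> pes P e = pes Q e.
Proof. exact: perm_big. Qed.

Lemma ces_cons s P e : ces (s :: P) e = ce s e (+) ces P e.
Proof. by rewrite /ces big_cons. Qed.

Lemma ces_nil e : ces [::] e = false.
Proof. by rewrite /ces big_nil. Qed.

Lemma ces_cat P Q e : ces (P ++ Q) e = ces P e (+) ces Q e.
Proof. by rewrite /ces big_cat. Qed.

Lemma ces_perm P Q e : perm_eq P Q -> ces P e = ces Q e.
Proof. exact: perm_big. Qed.

(* Joining the components of L consecutively, and joining the pairs of their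
   extremities in the same order, uses the same connecting edges twice. *)
Lemma pth_join x L t e : [::] \notin L ->
  pth x (flatten L ++ t) e (+) pth x (endss L ++ t) e = ces L e.
Proof.
elim: L x => [|[|y s] L IH] x; rewrite ?in_cons ?eqxx ?ces_nil ?addbb //=.
by move=> /(IH (last y s)) IHL; rewrite ces_cons -IHL -/(endss L) -catA pth_cat /= (xeC y); ring.
Qed.

(** The cyclic form of the same cancellation. It makes a family of disjoint cycles the sum of two
    cycles, one through all vertices and one through the ends of the cuts. *)
Lemma ce_join L e : [::] \notin L ->
  ce (flatten L) e (+) ce (endss L) e = ces L e.
Proof.
case: L => [|[|x s] L]; rewrite ?in_cons ?eqxx ?ces_nil // => nL.
have cE u : ce (x :: u) e = pth x (u ++ [:: x]) e by rewrite ceEr cats1.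
have -> : flatten ((x :: s) :: L) = x :: (s ++ flatten L) by [].
have -> : endss ((x :: s) :: L) = x :: last x s :: endss L by [].
rewrite !cE ces_cons ceE /= -(pth_join (last x s) [:: x] e nL) -/(endss L) -catA pth_cat.
by rewrite (xeC x); ring.
Qed.

Lemma flatten_cons s P : flatten (s :: P) = s ++ flatten P.
Proof. by []. Qed.

Lemma mem_flatten_cons x s P : (x \in flatten (s :: P)) = (x \in s) || (x \in flatten P).
Proof. by rewrite flatten_cons mem_cat. Qed.

Lemma endss_cat P Q : endss (P ++ Q) = endss P ++ endss Q.
Proof. by rewrite /endss map_cat flatten_cat. Qed.

Lemma perm_endss P Q : perm_eq P Q -> perm_eq (endss P) (endss Q).
Proof. by move=> pPQ; apply/perm_flatten/perm_map. Qed.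

Lemma mem_ends s x : x \in ends s -> x \in s.
Proof.
case: s => [|y s] //=; rewrite !inE => /orP[/eqP->|/eqP->]; rewrite ?eqxx //.
by have := mem_last y s; rewrite inE.
Qed.

Lemma endssP P x : reflect (exists2 s, s \in P & x \in ends s) (x \in endss P).
Proof. exact: flatten_mapP. Qed.

Lemma mem_endss P x : x \in endss P -> x \in flatten P.
Proof. by case/endssP=> s sP /mem_ends xs; apply/flattenP; exists s. Qed.

Lemma ends_rcons t b : ends (rcons t b) = [:: head b t; b].
Proof. by case: t => [|x t] //=; rewrite last_rcons. Qed.

Lemma size_endss P : [::] \notin P -> size (endss P) = (size P).*2.
Proof.
elim: P => [|[|x s] P IH] //=; rewrite in_cons /= => /IH.
by rewrite /endss /= => ->.
Qed.

Lemma orient_head s b : b \in ends s ->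
  exists t, [/\ perm_eq (b :: t) s, pe (b :: t) =1 pe s
              & perm_eq (ends (b :: t)) (ends s)].
Proof.
case: s => [|x s] // bs; have {bs} /orP[/eqP->|/eqP->] : (b == x) || (b == last x s).
- by move: bs; rewrite !inE.
- by exists s.
case/lastP: s => [|s y]; first by exists [::].
exists (rev (x :: s)); rewrite last_rcons -rev_rcons; split.
- by rewrite perm_rev.
- by move=> e; rewrite pe_rev.
- by rewrite rev_rcons rev_cons /= !last_rcons (perm_catC [:: y]).
Qed.

Lemma orient_last s b : b \in ends s ->
  exists t, [/\ perm_eq (rcons t b) s, pe (rcons t b) =1 pe s
              & perm_eq (ends (rcons t b)) (ends s)].
Proof.
case/orient_head=> t [p1 p2 p3]; exists (rev t); rewrite -rev_cons; split.
- by rewrite perm_rev.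
- by move=> e; rewrite pe_rev.
apply: perm_trans p3; rewrite rev_cons ends_rcons.
case/lastP: t {p1 p2} => [|t y] //; rewrite rev_rcons /= last_rcons.
by rewrite (perm_catC [:: y]).
Qed.

Lemma flatten_uniq_eq P s t x : uniq (flatten P) ->
  s \in P -> t \in P -> x \in s -> x \in t -> s = t.
Proof.
elim: P => [|u P IH] //=; rewrite cat_uniq => /and3P[_ /hasPn dis uP].
rewrite !inE => /orP[/eqP->|sP] /orP[/eqP->|tP] // xs xt; last exact: IH.
- by have /dis/negP[] : x \in flatten P by apply/flattenP; exists t.
- by have /dis/negP[] : x \in flatten P by apply/flattenP; exists s.
Qed.

(** The two components are reversed where necessary and concatenated at [b b']. The last clauses
    follow the components: they only grow, and those without [b] and [b'] survive unchanged.
    Coherence and the preservation of a chosen component rest on this. *)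
Lemma link P b b' : uniq (flatten P) -> [::] \notin P ->
    b \in endss P -> b' \in endss P ->
    (forall s, s \in P -> b \in s -> b' \in s -> False) ->
  exists P', [/\ perm_eq (flatten P') (flatten P), [::] \notin P',
    perm_eq (b :: b' :: endss P') (endss P),
    forall e, pes P' e = pes P e (+) xe b b' e &
    [/\ forall s, s \in P -> exists2 s', s' \in P' & {subset s <= s'},
    exists s', [/\ s' \in P', b \in s' & b' \in s'] &
    forall s, s \in P -> b \notin s -> b' \notin s -> s \in P']].
Proof.
move=> uP nP /endssP[s sP bs] /endssP[s' s'P b's'] sep.
have ns : s != s' by apply/eqP=> ss; apply: (sep s sP (mem_ends bs)); rewrite ss mem_ends.
have pP : perm_eq P (s :: s' :: rem s' (rem s P)).
  apply: perm_trans (perm_to_rem sP) _; rewrite perm_cons perm_to_rem //.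
  have : s' \in s :: rem s P by rewrite -(perm_mem (perm_to_rem sP)).
  by rewrite inE eq_sym (negPf ns).
set R := rem s' (rem s P) in pP.
have [t [pt et nt]] := orient_last bs; have [t' [pt' et' nt']] := orient_head b's'.
exists ((rcons t b ++ b' :: t') :: R); split.
- rewrite /= -catA perm_sym; apply: perm_trans (perm_flatten pP) _ => /=.
  by rewrite perm_sym perm_cat // -cat_cons perm_cat.
- move: nP; rewrite (perm_mem pP) !inE !negb_or => /and3P[_ _ ->].
  by rewrite andbT; case: (t).
- rewrite perm_sym; apply: perm_trans (perm_endss pP) _.
  rewrite /endss /= perm_sym; set N := flatten _.
  have -> : ends (rcons t b ++ b' :: t') = [:: head b t; last b' t'].
    by case: (t) => [|y u] //=; rewrite last_cat.
  apply: (@perm_trans _ (ends (rcons t b) ++ ends (b' :: t') ++ N)); last first.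
    by rewrite perm_cat // perm_cat.
  by rewrite ends_rcons /=; have /permPl := perm_catCA [:: b; b'] [:: head b t] (last b' t' :: N).
- by move=> e; rewrite (pes_perm _ pP) !pes_cons -et -et' pe_rcat; ring.
split.
- move=> u; rewrite (perm_mem pP) !inE => /or3P[/eqP->|/eqP->|uR].
  + by eexists; [exact: mem_head | move=> z; rewrite mem_cat (perm_mem pt) => ->].
  + by eexists; [exact: mem_head | move=> z; rewrite mem_cat (perm_mem pt') orbC => ->].
  + by exists u => //; rewrite inE uR orbT.
- by eexists; split; [exact: mem_head| |]; rewrite mem_cat ?mem_rcons ?inE ?eqxx ?orbT.
- move=> u; rewrite (perm_mem pP) !inE => /or3P[/eqP->|/eqP->|->]; rewrite ?orbT //.
  + by rewrite mem_ends.
  + by move=> _; rewrite mem_ends.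
Qed.

End EdgeSums.

(** * Three linear forests *)

Section Linking.

Variable T : finType.
Implicit Types (s t W E F A : seq T) (P Q : seq (seq T)) (e : {set T}) (x y : T).

Definition forest P A := [/\ uniq (flatten P), [::] \notin P & perm_eq (endss P) A].

(* Three linear forests whose ends are paired up: W collects the common ends of
   the first two, E those of the first and third, F those of the last two. *)
Definition linked P1 P2 P3 W E F :=
  [/\ forest P1 (W ++ E), forest P2 (W ++ F), forest P3 (E ++ F)
    & [/\ uniq W, uniq E & uniq F]].

Definition same P x y := has (fun s => (x \in s) && (y \in s)) P.

Lemma sameP P x y :
  reflect (exists s, [/\ s \in P, x \in s & y \in s]) (same P x y).
Proof.
apply: (iffP hasP) => [[s sP /andP[]]|[s [sP xs ys]]]; first by exists s.
by exists s; rewrite ?xs.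
Qed.

Lemma end_in P K x : uniq (flatten P) -> K \in P -> x \in K -> x \in endss P -> x \in ends K.
Proof. by move=> uP KP xK /endssP[s sP xs]; rewrite (flatten_uniq_eq uP KP sP xK (mem_ends xs)). Qed.

Lemma three_ends P K x y z : uniq (flatten P) -> K \in P ->
  {subset [:: x; y; z] <= K} -> {subset [:: x; y; z] <= endss P} -> ~~ uniq [:: x; y; z].
Proof.
move=> uP KP sK sE; apply/negP=> u.
have sub : {subset [:: x; y; z] <= ends K}.
  by move=> w wx; apply: (end_in uP KP); [apply: sK | apply: sE].
by have := uniq_leq_size u sub; case: (K).
Qed.

Lemma three_ends_same P x y z : uniq (flatten P) ->
  {subset [:: x; y; z] <= endss P} -> uniq [:: x; y; z] -> same P x y -> same P x z -> False.
Proof.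
move=> uP sE u /sameP[K [KP xK yK]] /sameP[K' [K'P xK' zK']].
rewrite -(flatten_uniq_eq uP KP K'P xK xK') in zK'.
have := three_ends uP KP _ sE; rewrite u => /(_ _)/negP; apply => // w.
by rewrite !inE => /or3P[]/eqP->.
Qed.

Lemma sameC P x y : same P x y = same P y x.
Proof. by apply: eq_has => s; rewrite andbC. Qed.

Lemma forest_perm P A B : perm_eq A B -> forest P A -> forest P B.
Proof. by move=> pAB [uP nP pA]; split=> //; exact: perm_trans pAB. Qed.

Lemma forest_link P A b b' : forest P (b :: b' :: A) -> ~~ same P b b' ->
  exists P', [/\ forest P' A, perm_eq (flatten P') (flatten P)
   & forall e, pes P' e = pes P e (+) xe b b' e].
Proof.
move=> [uP nP pA] ns.
have [| |s sP bs b's|P' [fP nP' pP' eP' _]] := @link _ P b b' uP nP.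
- by rewrite (perm_mem pA) mem_head.
- by rewrite (perm_mem pA) !inE eqxx orbT.
- by case/sameP: ns; exists s.
exists P'; split=> //; split=> //; first by rewrite (perm_uniq fP).
by have := perm_trans pP' pA; rewrite !perm_cons.
Qed.

(** A component has two ends, so each forest has at most one of the three pairs among [x], [y], [z]
    in a common component. Two forests spoil at most two pairs. *)
Lemma linked_same_pair P1 P2 W x y z : uniq (flatten P1) -> uniq (flatten P2) ->
  {subset W <= endss P1} -> {subset W <= endss P2} ->
  {subset [:: x; y; z] <= W} -> uniq [:: x; y; z] ->
  exists b b', [/\ b != b', {subset [:: b; b'] <= W}, ~~ same P1 b b' & ~~ same P2 b b'].
Proof.
move=> u1 u2 s1 s2 sW u.
have ex b b' : b != b' -> b \in [:: x; y; z] -> b' \in [:: x; y; z] ->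
   ~~ (same P1 b b' || same P2 b b') ->
   exists b b', [/\ b != b', {subset [:: b; b'] <= W}, ~~ same P1 b b' & ~~ same P2 b b'].
  move=> bb' bx b'x; rewrite negb_or => /andP[n1 n2]; exists b, b'; split=> // w.
  by rewrite !inE => /orP[]/eqP->; apply: sW.
have [xy xz yz] : [/\ x != y, x != z & y != z].
  by move: u; rewrite /= !inE negb_or -!andbA => /and4P[].
case: (boolP (same P1 x y || same P2 x y)) => [sxy|]; last by apply: ex; rewrite // !inE eqxx ?orbT.
case: (boolP (same P1 x z || same P2 x z)) => [sxz|]; last by apply: ex; rewrite // !inE eqxx ?orbT.
case: (boolP (same P1 y z || same P2 y z)) => [syz|]; last by apply: ex; rewrite // !inE eqxx ?orbT.
have T1 p q r : {subset [:: p; q; r] <= [:: x; y; z]} -> uniq [:: p; q; r] -> same P1 p q -> same P1 p r -> False.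
  by move=> pq; apply: three_ends_same => // w /pq /sW/s1.
have T2 p q r : {subset [:: p; q; r] <= [:: x; y; z]} -> uniq [:: p; q; r] -> same P2 p q -> same P2 p r -> False.
  by move=> pq; apply: three_ends_same => // w /pq /sW/s2.
have per p q r : perm_eq [:: p; q; r] [:: x; y; z] -> {subset [:: p; q; r] <= [:: x; y; z]} /\ uniq [:: p; q; r].
  by move=> pp; rewrite (perm_uniq pp); split=> // w; rewrite (perm_mem pp).
have [i1 v1] := per _ _ _ (perm_refl _).
have /per[i2 v2] : perm_eq [:: y; x; z] [:: x; y; z] by have /permPl := perm_catCA [:: y] [:: x] [:: z].
have /per[i3 v3] : perm_eq [:: z; x; y] [:: x; y; z] by have /permPl := perm_catC [:: z] [:: x; y].
(* Of three spoiled pairs two fall to the same forest, and any two pairs share a vertex, which would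
   give a component with three ends. *)
exfalso; have := (T1 _ _ _ i1 v1, T1 _ _ _ i2 v2, T1 _ _ _ i3 v3, T2 _ _ _ i1 v1, T2 _ _ _ i2 v2, T2 _ _ _ i3 v3).
rewrite !(sameC _ y x) !(sameC _ z x) !(sameC _ z y).
case/orP: sxy => ->; case/orP: sxz => ->; case/orP: syz => -> [[[[[a1 a2] a3] a4] a5] a6];
  first [by apply: a1 | by apply: a2 | by apply: a3 | by apply: a4 | by apply: a5 | by apply: a6].
Qed.

(** The edge [b b'] is added to both forests that share these ends, so it cancels in the sum. *)
Lemma linked_reduce P1 P2 P3 W E F : linked P1 P2 P3 W E F -> 2 < size W ->
  exists P1' P2' W', [/\ (size W').+2 = size W, linked P1' P2' P3 W' E F,
     perm_eq (flatten P1') (flatten P1), perm_eq (flatten P2') (flatten P2)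
   & forall e, pes P1' e (+) pes P2' e = pes P1 e (+) pes P2 e].
Proof.
move=> [f1 f2 f3 [uW uE uF]].
case eW: {1 2}W => [|x [|y [|z W0]]] // _.
have [u1 _ p1] := f1; have [u2 _ p2] := f2.
have s1 : {subset W <= endss P1} by move=> w wW; rewrite (perm_mem p1) mem_cat wW.
have s2 : {subset W <= endss P2} by move=> w wW; rewrite (perm_mem p2) mem_cat wW.
have [||b [b' [bb' bW n1 n2]]] := linked_same_pair u1 u2 s1 s2 (x := x) (y := y) (z := z).
- by rewrite eW => w; rewrite !inE => /or3P[]->; rewrite ?orbT.
- by have := uW; rewrite eW -[x :: _]/([:: x; y; z] ++ W0) cat_uniq => /and3P[].
have pW : perm_eq W (b :: b' :: rem b' (rem b W)).
  have bW0 : b \in W by rewrite bW ?mem_head.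
  apply: perm_trans (perm_to_rem bW0) _; rewrite perm_cons perm_to_rem //.
  have : b' \in b :: rem b W by rewrite -(perm_mem (perm_to_rem bW0)) bW // !inE eqxx orbT.
  by rewrite inE eq_sym (negPf bb').
set W' := rem b' _ in pW.
have pX X : perm_eq (W ++ X) (b :: b' :: (W' ++ X)) by rewrite (perm_cat2r X W (b :: b' :: W')).
have [P1' [g1 q1 e1]] := forest_link (forest_perm (pX E) f1) n1.
have [P2' [g2 q2 e2]] := forest_link (forest_perm (pX F) f2) n2.
exists P1', P2', W'; split=> //.
- by rewrite -?eW (perm_size pW).
- split=> //; split=> //.
  by move: uW; rewrite (perm_uniq pW) /= => /and3P[].
- by move=> e; rewrite e1 e2; ring.
Qed.

(** The first two forests have [|W| + |E|] and [|W| + |F|] ends, and both numbers are even. *)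
Lemma linked_parity P1 P2 P3 W E F : linked P1 P2 P3 W E F ->
  odd (size W) = odd (size E) /\ odd (size W) = odd (size F).
Proof.
move=> [[_ n1 p1] [_ n2 p2] _ _].
have := perm_size p1; have := perm_size p2; rewrite !size_endss // !size_cat.
by move=> h2 h1; have := odd_double (size P1); have := odd_double (size P2); rewrite h1 h2 !oddD; do 3!case: (odd _).
Qed.

(** By this cyclic symmetry the reduction of [W] also serves for [E] and [F]. *)
Lemma linked_rot P1 P2 P3 W E F : linked P1 P2 P3 W E F -> linked P3 P1 P2 E F W.
Proof.
move=> [f1 f2 f3 [uW uE uF]]; split=> //; first by apply: forest_perm f1; rewrite perm_catC.
by apply: forest_perm f2; rewrite perm_catC.
Qed.

(** Odd sizes drop by two until each is one. Every forest then has two ends and is a single path. *)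
Lemma linked_reduce_all P1 P2 P3 W E F : linked P1 P2 P3 W E F -> odd (size W) ->
  exists P1' P2' P3' a b c, [/\ linked P1' P2' P3' [:: b] [:: a] [:: c],
     perm_eq (flatten P1') (flatten P1), perm_eq (flatten P2') (flatten P2),
     perm_eq (flatten P3') (flatten P3)
   & forall e, pes P1' e (+) pes P2' e (+) pes P3' e = pes P1 e (+) pes P2 e (+) pes P3 e].
Proof.
have [n] := ubnP (size W + size E + size F).
elim: n P1 P2 P3 W E F => // n IH P1 P2 P3 W E F ltn lk oW.
have [oE oF] := linked_parity lk.
case: (ltnP 2 (size W)) => [W3|W3].
  have [Q1 [Q2 [W' [sW lk' q1 q2 eq]]]] := linked_reduce lk W3.
  have [| |R1 [R2 [R3 [a [b [c [lkR r1 r2 r3 eR]]]]]]] := IH _ _ _ _ _ _ _ lk'.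
  - by lia.
  - by move: oW; rewrite -sW /= negbK.
  exists R1, R2, R3, a, b, c; split=> //.
  + exact: perm_trans q1.
  + exact: perm_trans q2.
  + by move=> e; rewrite eR eq.
case: (ltnP 2 (size E)) => [E3|E3].
  have [Q3 [Q1 [E' [sE lk' q3 q1 eq]]]] := linked_reduce (linked_rot lk) E3.
  have [| |R1 [R2 [R3 [a [b [c [lkR r1 r2 r3 eR]]]]]]] := IH _ _ _ _ _ _ _ (linked_rot (linked_rot lk')).
  - by lia.
  - by [].
  exists R1, R2, R3, a, b, c; split=> //.
  + exact: perm_trans q1.
  + exact: perm_trans q3.
  + move=> e; rewrite eR; have -> : pes Q1 e (+) pes P2 e (+) pes Q3 e
      = pes Q3 e (+) pes Q1 e (+) pes P2 e by ring.
    by rewrite eq; ring.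
case: (ltnP 2 (size F)) => [F3|F3].
  have [Q2 [Q3 [F' [sF lk' q2 q3 eq]]]] := linked_reduce (linked_rot (linked_rot lk)) F3.
  have [| |R1 [R2 [R3 [a [b [c [lkR r1 r2 r3 eR]]]]]]] := IH _ _ _ _ _ _ _ (linked_rot lk').
  - by lia.
  - by [].
  exists R1, R2, R3, a, b, c; split=> //.
  + exact: perm_trans q2.
  + exact: perm_trans q3.
  + by move=> e; rewrite eR -!addbA eq.
have one (u : seq T) : odd (size u) -> size u <= 2 -> exists x, u = [:: x].
  by case: u => [|x [|y [|z u]]] // _ _; exists x.
have [b eW] := one _ oW W3.
have [a eE] := one _ (etrans (esym oE) oW) E3.
have [c eF] := one _ (etrans (esym oF) oW) F3.
by exists P1, P2, P3, a, b, c; rewrite -eW -eE -eF; split.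
Qed.

(** A triangle of paths with corners [a], [b], [c] on prescribed vertex sets. The corners are
    recorded because two triangles are closed up along them. *)
Definition triple (V1 V2 V3 : seq T) (phi : {set T} -> bool) :=
  exists z1 z2 z3 a b c,
   [/\ [/\ perm_eq (a :: z1) V1, perm_eq (b :: z2) V2 & perm_eq (c :: z3) V3],
       [/\ last a z1 = b, last b z2 = c & last c z3 = a]
     & forall e, pe (a :: z1) e (+) pe (b :: z2) e (+) pe (c :: z3) e = phi e].

Lemma forest2 P a b : forest P [:: a; b] ->
  exists z, [/\ perm_eq (a :: z) (flatten P), last a z = b & pe (a :: z) =1 pes P].
Proof.
move=> [uP nP pA].
have := perm_size pA; rewrite size_endss //; case: P uP nP pA => [|s [|t P]] //= uP nP pA _.
rewrite /endss /= cats0 in pA.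
have [|z [pz ez nz]] := @orient_head _ s a; first by rewrite (perm_mem pA) mem_head.
exists z; split; first by rewrite cats0.
- by move: (perm_trans nz pA) => /=; rewrite perm_cons => /perm_mem/(_ b); rewrite !inE eqxx => /eqP.
- by move=> e; rewrite ez pes_cons pes_nil addbF.
Qed.

Lemma linked_triple P1 P2 P3 W E F : linked P1 P2 P3 W E F -> odd (size W) ->
  triple (flatten P1) (flatten P2) (flatten P3)
     (fun e => pes P1 e (+) pes P2 e (+) pes P3 e).
Proof.
move=> lk oW; have [Q1 [Q2 [Q3 [a [b [c [[f1 f2 f3 _] q1 q2 q3 eQ]]]]]]] := linked_reduce_all lk oW.
have pC (x y : T) : perm_eq [:: x; y] [:: y; x] by rewrite (perm_catC [:: x]).
have [z1 [p1 l1 e1]] := forest2 (forest_perm (pC _ _) f1).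
have [z2 [p2 l2 e2]] := forest2 f2.
have [z3 [p3 l3 e3]] := forest2 (forest_perm (pC _ _) f3).
exists z1, z2, z3, a, b, c; split; first by split; [exact: perm_trans q1|exact: perm_trans q2|exact: perm_trans q3].
  by [].
by move=> e; rewrite e1 e2 e3 eQ.
Qed.

(** The closed walk follows one path, crosses by [b b'], runs back along the other and returns by
    [a' a]. *)
Lemma close_pair a z b a' z' b' e : last a z = b -> last a' z' = b' ->
  ce ((a :: z) ++ rev (a' :: z')) e =
  pe (a :: z) e (+) pe (a' :: z') e (+) (xe a a' e (+) xe b b' e).
Proof.
move=> <- <-; rewrite -[pe (a' :: _) e]pe_rev.
have : last a' z' = head a' (rev (a' :: z')).
  by case/lastP: (z') => [|u y] //; rewrite last_rcons -rcons_cons rev_rcons.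
have : last a (z ++ rev (a' :: z')) = a' by rewrite last_cat rev_cons last_rcons.
case: (rev (a' :: z')) (size_rev (a' :: z')) => [|y u] // _ la ->.
by rewrite cat_cons ceE la -cat_cons pe_cat2 (xeC a a') /=; ring.
Qed.

(** Every corner belongs to two paths of its triangle, so each of the edges [a a'], [b b'], [c c']
    is used by two of the closed walks and cancels. *)
Lemma two_triples_cycles U1 U2 U3 V1 V2 V3 phi psi :
  triple U1 U2 U3 phi -> triple V1 V2 V3 psi ->
  uniq (U1 ++ V1) -> uniq (U2 ++ V2) -> uniq (U3 ++ V3) ->
  exists c1 c2 c3, [/\ uniq c1, uniq c2, uniq c3
    & forall e, ce c1 e (+) ce c2 e (+) ce c3 e = phi e (+) psi e].
Proof.
move=> [z1 [z2 [z3 [a [b [c [[p1 p2 p3] [l1 l2 l3] eZ]]]]]]].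
move=> [y1 [y2 [y3 [a' [b' [c' [[q1 q2 q3] [m1 m2 m3] eY]]]]]]] u1 u2 u3.
have up p q (U V : seq T) : perm_eq p U -> perm_eq q V -> uniq (U ++ V) -> uniq (p ++ rev q).
  move=> pU qV; rewrite (@perm_uniq _ (p ++ rev q) (U ++ V)) //.
  by rewrite perm_cat // perm_rev.
exists ((a :: z1) ++ rev (a' :: y1)), ((b :: z2) ++ rev (b' :: y2)), ((c :: z3) ++ rev (c' :: y3)).
split; [exact: up u1 | exact: up u2 | exact: up u3|].
by move=> e; rewrite (close_pair _ l1 m1) (close_pair _ l2 m2) (close_pair _ l3 m3) -eZ -eY; xring.
Qed.

End Linking.

(** * Cut cycles and the forest of removed edges *)

Section Systems.

Variable T : finType.
Implicit Types (s t K W E F A : seq T) (P Q CC DD : seq (seq T)) (e : {set T}) (x y k : T).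

(** The removed edge joins the two ends of a cut cycle, so both lie in one component of the removed
    edges. This is what allows a system to be split along such a component. *)
Definition coherent P Q := forall s, s \in P -> exists2 K, K \in Q & {subset ends s <= K}.

(* P1 and P2 are cycles of CC and DD, each cut at one edge; P3 is the linear
   forest formed by the removed edges. *)
Definition sys CC DD P1 P2 P3 W E F :=
  [/\ linked P1 P2 P3 W E F,
      [/\ perm_eq (flatten P1) (flatten CC), perm_eq (flatten P2) (flatten DD) & uniq (E ++ F)],
      {subset flatten P3 <= W ++ E ++ F},
      coherent P1 P3 /\ coherent P2 P3
    & forall e, pes P1 e (+) pes P2 e (+) pes P3 e = ces CC e (+) ces DD e].

Lemma sys_sym CC DD P1 P2 P3 W E F : sys CC DD P1 P2 P3 W E F -> sys DD CC P2 P1 P3 W F E.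
Proof.
move=> [[f1 f2 f3 [uW uE uF]] [q1 q2 u] sub [c1 c2] eq]; split=> //.
- by split=> //; apply: forest_perm f3; rewrite perm_catC.
- by split=> //; rewrite uniq_catC.
- by move=> z /sub; rewrite !mem_cat [(z \in E) || _]orbC.
- by move=> e; rewrite [RHS]addbC -eq; xring.
Qed.

Lemma sys_sub CC DD P1 P2 P3 W E F : sys CC DD P1 P2 P3 W E F ->
  [/\ {subset W ++ E <= flatten CC}, {subset W ++ F <= flatten DD} & {subset E ++ F <= flatten P3}].
Proof.
move=> [[[_ _ p1] [_ _ p2] [_ _ p3] _] [q1 q2 _] _ _ _]; split=> z.
- by rewrite -(perm_mem p1) -(perm_mem q1); apply: mem_endss.
- by rewrite -(perm_mem p2) -(perm_mem q2); apply: mem_endss.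
- by rewrite -(perm_mem p3); apply: mem_endss.
Qed.

(** Members of [W] and [E] are ends of cut cycles of [CC], so outside [CC] only [F] remains. *)
Lemma sys_contact CC DD P1 P2 P3 W E F x : sys CC DD P1 P2 P3 W E F ->
  x \notin flatten CC -> (x \in flatten P3) = (x \in F).
Proof.
move=> S xC; have [s1 _ s3] := sys_sub S; case: S => _ _ sub _ _.
apply/idP/idP => [/sub|xF]; last by apply: s3; rewrite mem_cat xF orbT.
rewrite catA mem_cat => /orP[/s1 xC'|//]; by rewrite xC' in xC.
Qed.

(** End counts for [sys_add], here and in the next two lemmas: of the two ends [xy] of a removed
    edge, [fr] are new to the forest of removed edges and [ct] already lie on it. *)
Lemma perm_add_cut (fr ct A B B' xy N N' : seq T) :
  perm_eq (fr ++ ct) xy -> perm_eq (ct ++ B') B -> perm_eq N (A ++ B) ->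
  perm_eq (xy ++ N') (fr ++ fr ++ N) -> perm_eq N' ((fr ++ A) ++ B').
Proof.
move=> /permP p1 /permP p2 /permP p3 /permP p4; apply/permP => f.
move: (p1 f) (p2 f) (p3 f) (p4 f); rewrite !count_cat; clear; lia.
Qed.

Lemma perm_add_new (fr ct A B xy N : seq T) :
  perm_eq (fr ++ ct) xy -> perm_eq N (A ++ B) -> perm_eq (xy ++ N) ((ct ++ A) ++ (fr ++ B)).
Proof.
move=> /permP p1 /permP p2; apply/permP => f.
move: (p1 f) (p2 f); rewrite !count_cat; clear; lia.
Qed.

Lemma perm_add_old (ct A B B' : seq T) :
  perm_eq (ct ++ B') B -> perm_eq (A ++ B) ((ct ++ A) ++ B').
Proof.
by move=> /permP p1; apply/permP => f; move: (p1 f); rewrite !count_cat; clear; lia.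
Qed.

(** The new cycle is cut at the edge between [x] and [last x s], which goes to [P3]; the two
    vertices must lie in different components there. An end already on [P3] belongs to [F], since
    the cycle avoids [CC], and moves from [F] to [W]; a new one joins [E]. This gives the change of
    parity. *)
Lemma sys_add CC DD P1 P2 P3 W E F x s : sys CC DD P1 P2 P3 W E F ->
    uniq (x :: s) -> x != last x s -> ~~ has (mem (flatten CC)) (x :: s) ->
    ~~ same P3 x (last x s) ->
  exists P3' W' E' F', [/\ sys ((x :: s) :: CC) DD ((x :: s) :: P1) P2 P3' W' E' F',
    odd (size W') = (x \in flatten P3) (+) (last x s \in flatten P3) (+) odd (size W),
    flatten P3' =i [:: x, last x s & flatten P3],
    forall K, K \in P3 -> x \notin K -> last x s \notin K -> K \in P3'
    & forall z, z \notin [:: x; last x s] -> (z \in F') = (z \in F)].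
Proof.
move=> S us; set y := last x s => xy dis nxy.
have [sC sD s3] := sys_sub S.
have con z : z \in x :: s -> (z \in flatten P3) = (z \in F).
  by move=> zs; apply: (sys_contact S); apply: contra dis => zC; apply/hasP; exists z.
have xs : x \in x :: s := mem_head _ _; have ys : y \in x :: s := mem_last _ _.
case: S => [[f1 f2 [u3 n3 p3] [uW uE uF]] [q1 q2 uEF] sub [c1 c2] eq].
pose fr := [seq z <- [:: x; y] | z \notin flatten P3].
pose ct := [seq z <- [:: x; y] | z \in flatten P3].
pose F' := [seq z <- F | z \notin [:: x; y]].
have uxy : uniq [:: x; y] by rewrite /= inE xy.
have frct : perm_eq (fr ++ ct) [:: x; y].
  by rewrite perm_catC; have /permPl := perm_filterC (mem (flatten P3)) [:: x; y].
have xyS z : z \in [:: x; y] -> z \in x :: s by rewrite !inE => /orP[]/eqP-> //; rewrite -in_cons.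
have ctF : perm_eq (ct ++ F') F.
  have /permPl pF := perm_filterC (mem [:: x; y]) F.
  apply: perm_trans pF; rewrite perm_cat2r; apply: uniq_perm; rewrite ?filter_uniq // => z; rewrite !mem_filter.
  by apply/andP/andP => -[]; [move=> + zx; rewrite con ?xyS // => ->| move=> zx; rewrite -con ?xyS //].
(* New ends enter as one-vertex components, so that adding the removed edge is always a link of two
   components. *)
pose X := [seq [:: z] | z <- fr] ++ P3.
have fX : flatten X = fr ++ flatten P3.
  by rewrite /X flatten_cat; congr (_ ++ _); elim: (fr) => //= z l ->.
have eX : perm_eq (endss X) (fr ++ fr ++ endss P3).
  rewrite /X endss_cat catA perm_cat2r; elim: (fr) => //= z l IH.
  by rewrite /endss /= in IH *; rewrite perm_cons perm_sym (perm_catCA l [:: z]) perm_cons perm_sym.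
have frP : {in fr, forall z, z \notin flatten P3} by move=> z; rewrite mem_filter => /andP[].
have ufr : uniq fr by rewrite filter_uniq.
have uX : uniq (flatten X).
  by rewrite fX cat_uniq u3 ufr andbT; apply/hasPn=> z zP; apply/negP=> /frP; rewrite zP.
have nX : [::] \notin X.
  by rewrite /X mem_cat negb_or n3 andbT; apply/mapP=> -[].
have memx z : z \in [:: x; y] -> z \in endss X.
  rewrite (perm_mem eX) -(perm_mem frct) !mem_cat => /orP[->//|].
  by rewrite mem_filter => /andP[zP zx]; rewrite (perm_mem p3) mem_cat -con ?xyS // zP !orbT.
have [||z|P3' [fP nP pP eP [mP sP kP]]] := @link _ X x y uX nX.
- by rewrite memx ?mem_head.
- by rewrite memx // !inE eqxx orbT.
- rewrite mem_cat => /orP[/mapP[w _ ->]|zP xz yz]; first by rewrite !inE => /eqP<- /eqP yx; rewrite yx eqxx in xy.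
  by case/sameP: nxy; exists z.
have fP' : flatten P3' =i [:: x, y & flatten P3].
  move=> z; rewrite (perm_mem fP) fX -[RHS]/(z \in [:: x; y] ++ flatten P3) !mem_cat.
  rewrite -(perm_mem frct) mem_cat -orbA; congr orb.
  by rewrite mem_filter; case: (z \in flatten P3); rewrite ?orbT ?andFb.
exists P3', (ct ++ W), (fr ++ E), F'.
have frE : ~~ has (mem fr) (E ++ F).
  by apply/hasPn=> z /s3 zP; apply/negP => /frP; rewrite zP.
have sF' : {subset F' <= F} by apply: mem_subseq; apply: filter_subseq.
have uEF' : uniq ((fr ++ E) ++ F').
  rewrite -catA cat_uniq ufr /=; apply/andP; split.
    apply: contra frE => /hasP[z zE zf]; apply/hasP; exists z => //.
    by move: zE; rewrite !mem_cat => /orP[->//|/sF' ->]; rewrite orbT.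
  apply: subseq_uniq uEF; apply: cat_subseq => //; exact: filter_subseq.
have uctW : uniq (ct ++ W).
  rewrite cat_uniq uW filter_uniq // andbT; apply/hasPn=> z zW; apply/negP.
  rewrite mem_filter => /andP[_ /xyS zs]; case/negP: dis; apply/hasP; exists z => //.
  by apply: sC; rewrite mem_cat zW.
have ctP : {subset ct <= flatten P3} by move=> z; rewrite mem_filter => /andP[].
split=> //.
- split.
  + split.
    * case: f1 => [u1 n1 p1]; split.
      - have -> : flatten ((x :: s) :: P1) = (x :: s) ++ flatten P1 by [].
        rewrite cat_uniq us u1 andbT; apply: contra dis => /hasP[z zP zs].
        by apply/hasP; exists z => //; rewrite /= -(perm_mem q1).
      - by rewrite inE.
      - exact: perm_add_new frct p1.
    * by apply: forest_perm f2; apply: perm_add_old ctF.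
    * split; rewrite ?(perm_uniq fP) //.
      by apply: perm_add_cut frct ctF p3 _; apply: perm_trans pP eX.
    * split=> //; first by move: uEF'; rewrite cat_uniq => /andP[].
      by rewrite filter_uniq.
  + by split=> //; exact: (perm_cat (perm_refl (x :: s)) q1).
  + move=> z; rewrite fP' -[_ \in _ :: _]/(z \in [:: x; y] ++ flatten P3) mem_cat => /orP[|/sub].
      by rewrite -(perm_mem frct) !mem_cat => /orP[]->; rewrite ?orbT.
    rewrite !mem_cat -(perm_mem ctF) !mem_cat => /or3P[->|->|/orP[]->]; by rewrite ?orbT.
  + split=> t.
      rewrite inE => /orP[/eqP->|/c1[K KP sK]].
        have [K [KP xK yK]] := sP; exists K => // z.
        by rewrite !inE => /orP[]/eqP->.
      have [|K' K'P sK'] := mP K; first by rewrite mem_cat KP orbT.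
      by exists K' => // z /sK /sK'.
    move=> /c2[K KP sK].
    have [|K' K'P sK'] := mP K; first by rewrite mem_cat KP orbT.
    by exists K' => // z /sK /sK'.
  + move=> e; rewrite pes_cons eP ces_cons ceE -/y (xeC y) /X pes_cat.
    have -> : pes [seq [:: z] | z <- fr] e = false.
      by elim: (fr) => [|z l IH]; rewrite ?pes_nil //= pes_cons IH.
    have := eq e; set a := pes P1 e; set b := pes P2 e; set c := pes P3 e => h.
    have -> : pe (x :: s) e (+) xe x y e (+) ces CC e (+) ces DD e =
              pe (x :: s) e (+) xe x y e (+) (ces CC e (+) ces DD e) by xring.
    by rewrite -h; xring.
- rewrite size_cat oddD /ct /=.
  by case: (x \in _); case: (y \in _).
- by move=> K KP; apply: kP; rewrite mem_cat KP orbT.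
- by move=> z zx; rewrite mem_filter zx.
Qed.

End Systems.

(** * Changing the parity of a system and splitting it *)

Section Systems2.

Variable T : finType.
Implicit Types (s t K W E F A : seq T) (P Q CC DD : seq (seq T)) (e : {set T}) (x y k : T).

(** With an empty second family the removed edges form a matching and no end is shared. *)
Lemma sys_start CC : uniq (flatten CC) -> all (fun s => 1 < size s) CC ->
  sys CC [::] CC [::] [seq ends s | s <- CC] [::] (endss CC) [::].
Proof.
move=> uC /allP sC; have nC : [::] \notin CC by apply/negP=> /sC.
have uE P : [::] \notin P -> {subset P <= CC} -> uniq (flatten P) -> uniq (endss P).
  elim: P => [|s P IH] //; rewrite inE negb_or => /andP[ns nP] sub.
  have -> : flatten (s :: P) = s ++ flatten P by [].
  have -> : endss (s :: P) = ends s ++ endss P by [].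
  rewrite !cat_uniq => /and3P[us dis uP]; rewrite IH ?andbT //; last by move=> t tP; rewrite sub // inE tP orbT.
  apply/andP; split.
    have := sC _ (sub _ (mem_head _ _)); case: (s) us => [|x [|y u]] // us _.
    rewrite /= inE andbT; apply: contraTneq us => ->; rewrite [last _ _]/=.
    by rewrite [uniq _]/= -/(uniq (y :: u)) mem_last.
  apply: contra dis => /hasP[z zP zs]; apply/hasP; exists z; last exact: mem_ends.
  exact: mem_endss.
have eE : endss [seq ends s | s <- CC] = endss CC.
  rewrite /endss -map_comp; congr flatten; apply: eq_map => -[|x s] //=.
have fE : flatten [seq ends s | s <- CC] = endss CC by [].
split.
- split; split=> //.
  + by rewrite fE uE.
  + by apply/mapP => -[[|x s] // /sC].
  + by rewrite eE cats0.
  + exact: uE.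
- by split; rewrite ?cats0 ?uE.
- by move=> z; rewrite fE cats0.
- by split=> // s sCC; exists (ends s); rewrite ?map_f.
- move=> e; rewrite pes_nil ces_nil !addbF /pes /ces big_map -big_split /=.
  apply: eq_bigr => s _; case: s => [|x s] //; rewrite ceE /= (xeC x); xring.
Qed.

(* An end k in F that lies in no cycle of CC may also be treated as a one-vertex
   cycle of CC; this moves k from F to both W and E. *)
Lemma sys_toggle CC DD P1 P2 P3 W E F k : sys CC DD P1 P2 P3 W E F ->
  k \in F -> k \notin flatten CC ->
  sys ([:: k] :: CC) DD ([:: k] :: P1) P2 P3 (k :: W) (k :: E) (rem k F).
Proof.
move=> S kF kC; have [sC sD s3] := sys_sub S.
case: S => [[[u1 n1 p1] f2 f3 [uW uE uF]] [q1 q2 uEF] sub [c1 c2] eq].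
have pF := perm_to_rem kF.
have kEF : perm_eq (E ++ F) ((k :: E) ++ rem k F).
  apply: perm_trans (_ : perm_eq (E ++ k :: rem k F) _); first by rewrite perm_cat2l.
  by rewrite -cat1s perm_catCA.
have kW : k \notin W by apply: contra kC => kW; apply: sC; rewrite mem_cat kW.
split.
- split.
  + split=> //.
    * have -> : flatten ([:: k] :: P1) = k :: flatten P1 by [].
      by rewrite cons_uniq u1 andbT (perm_mem q1).
    * have -> : endss ([:: k] :: P1) = k :: k :: endss P1 by [].
      by rewrite /= perm_cons perm_sym -cat1s perm_catCA perm_cons perm_sym.
  + by apply: forest_perm f2; rewrite perm_sym -[k :: W]cat1s -catA perm_catCA perm_cat2l perm_sym.
  + exact: forest_perm f3.
  + split; first by rewrite /= kW.
    * by move: uEF; rewrite (perm_uniq kEF) cat_uniq => /andP[].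
    * exact: rem_uniq.
- split=> //; first exact: (perm_cat (perm_refl [:: k]) q1).
  by rewrite -(perm_uniq kEF).
- move=> z /sub; rewrite !mem_cat !inE (perm_mem pF) inE.
  by case: (z == k) => //=; case: (z \in W).
- split=> // s; rewrite inE => /orP[/eqP->|/c1 //].
  have /flattenP[K KP kK] : k \in flatten P3 by apply: s3; rewrite mem_cat kF orbT.
  by exists K => // z; rewrite !inE orbb => /eqP->.
- by move=> e; rewrite pes_cons ces_cons /= xexx !addFb.
Qed.

(** In a system this singles out the components of [P3] with one end in [E] and the other in [F],
    since the ends of [P3] are divided between these two. *)
Definition EF_piece F K := if K is x :: s then (x \in F) (+) (last x s \in F) else false.

(** If [|W|] is odd then so is [|F|], whereas components with no end or both ends in [F] account for
    an even number of its members. *)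
Lemma sys_EF_piece CC DD P1 P2 P3 W E F : sys CC DD P1 P2 P3 W E F -> odd (size W) ->
  exists2 K, K \in P3 & EF_piece F K.
Proof.
move=> [lk [_ _ uEF] _ _ _] oW; have [_ oF] := linked_parity lk.
case: lk => [_ _ [_ _ p3] _].
apply/hasP; apply: contraT => /hasPn nK.
suff : ~~ odd (count (mem F) (endss P3)).
  have /permP-> := p3; rewrite count_cat.
  have -> : count (mem F) E = 0.
    apply/eqP; rewrite -leqn0 leqNgt -has_count; apply: contraL uEF => h.
    rewrite cat_uniq !negb_and negbK; suff -> : has (mem E) F by rewrite orbT.
    by case/hasP: h => z zE zF; apply/hasP; exists z.
  rewrite add0n; have -> : count (mem F) F = size F by apply/eqP; rewrite -all_count; apply/allP.
  by rewrite -oF oW.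
elim: (P3) nK => [|K P IH] // nK.
have -> : endss (K :: P) = ends K ++ endss P by [].
rewrite count_cat oddD (negPf (IH _)); last by move=> L LP; apply: nK; rewrite inE LP orbT.
rewrite addbF.
have := nK K (mem_head _ _); case: (K) => [|x s] //=; rewrite addn0 !oddD.
by case: (x \in F); case: (last x s \in F).
Qed.

Lemma filter_endss (a : pred T) P :
  (forall s, s \in P -> {in ends s &, forall x y, a x = a y}) ->
  filter a (endss P) = endss [seq s <- P | has a (ends s)].
Proof.
elim: P => [|s P IH] // cst.
have -> : endss (s :: P) = ends s ++ endss P by [].
rewrite filter_cat IH; last by move=> t tP; apply: cst; rewrite inE tP orbT.
have /= := cst s (mem_head _ _); case: s {cst} => [|x s] //= cst.
have := cst x (last x s); rewrite !inE !eqxx orbT => /(_ isT isT) <-.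
by case: (a x).
Qed.

Lemma perm_flatten_filterC (b : pred (seq T)) P :
  perm_eq (flatten (filter b P) ++ flatten (filter (predC b) P)) (flatten P).
Proof.
by rewrite -flatten_cat; apply: perm_flatten; have /permPl := perm_filterC b P.
Qed.

Lemma forest_filter (a : pred T) P A :
  (forall s, s \in P -> {in ends s &, forall x y, a x = a y}) ->
  forest P A -> forest [seq s <- P | has a (ends s)] (filter a A).
Proof.
move=> cst [uP nP pA]; split.
- have := perm_uniq (perm_flatten_filterC (fun s => has a (ends s)) P).
  by rewrite uP cat_uniq => /and3P[].
- by apply: contra nP; rewrite mem_filter => /andP[].
- by rewrite -filter_endss //; apply: perm_filter.
Qed.

(** A vertex set that separates the ends of no component cuts out three linked forests of its
    own. *)
Lemma linked_filter (a : pred T) P1 P2 P3 W E F :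
  (forall s, s \in P1 ++ P2 ++ P3 -> {in ends s &, forall x y, a x = a y}) ->
  linked P1 P2 P3 W E F ->
  linked [seq s <- P1 | has a (ends s)] [seq s <- P2 | has a (ends s)]
    [seq s <- P3 | has a (ends s)] (filter a W) (filter a E) (filter a F).
Proof.
move=> cst [f1 f2 f3 [uW uE uF]].
have [c1 c2 c3] : [/\ forall s, s \in P1 -> {in ends s &, forall x y, a x = a y},
   forall s, s \in P2 -> {in ends s &, forall x y, a x = a y} &
   forall s, s \in P3 -> {in ends s &, forall x y, a x = a y}].
  by split=> s sP; apply: cst; rewrite !mem_cat sP ?orbT.
split; rewrite -?filter_cat; try exact: forest_filter.
by split; apply: filter_uniq.
Qed.

Lemma pes_filterC (b : pred (seq T)) P e :
  pes (filter b P) e (+) pes (filter (predC b) P) e = pes P e.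
Proof. by rewrite -pes_cat; apply: pes_perm; have /permPl := perm_filterC b P. Qed.

Lemma uniq_components P : uniq (flatten P) -> [::] \notin P -> uniq P.
Proof.
elim: P => [|[|x s] P IH] //; rewrite inE negb_or => uP /andP[_ nP].
move: uP; have -> : flatten ((x :: s) :: P) = (x :: s) ++ flatten P by [].
rewrite cat_uniq cons_uniq => /and3P[_ dis uP]; rewrite cons_uniq (IH uP nP) andbT.
apply: contra dis => sP; apply/hasP; exists x; rewrite ?mem_head //.
by apply/flattenP; exists (x :: s); rewrite ?mem_head.
Qed.

(** By coherence [K] separates the ends of no component. Exactly one end of [K] is in [F], so the
    part on [K] has odd parity; as [|W|] is even, so has the rest. Each part gives a triangle of
    paths, and corresponding paths are disjoint. *)
Lemma sys_even_cycles CC DD P1 P2 P3 W E F K : sys CC DD P1 P2 P3 W E F ->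
  ~~ odd (size W) -> K \in P3 -> EF_piece F K ->
  exists c1 c2 c3, [/\ uniq c1, uniq c2, uniq c3
    & forall e, ce c1 e (+) ce c2 e (+) ce c3 e = ces CC e (+) ces DD e].
Proof.
move=> [lk [_ _ uEF] _ [c1 c2] eq] eW KP eK.
have [[u1 n1 p1] [u2 n2 p2] [u3 n3 p3] _] := lk.
have cohK P : coherent P P3 -> forall s, s \in P -> {in ends s &, forall x y, (x \in K) = (y \in K)}.
  move=> cP s /cP[K' K'P sub] x y /sub xK' /sub yK'.
  apply/idP/idP => zK; by rewrite (flatten_uniq_eq u3 KP K'P zK _).
have coh s : s \in P1 ++ P2 ++ P3 -> {in ends s &, forall x y, (x \in K) = (y \in K)}.
  rewrite !mem_cat => /or3P[]; first exact: cohK.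
  - exact: cohK.
  - by apply: cohK => t tP; exists t => // z /mem_ends.
have cohC s : s \in P1 ++ P2 ++ P3 -> {in ends s &, forall x y, (x \notin K) = (y \notin K)}.
  by move=> sP x y xs ys; rewrite (coh s sP x y).
have lK := linked_filter (a := mem K) coh lk.
have lC := linked_filter (a := predC (mem K)) cohC lk.
have oK : odd (size (filter (mem K) W)).
  have [_ ->] := linked_parity lK; rewrite size_filter.
  (* Both sides count the ends of [P3] that lie on [K] and in [F]. *)
  have -> : count (mem K) F = count (mem F) (ends K).
    transitivity (count (mem F) (filter (mem K) (E ++ F))).
      rewrite filter_cat count_cat.
      have -> : count (mem F) (filter (mem K) E) = 0.
        apply/eqP; rewrite -leqn0 leqNgt -has_count; apply: contraL uEF => /hasP[z zE zF].
        rewrite cat_uniq !negb_and negbK; suff -> : has (mem E) F by rewrite orbT.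
        by apply/hasP; exists z => //; move: zE; rewrite mem_filter => /andP[].
      rewrite add0n count_filter; apply: eq_in_count => z zF /=.
      by rewrite (_ : z \in F = true).
    have /permP <- : perm_eq (filter (mem K) (endss P3)) (filter (mem K) (E ++ F)) by apply: perm_filter.
    rewrite filter_endss; last by move=> s sP; apply: coh; rewrite !mem_cat sP !orbT.
    suff -> : [seq s <- P3 | has (mem K) (ends s)] = [seq s <- P3 | s == K].
      by rewrite filter_pred1_uniq ?(uniq_components u3) // /endss /= cats0.
    apply: eq_in_filter => s sP; apply/hasP/eqP => [[z zs zK]|->].
      exact: flatten_uniq_eq u3 sP KP (mem_ends zs) zK.
    by case: (K) eK => [|x t] // _; exists x; apply: mem_head.
  by case: (K) eK => [|x t] //=; rewrite addn0 oddD; case: (x \in F); case: (last x t \in F).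
have oC : odd (size (filter (predC (mem K)) W)).
  have := count_predC (mem K) W; rewrite -!size_filter => /(congr1 odd).
  by rewrite oddD oK (negPf eW) => /= /negbFE.
have tK := linked_triple lK oK; have tC := linked_triple lC oC.
have fC P : (forall s, s \in P -> {in ends s &, forall x y, (x \in K) = (y \in K)}) -> [::] \notin P ->
    [seq s <- P | has (predC (mem K)) (ends s)] = [seq s <- P | ~~ has (mem K) (ends s)].
  move=> cP nP; apply: eq_in_filter => s sP; have := cP s sP.
  case: s sP => [|x s] sP; first by rewrite sP in nP.
  by move=> /(_ x (last x s)); rewrite /= !inE !eqxx orbT => /(_ isT isT) ->; rewrite !orbF !orbb.
have uU P : (forall s, s \in P -> {in ends s &, forall x y, (x \in K) = (y \in K)}) ->
   [::] \notin P -> uniq (flatten P) ->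
   uniq (flatten [seq s <- P | has (mem K) (ends s)] ++ flatten [seq s <- P | has (predC (mem K)) (ends s)]).
  by move=> cP nP uP; rewrite fC // (perm_uniq (perm_flatten_filterC _ P)).
have [d1 d2 d3] : [/\ forall s, s \in P1 -> {in ends s &, forall x y, (x \in K) = (y \in K)},
   forall s, s \in P2 -> {in ends s &, forall x y, (x \in K) = (y \in K)} &
   forall s, s \in P3 -> {in ends s &, forall x y, (x \in K) = (y \in K)}].
  by split=> s sP; apply: coh; rewrite !mem_cat sP ?orbT.
have [z1 [z2 [z3 [v1 v2 v3 ez]]]] := two_triples_cycles tK tC (uU _ d1 n1 u1) (uU _ d2 n2 u2) (uU _ d3 n3 u3).
exists z1, z2, z3; split=> // e; rewrite ez -eq !fC //.
rewrite -(pes_filterC (fun s => has (mem K) (ends s)) P1 e).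
rewrite -(pes_filterC (fun s => has (mem K) (ends s)) P2 e).
rewrite -(pes_filterC (fun s => has (mem K) (ends s)) P3 e).
xring.
Qed.

End Systems2.

(** * Choosing the cut edges *)

Section Choices.

Variable T : finType.
Implicit Types (s t c d C D K W E F A : seq T) (P Q CC DD : seq (seq T)) (e : {set T}).
Implicit Types (x y k h g v : T).

Lemma pth_notin x a s e : x \in e -> x \notin a :: s -> pth a s e = false.
Proof.
move=> xe0; elim: s a => [|b s IH] a //=; rewrite inE negb_or => /andP[xa xb].
rewrite IH // addbF /xe; apply/negP => /andP[_ /eqP e_ab].
move: xe0; rewrite e_ab !inE (negPf xa) /=.
by apply/negP; move: xb; rewrite inE negb_or => /andP[].
Qed.

Lemma ce_last x s : uniq (x :: s) -> 1 < size s -> ce (x :: s) [set x; last x s].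
Proof.
case: s => [|y [|z s]] // u _.
have ux : x \notin [:: y, z & s] by move: u; rewrite cons_uniq => /andP[].
have uy : y \notin z :: s by move: u; rewrite !cons_uniq => /and3P[].
have xl : x != last z s by apply: contraNneq ux => ->; rewrite in_cons mem_last orbT.
rewrite ceE; set e := [set _; _]; have xe0 : x \in e by rewrite !inE eqxx.
have -> : pe [:: x, y, z & s] e = false.
  rewrite /= -/(pth y (z :: s) e) (pth_notin xe0 ux) addbF /xe.
  apply/negP => /andP[_ /eqP/setP/(_ y)]; rewrite !inE eqxx orbT [y == x]eq_sym.
  move=> /orP[/eqP xy|/eqP yl]; first by rewrite xy mem_head in ux.
  by have := mem_last z s; rewrite -[last z s]/(last x [:: y, z & s]) -yl (negPf uy).
by rewrite addFb /xe eq_sym xl /e /= setUC eqxx.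
Qed.

Lemma ce_head x y s : uniq [:: x, y & s] -> 0 < size s -> ce [:: x, y & s] [set x; y].
Proof.
move=> u s0; have ur : uniq (y :: rcons s x).
  by rewrite -rcons_cons rcons_uniq -cons_uniq.
have := ce_last ur; rewrite size_rcons ltnS s0 last_rcons setUC => /(_ isT).
by rewrite -rcons_cons ce_rcons.
Qed.

Definition edge_disjoint CC DD :=
  forall C D e, C \in CC -> D \in DD -> ce C e -> ce D e -> False.

Definition cycles CC := uniq (flatten CC) && all (fun s => 2 < size s) CC.

Definition same_cycles CC CC' :=
  perm_eq (flatten CC') (flatten CC) /\ ces CC' =1 ces CC.

Lemma rot_mem C g : g \in C -> exists s, perm_eq (g :: s) C /\ ce (g :: s) =1 ce C.
Proof.
move=> /rot_to[i s eC]; exists s; rewrite -eC; split; last by move=> e; rewrite ce_rot.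
by rewrite perm_rot.
Qed.

(** Of the two edges at [k] at most one leads to [h], and the other is cut. If [k] is not on [C], an
    edge not at [h] is cut. *)
Lemma cut_with_without C k h : uniq C -> 2 < size C -> k != h ->
  exists c, [/\ perm_eq c C, ce c =1 ce C, h \notin ends c & k \in C -> k \in ends c].
Proof.
move=> uC sC kh; case: (boolP (k \in C)) => [/rot_mem[s [ps es]]|kC].
  have us : uniq (k :: s) by rewrite (perm_uniq ps).
  have ss : 1 < size s by have := perm_size ps; rewrite /= => s1; rewrite -ltnS s1.
  case: s us ss ps es => [|x [|y s]] // us _ ps es.
  have [hl|hl] := eqVneq h (last y s).
    exists [:: x, y & rcons s k]; split=> [|e||_].
    - by rewrite -!rcons_cons -rot1_cons perm_rot.
    - by rewrite -!rcons_cons -rot1_cons ce_rot es.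
    - rewrite /= last_rcons !inE [h == k]eq_sym (negPf kh) orbF hl.
      by apply: contraTneq us => <-; rewrite !cons_uniq mem_last /= andbF.
    - by rewrite /= last_rcons !inE eqxx orbT.
  exists [:: k, x, y & s]; split=> //; last by rewrite mem_head.
  by rewrite /= !inE eq_sym negb_or kh.
case: (boolP (h \in C)) => [/rot_mem[s [ps es]]|hC]; last first.
  by exists C; split=> //; apply: contra hC; apply: mem_ends.
have us : uniq (h :: s) by rewrite (perm_uniq ps).
have ss : 1 < size s by have := perm_size ps; rewrite /= => s1; rewrite -ltnS s1.
case: s us ss ps es => [|x [|y s]] // us _ ps es.
have rt : [:: y & rcons (rcons s h) x] = rot 2 [:: h, x, y & s].
  by rewrite /rot /= -!cats1 -catA.
exists [:: y & rcons (rcons s h) x]; split=> [|e||].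
- by rewrite rt perm_rot.
- by rewrite rt ce_rot es.
- rewrite /= last_rcons !inE negb_or; move: us; rewrite !cons_uniq !inE !negb_or -!andbA.
  by move=> /and3P[-> ->].
- by [].
Qed.

Lemma cut_all CC k h : cycles CC -> k != h ->
  exists CC', [/\ cycles CC', same_cycles CC CC', h \notin endss CC',
    k \in flatten CC -> k \in endss CC' &
    forall c, c \in CC' -> exists2 C, C \in CC & ce c =1 ce C].
Proof.
move=> /andP[uC sC] kh; elim: CC uC sC => [|C CC IH]; first by exists [::].
rewrite [flatten _]/= cat_uniq => /and3P[uC dis uCC] /andP[sC sCC].
have [CC' [/andP[u' s'] [p' e'] h' k' c']] := IH uCC sCC.
have [c [pc ec hc kc]] := cut_with_without uC sC kh.
have pp : perm_eq (flatten (c :: CC')) (flatten (C :: CC)) by exact: (perm_cat pc p').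
exists (c :: CC'); split.
- apply/andP; split; last by rewrite /= (perm_size pc) sC.
  by rewrite (perm_uniq pp) [flatten _]/= cat_uniq uC dis.
- by split=> // e; rewrite !ces_cons ec e'.
- have -> : endss (c :: CC') = ends c ++ endss CC' by [].
  by rewrite mem_cat negb_or hc.
- have -> : endss (c :: CC') = ends c ++ endss CC' by [].
  by rewrite !mem_cat => /orP[/kc->|/k'->]; rewrite ?orbT.
- move=> z; rewrite inE => /orP[/eqP->|/c'[C' C'C eC']]; first by exists C; rewrite ?mem_head.
  by exists C' => //; rewrite inE C'C orbT.
Qed.

(** The part of a system on which the choice of further cuts depends; [o] is the parity of [W]. *)
Definition state CC DD P3 F (o : bool) :=
  exists P1 P2 W E, sys CC DD P1 P2 P3 W E F /\ odd (size W) = o.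

(** Having [k] on a removed edge and [h] on none gives two later cuts with different effects on the
    parity. The last clause holds because the components of [P3] are single edges of [CC] at this
    stage. *)
Lemma state_start CC k h : cycles CC -> k != h ->
  exists CC' P3, [/\ state CC' [::] P3 [::] false, same_cycles CC CC', h \notin flatten P3,
    k \in flatten CC -> k \in flatten P3 &
    forall x y, x != y -> same P3 x y -> exists2 C, C \in CC & ce C [set x; y]].
Proof.
move=> cC kh; have [CC' [/andP[u' s'] sCC h' k' c']] := cut_all cC kh.
exists CC', [seq ends s | s <- CC']; split=> //.
  exists CC', [::], [::], (endss CC'); split=> //; apply: sys_start => //.
  by apply: sub_all s' => s /ltnW.
move=> x y xy /sameP[_ [/mapP[c cC' ->] xc yc]].
have [C CCC eC] := c' c cC'; exists C => //; rewrite -eC.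
have uc : uniq c.
  elim: (CC') u' cC' => [|d L IH] //; rewrite [flatten _]/= cat_uniq inE => /and3P[ud _ uL].
  by case/orP=> [/eqP->|/IH ->].
have := allP s' _ cC'; case: (c) uc xc yc => [|a t] // uat xc yc sat.
have el := ce_last uat sat; move: xc yc; rewrite !inE.
by case/orP=> /eqP ex; case/orP=> /eqP ey; subst x y; rewrite ?eqxx // in xy *; rewrite ?el // setUC el.
Qed.

(** [W] consists of vertices on cycles of both families, so a vertex missing from one of them is in
    [E] or [F]. *)
Lemma state_end CC DD P3 F o x : state CC DD P3 F o -> x \in flatten P3 ->
  (x \notin flatten CC) || (x \notin flatten DD) -> x \in endss P3.
Proof.
move=> [P1 [P2 [W [E [S _]]]]] xP.
have [sC sD _] := sys_sub S; case: S => [[_ _ [_ _ p3] _] _ sub _ _] out.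
rewrite (perm_mem p3); have := sub x xP; rewrite mem_cat => /orP[xW|//].
by case/orP: out => /negP[]; [apply: sC | apply: sD]; rewrite mem_cat xW.
Qed.

Lemma state_not_three CC DD P3 F o x y z : state CC DD P3 F o ->
  {subset [:: x; y; z] <= endss P3} -> uniq [:: x; y; z] ->
  same P3 x y -> same P3 x z -> False.
Proof. by move=> [P1 [P2 [W [E [[[_ _ [u3 _ _] _] _ _ _ _] _]]]]]; apply: three_ends_same. Qed.

Lemma state_contact CC DD P3 F o x : state CC DD P3 F o -> x \notin flatten CC ->
  (x \in flatten P3) = (x \in F).
Proof. by move=> [P1 [P2 [W [E [S _]]]]]; apply: (sys_contact S). Qed.

Lemma state_sub CC DD P3 F o : state CC DD P3 F o ->
  {subset flatten P3 <= flatten CC ++ flatten DD}.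
Proof.
move=> [P1 [P2 [W [E [S _]]]]] x; have [sC sD _] := sys_sub S.
case: S => [_ _ sub _ _] /sub; rewrite !mem_cat => /or3P[xW|xE|xF].
- by rewrite sC // mem_cat xW.
- by rewrite sC // mem_cat xE orbT.
- by rewrite sD ?orbT // mem_cat xF orbT.
Qed.

Lemma state_same_keep CC DD P3 F o K x y : state CC DD P3 F o ->
  K \in P3 -> x \in K -> y \notin K -> ~~ same P3 x y.
Proof.
move=> [P1 [P2 [W [E [[[_ _ [u3 _ _] _] _ _ _ _] _]]]]] KP xK.
by apply: contra => /sameP[K' [K'P xK' yK']]; rewrite (flatten_uniq_eq u3 KP K'P xK xK').
Qed.

Lemma same_out P3 x y : x \notin flatten P3 -> ~~ same P3 x y.
Proof. by apply: contra => /sameP[K [KP xK _]]; apply/flattenP; exists K. Qed.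

Lemma state_addC CC DD P3 F o x s : state CC DD P3 F o ->
    uniq (x :: s) -> x != last x s -> ~~ has (mem (flatten CC)) (x :: s) ->
    ~~ same P3 x (last x s) ->
  exists P3' F', [/\ state ((x :: s) :: CC) DD P3' F'
      ((x \in flatten P3) (+) (last x s \in flatten P3) (+) o),
    flatten P3' =i [:: x, last x s & flatten P3],
    forall K, K \in P3 -> x \notin K -> last x s \notin K -> K \in P3'
    & forall z, z \notin [:: x; last x s] -> (z \in F') = (z \in F)].
Proof.
move=> [P1 [P2 [W [E [S oW]]]]] u xl dis ns.
have [P3' [W' [E' [F' [S' o' f' k' m']]]]] := sys_add S u xl dis ns.
exists P3', F'; split=> //; exists ((x :: s) :: P1), P2, W', E'.
by split=> //; rewrite o' oW.
Qed.

Lemma state_addD CC DD P3 F o x s : state CC DD P3 F o ->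
    uniq (x :: s) -> x != last x s -> ~~ has (mem (flatten DD)) (x :: s) ->
    ~~ same P3 x (last x s) ->
  exists P3' F', [/\ state CC ((x :: s) :: DD) P3' F'
      ((x \in flatten P3) (+) (last x s \in flatten P3) (+) o),
    flatten P3' =i [:: x, last x s & flatten P3]
    & forall K, K \in P3 -> x \notin K -> last x s \notin K -> K \in P3'].
Proof.
move=> [P1 [P2 [W [E [S oW]]]]] u xl dis ns.
have [P3' [W' [F' [E' [S' o' f' k' _]]]]] := sys_add (sys_sym S) u xl dis ns.
exists P3', F'; split=> //; exists P1, ((x :: s) :: P2), W', E'.
by split; [exact: sys_sym | rewrite o' oW].
Qed.

Lemma last_neq x s : uniq (x :: s) -> 1 < size s -> x != last x s.
Proof.
case: s => [|y s] //= /andP[xs _] _; apply: contraNneq xs => ->; exact: mem_last.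
Qed.

(* An edge at a vertex outside P3 will do; if there is none, all vertices of D are ends
   of P3, and one of any two consecutive edges of D joins two components of P3, since
   no component has three ends. *)
Lemma safe_cut CC DD P3 F o D : state CC DD P3 F o -> uniq D -> 2 < size D ->
    ~~ has (mem (flatten DD)) D ->
  exists x s, [/\ perm_eq (x :: s) D, ce (x :: s) =1 ce D & ~~ same P3 x (last x s)].
Proof.
move=> S uD sD dis; case: (boolP (all (mem (flatten P3)) D)) => [/allP mD|].
  have eD x : x \in D -> x \in endss P3.
    move=> xD; apply: (state_end S (mD x xD)); apply/orP; right.
    by apply: contra dis => xDD; apply/hasP; exists x.
  case: D uD sD dis mD eD => [|a [|b [|c s]]] // uD _ _ _ eD.
  case: (boolP (same P3 b a)) => sba; last first.
    exists b, (c :: rcons s a); split=> [|e|].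
    - by rewrite -!rcons_cons -rot1_cons perm_rot.
    - by rewrite -!rcons_cons -rot1_cons ce_rot.
    - by rewrite /= last_rcons.
  case: (boolP (same P3 b c)) => sbc.
    case: (state_not_three (x := b) (y := a) (z := c) S _ _ sba sbc).
      by move=> z zb; apply: eD; move: zb; rewrite !inE => /or3P[]->; rewrite ?orbT.
    by move: uD; rewrite /= !inE [b == a]eq_sym; case: (a == b); case: (a == c); case: (b == c) => //=; rewrite ?andbF.
  have rt : [:: c & rcons (rcons s a) b] = rot 2 [:: a, b, c & s].
    by rewrite /rot /= -!cats1 -catA.
  exists c, (rcons (rcons s a) b); split=> [|e|]; rewrite ?rt ?perm_rot ?ce_rot //.
  by rewrite last_rcons sameC.
rewrite -has_predC => /hasP[x /rot_mem[s [ps es]] xP].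
by exists x, s; split=> //; apply: same_out.
Qed.

(** A safe cut always exists, so the cycles can be added one at a time. The resulting parity [o'] is
    left open and is corrected by a later choice. *)
Lemma state_addD_all CC DD0 DD P3 F o : state CC DD0 P3 F o -> cycles DD ->
    ~~ has (mem (flatten DD0)) (flatten DD) ->
  exists DD' P3' F' o', [/\ state CC DD' P3' F' o',
    perm_eq (flatten DD') (flatten DD ++ flatten DD0),
    forall e, ces DD' e = ces DD e (+) ces DD0 e,
    {subset flatten P3 <= flatten P3'} &
    {subset flatten P3' <= flatten P3 ++ flatten DD}].
Proof.
elim: DD DD0 P3 F o => [|D DD IH] DD0 P3 F o S.
  exists DD0, P3, F, o; split=> [||e||x xP] //; first by rewrite ces_nil.
  by rewrite mem_cat xP.
rewrite /cycles /= cat_uniq has_cat negb_or => /andP[/and3P[uD dDD uDD] /andP[sD sDD]] /andP[d1 d2].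
have [x [s [ps es ns]]] := safe_cut S uD sD d1.
have us : uniq (x :: s) by rewrite (perm_uniq ps).
have ss : 1 < size s by have := perm_size ps; rewrite /= => s1; rewrite -ltnS s1.
have ds : ~~ has (mem (flatten DD0)) (x :: s) by rewrite (perm_has _ ps).
have [P3' [F' [S' f' _]]] := state_addD S us (last_neq us ss) ds ns.
have [||DD' [P3'' [F'' [o'' [S'' p'' e'' m'' l'']]]]] := IH _ _ _ _ S'.
- by rewrite /cycles uDD sDD.
- have -> : flatten ((x :: s) :: DD0) = (x :: s) ++ flatten DD0 by [].
  apply/hasPn => z zDD; rewrite -[~~ _]/(z \notin (x :: s) ++ flatten DD0) mem_cat negb_or; apply/andP; split; last exact: (hasPn d2).
  by rewrite (perm_mem ps); apply: (hasPn dDD).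
exists DD', P3'', F'', o''; split=> // [|e|z zP|z /l''].
- apply: perm_trans p'' _; rewrite [flatten (_ :: DD0)]/= -[x :: s ++ _]cat_cons.
  by rewrite perm_catCA catA perm_cat2r perm_cat2r.
- by rewrite e'' !ces_cons es; xring.
- by apply: m''; rewrite f' !inE zP !orbT.
- rewrite !mem_cat f' !inE => /orP[/or3P[/eqP->|/eqP->|->]|->]; rewrite ?orbT //.
  + by rewrite -(perm_mem ps) mem_head !orbT.
  + by rewrite -(perm_mem ps) mem_last !orbT.
Qed.

(** Only the vertices used and the sum of the edges matter, so [CC'] and [DD'] may cut the cycles
    anywhere and may contain additional one-vertex cycles. *)
Definition odd_system CC DD := exists CC' DD' P3 F,
  [/\ state CC' DD' P3 F true, {subset flatten CC' <= flatten CC ++ flatten DD},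
      {subset flatten DD' <= flatten CC ++ flatten DD} &
      forall e, ces CC' e (+) ces DD' e = ces CC e (+) ces DD e].

Lemma odd_system_sym CC DD : odd_system CC DD -> odd_system DD CC.
Proof.
move=> [CC' [DD' [P3 [F [[P1 [P2 [W [E [S o]]]]] sC sD eq]]]]].
exists DD', CC', P3, E; split.
- by exists P2, P1, W, F; split=> //; apply: sys_sym.
- by move=> x /sD; rewrite !mem_cat orbC.
- by move=> x /sC; rewrite !mem_cat orbC.
- by move=> e; rewrite addbC eq addbC.
Qed.

End Choices.

(** * Existence of systems with odd parity *)

Section OddSystems.

Variable T : finType.
Implicit Types (s t c d C D K W E F A : seq T) (P Q CC DD : seq (seq T)) (e : {set T}).
Implicit Types (x y k h g v : T).

Lemma cycles_perm CC CC' : perm_eq CC CC' -> cycles CC -> cycles CC'.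
Proof. by move=> p /andP[u a]; rewrite /cycles -(perm_uniq (perm_flatten p)) u -(perm_all _ p). Qed.

Lemma cycles_cons C CC : cycles (C :: CC) ->
  [/\ uniq C, 2 < size C, cycles CC & ~~ has (mem (flatten CC)) C].
Proof.
rewrite /cycles /= cat_uniq => /andP[/and3P[uC dis uCC] /andP[sC sCC]]; split; rewrite ?uCC //.
by apply: contra dis => /hasP[x xC xCC]; apply/hasP; exists x.
Qed.

Lemma pick_cycle CC g : cycles CC -> g \in flatten CC ->
  exists C s CC', [/\ perm_eq CC (C :: CC'), perm_eq (g :: s) C, ce (g :: s) =1 ce C
     & [/\ uniq (g :: s), 1 < size s, cycles CC' & ~~ has (mem (flatten CC')) (g :: s)]].
Proof.
move=> cC /flattenP[C CCC gC]; have [s [ps es]] := rot_mem gC.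
have pC := perm_to_rem CCC; exists C, s, (rem C CC); split=> //.
have [uC sC cR dis] := cycles_cons (cycles_perm pC cC).
split; rewrite ?(perm_uniq ps) ?(perm_has _ ps) //.
by rewrite -ltnS -[(size s).+1]/(size (g :: s)) (perm_size ps).
Qed.

(** Reversing the direction of travel from [g] cuts the cycle at its other edge at [g]. *)
Lemma two_cuts g c : uniq (g :: c) -> 1 < size c ->
  exists c', [/\ perm_eq c' c, ce (g :: c') =1 ce (g :: c), last g c' != last g c
    & last g c' = head g c].
Proof.
move=> u s1; exists (rev c); split.
- by rewrite perm_rev.
- by move=> e; rewrite -ce_rcons -rev_cons ce_rev.
- case: c u s1 => [|x [|y c]] // u _; rewrite rev_cons last_rcons /=.
  apply: contraTneq u => ->; rewrite !cons_uniq mem_last /= andbF //.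
- by case: c u s1 => [|x c] // _ _; rewrite rev_cons last_rcons.
Qed.

Lemma odd_system_build CC DD CC1 DD1 C D C0 D0 CC' DD' P3 F :
  perm_eq CC (C0 :: CC') -> perm_eq DD (D0 :: DD') ->
  perm_eq C C0 -> ce C =1 ce C0 -> perm_eq D D0 -> ce D =1 ce D0 ->
  same_cycles CC' CC1 -> perm_eq (flatten DD1) (flatten DD') -> (forall e, ces DD1 e = ces DD' e) ->
  state (C :: CC1) (D :: DD1) P3 F true -> odd_system CC DD.
Proof.
move=> pC pD pC0 eC pD0 eD [pC1 eC1] pD1 eD1 S.
exists (C :: CC1), (D :: DD1), P3, F; split=> //.
- move=> x; rewrite mem_flatten_cons (perm_mem pC0) (perm_mem pC1) => xC.
  by rewrite mem_cat (perm_mem (perm_flatten pC)) mem_flatten_cons xC.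
- move=> x; rewrite mem_flatten_cons (perm_mem pD0) (perm_mem pD1) => xD.
  by rewrite mem_cat (perm_mem (perm_flatten pD)) mem_flatten_cons xD orbT.
- by move=> e; rewrite (ces_perm _ pC) (ces_perm _ pD) !ces_cons eC eD eC1 eD1.
Qed.

Lemma state_toggle CC DD P3 F o k : state CC DD P3 F o -> k \in F -> k \notin flatten CC ->
  exists F', state ([:: k] :: CC) DD P3 F' (~~ o) /\ (forall z, z != k -> (z \in F') = (z \in F)).
Proof.
move=> [P1 [P2 [W [E [S o']]]]] kF kC; exists (rem k F); split.
  by exists ([:: k] :: P1), P2, (k :: W), (k :: E); split; [exact: sys_toggle | rewrite /= o'].
by move=> z zk; rewrite (perm_mem (perm_to_rem kF)) inE (negPf zk).
Qed.

(** The cycle of [k] is added last and cut at [k]. Then [k] is an end in [F] outside [CC], so a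
    wrong parity can be corrected by a toggle at [k]. *)
Lemma odd_system_uncovered CC DD k : cycles CC -> cycles DD ->
  k \in flatten DD -> k \notin flatten CC -> odd_system CC DD.
Proof.
move=> cC cD kD kC; have [D [s [DD' [pD ps es [us ss cD' dis]]]]] := pick_cycle cD kD.
have [CC' [P3 [S [pC' eC'] _ _ _]]] := state_start cC (last_neq us ss).
have [|DD1 [P31 [F1 [o1 [S1 p1 e1 _ m1]]]]] := state_addD_all S cD'; first by apply/hasPn.
rewrite cats0 in p1; have e1' e : ces DD1 e = ces DD' e by rewrite e1 ces_nil addbF.
have kC' : k \notin flatten CC' by rewrite (perm_mem pC').
have kD' : k \notin flatten DD' by apply: contra dis => kD'; apply/hasP; exists k; rewrite ?mem_head.
have kP : k \notin flatten P31.
  by apply/negP => /m1; rewrite mem_cat (negPf kD') orbF => /(state_sub S); rewrite mem_cat (negPf kC').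
have d1 : ~~ has (mem (flatten DD1)) (k :: s).
  by apply: contra dis => /hasP[x xs xD]; apply/hasP; exists x => //; rewrite /= -(perm_mem p1).
have [P32 [F2 [S2 f2 _]]] := state_addD S1 us (last_neq us ss) d1 (same_out _ kP).
set o2 := (_ (+) _) in S2.
have sD : {subset flatten ((k :: s) :: DD1) <= flatten CC ++ flatten DD}.
  move=> x; rewrite mem_flatten_cons (perm_mem ps) (perm_mem p1) => xD.
  by rewrite mem_cat (perm_mem (perm_flatten pD)) mem_flatten_cons xD orbT.
have eD e : ces ((k :: s) :: DD1) e = ces DD e.
  by rewrite (ces_perm _ pD) !ces_cons es e1'.
case: (boolP o2) S2 => o2P S2.
  exists CC', ((k :: s) :: DD1), P32, F2; split=> //; last by move=> e; rewrite eC' eD.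
  by move=> x; rewrite mem_cat (perm_mem pC') => ->.
have [||F3 [S3 _]] := @state_toggle _ _ _ _ _ k S2 => //.
  by rewrite -(state_contact S2) // f2 mem_head.
exists ([:: k] :: CC'), ((k :: s) :: DD1), P32, F3; split=> //.
  move=> x; rewrite /= inE => /orP[/eqP->|]; first by rewrite mem_cat kD orbT.
  by rewrite mem_cat (perm_mem pC') => ->.
by move=> e; rewrite ces_cons /= xexx eC' eD.
Qed.

(** The cycles [C] and [D] through [g] are kept for last. Once [C] is cut at [g], this vertex lies
    on a removed edge, and [D] has two admissible cuts that affect the parity differently. Below,
    [k] and [h] are the neighbours of [g] on [D], and [n] is the other neighbour of [k].
    Edge-disjointness ensures that the cut of [C] at [g] reaches neither [k] nor [h]. *)
Lemma odd_system_crossing CC DD g : cycles CC -> cycles DD -> edge_disjoint CC DD ->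
  g \in flatten CC -> g \in flatten DD -> {subset flatten DD <= flatten CC} -> odd_system CC DD.
Proof.
move=> cC cD ed gC gD DC.
have [C [c [CC' [pC pc ec [uc sc cC' dC]]]]] := pick_cycle cC gC.
have [D [d [DD' [pD pd ed' [ud sd cD' dD]]]]] := pick_cycle cD gD.
case: d sd pd ed' ud dD => [|k [|n d]] // sd pd eD ud dD.
have CCC : C \in CC by rewrite (perm_mem pC) mem_head.
have DDD : D \in DD by rewrite (perm_mem pD) mem_head.
have [c' [pc' ec' lc' hc']] := two_cuts uc sc.
have [d' [pd' ed' ld' hd']] := two_cuts ud sd.
have cutg c0 : perm_eq c0 c -> uniq (g :: c0) /\ perm_eq (g :: c0) C.
  by move=> pp; have pq : perm_eq (g :: c0) (g :: c); rewrite ?perm_cons // (perm_uniq pq) uc (perm_trans pq pc).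
have sz c0 : perm_eq c0 c -> 1 < size c0 by move=> /perm_size->.
have gC' : g \notin flatten CC' by apply: contra dC => gC'; apply/hasP; exists g; rewrite ?mem_head.
have gD' : g \notin flatten DD' by apply: contra dD => gD'; apply/hasP; exists g; rewrite ?mem_head.
have disC c0 CC1 : perm_eq c0 c -> perm_eq (flatten CC1) (flatten CC') -> ~~ has (mem (flatten CC1)) (g :: c0).
  move=> pp qq; apply: contra dC => /hasP[x xs xD]; apply/hasP; exists x; last by rewrite /= -(perm_mem qq).
  by move: xs; rewrite !inE (perm_mem pp).
have nD x : x \in [:: k, n & d] -> x \notin flatten DD'.
  by move=> xd; apply: contra dD => xD'; apply/hasP; exists x; rewrite // inE xd orbT.
have nC x : x \in c -> x \notin flatten CC'.
  by move=> xd; apply: contra dC => xD'; apply/hasP; exists x; rewrite // inE xd orbT.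
have gk : ce D [set g; k] by rewrite -eD ce_head.
have gl : ce D [set g; last g [:: k, n & d]] by rewrite -eD ce_last.
have gc c0 : perm_eq c0 c -> ce (g :: c0) =1 ce C -> ce C [set g; last g c0].
  by move=> pp <-; rewrite ce_last ?sz //; have [] := cutg _ pp.
pose h := last n d.
have kh : k != h.
  by move: ud; rewrite !cons_uniq => /and3P[_ kk _]; apply: contraNneq kk => ->; rewrite /h mem_last.
have uk : uniq [:: k, n & d] by move: ud; rewrite cons_uniq => /andP[].
have gd : g \notin [:: k, n & d] by move: ud; rewrite cons_uniq => /andP[].
have start k0 h0 : k0 != h0 -> exists CC1 DD1 P3 F o,
  [/\ state CC1 DD1 P3 F o, same_cycles CC' CC1, perm_eq (flatten DD1) (flatten DD'),
     ces DD1 =1 ces DD' &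
    [/\ h0 \in flatten DD' = false -> h0 \notin flatten P3, (k0 \in flatten CC' -> k0 \in flatten P3) &
     {subset flatten P3 <= flatten CC' ++ flatten DD'}]].
  move=> kh0; have [CC1 [P3 [S sC' h0P k0P _]]] := state_start cC' kh0.
  have [|DD1 [P31 [F1 [o1 [S1 p1 e1 i1 m1]]]]] := state_addD_all S cD'; first by apply/hasPn.
  exists CC1, DD1, P31, F1, o1; rewrite cats0 in p1.
  split=> // [e|]; first by rewrite e1 ces_nil addbF.
  split.
  - by move=> hD'; apply/negP=> /m1; rewrite mem_cat hD' (negPf h0P).
  - by move=> /k0P/i1.
  - move=> x /m1; rewrite !mem_cat => /orP[|->]; last by rewrite orbT.
    by move=> /(state_sub S); rewrite mem_cat orbF (perm_mem sC'.1) => ->.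
(* If [k] is on [C], it is on no cycle added before, and the initial cuts also avoid [n]. The two
   cuts of [D] are then [k n], with both ends new, and [g k], with one end new. *)
case: (boolP (k \in c)) => kc.
  have kn : k != n by move: uk; rewrite cons_uniq inE => /andP[/norP[]].
  have [CC1 [DD1 [P3 [F [o [S sC1 pD1 eD1 [nP _ mP]]]]]]] := start _ _ kn.
  have {}nP : n \notin flatten P3 by apply: nP; apply/negbTE/nD; rewrite !inE eqxx orbT.
  have kP : k \notin flatten P3.
    apply/negP=> /mP; rewrite mem_cat (negPf (nC _ kc)) /=; apply/negP.
    by apply: nD; rewrite mem_head.
  have gP : g \notin flatten P3 by apply/negP=> /mP; rewrite mem_cat (negPf gC') (negPf gD').
  (* The two edges of [C] at [g] have different other ends, so one of them avoids [n]. *)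
  have [c0 [pc0 ec0 lc0]] : exists c0, [/\ perm_eq c0 c, ce (g :: c0) =1 ce C & last g c0 != n].
    have [en|en] := eqVneq (last g c) n.
      by exists c'; split=> // [e|]; [rewrite ec' ec | rewrite -en].
    by exists c.
  have [uc0 pc0C] := cutg _ pc0.
  have [P3a [Fa [Sa fa _ _]]] := state_addC S uc0 (last_neq uc0 (sz _ pc0)) (disC _ _ pc0 sC1.1) (same_out _ gP).
  set oa := (_ (+) _) in Sa.
  have kl : k != last g c0.
    apply/eqP=> kl; apply: (ed _ _ [set g; k] CCC DDD) => //.
    by rewrite kl; apply: gc.
  have kPa : k \notin flatten P3a.
    have kg : k != g by apply: contraNneq gd => <-; rewrite mem_head.
    by rewrite fa !inE !negb_or kP kg kl.
  have nPa : n \notin flatten P3a.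
    have ng : n != g by apply: contraNneq gd => <-; rewrite !inE eqxx orbT.
    by rewrite fa !inE !negb_or nP ng eq_sym lc0.
  have gPa : g \in flatten P3a by rewrite fa mem_head.
  case: (boolP oa) => oaP.
    have pr : perm_eq [:: n & rcons (rcons d g) k] [:: g, k, n & d].
      have -> : [:: n & rcons (rcons d g) k] = rot 2 [:: g, k, n & d] by rewrite /rot /= -!cats1 -catA.
      by rewrite perm_rot.
    have er : ce [:: n & rcons (rcons d g) k] =1 ce D.
      have -> : [:: n & rcons (rcons d g) k] = rot 2 [:: g, k, n & d] by rewrite /rot /= -!cats1 -catA.
      by move=> e; rewrite ce_rot eD.
    have ur : uniq [:: n & rcons (rcons d g) k] by rewrite (perm_uniq pr).
    have dr : ~~ has (mem (flatten DD1)) [:: n & rcons (rcons d g) k].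
      rewrite (perm_has _ pr); apply: contra dD => /hasP[x xs xD]; apply/hasP; exists x => //.
      by rewrite /= -(perm_mem pD1).
    have [|P3b [Fb [Sb _ _]]] := state_addD Sa ur _ dr (same_out _ nPa).
      by rewrite last_rcons eq_sym.
    apply: (odd_system_build (P3 := P3b) (F := Fb) pC pD pc0C ec0 (perm_trans pr pd) er sC1 pD1 eD1).
    by move: Sb; rewrite last_rcons (negPf nPa) (negPf kPa) oaP.
  have [ud' pd'D] : uniq (g :: d') /\ perm_eq (g :: d') D.
    have pq : perm_eq (g :: d') [:: g, k, n & d] by rewrite perm_cons.
    by rewrite (perm_uniq pq) (perm_trans pq pd).
  have dr : ~~ has (mem (flatten DD1)) (g :: d').
    apply: contra dD => /hasP[x xs xD]; apply/hasP; exists x; last by rewrite /= -(perm_mem pD1).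
    by move: xs; rewrite in_cons (perm_mem pd').
  have gk' : g != last g d' by rewrite hd' eq_sym; apply: contraNneq gd => <-; rewrite mem_head.
  have [|P3b [Fb [Sb _ _]]] := state_addD Sa ud' gk' dr.
    by rewrite sameC hd' /= same_out.
  apply: (odd_system_build (P3 := P3b) (F := Fb) pC pD pc0C ec0 pd'D _ sC1 pD1 eD1).
    by move=> e; rewrite ed' eD.
  by move: Sb; rewrite hd' /= gPa (negPf kPa) (negPf oaP).
(* Now [k] lies on another cycle of [CC], which can be cut at [k]; this puts [k] on [P3] while [h]
   stays off it. *)
have kC : k \in flatten CC'.
  have : k \in flatten CC by apply: DC; rewrite (perm_mem (perm_flatten pD)) mem_flatten_cons -(perm_mem pd) !inE eqxx orbT.
  rewrite (perm_mem (perm_flatten pC)) mem_flatten_cons -(perm_mem pc) inE (negPf kc) orbF.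
  by move=> /orP[/eqP kg|//]; rewrite kg mem_head in gd.
have [CC1 [DD1 [P3 [F [o [S sC1 pD1 eD1 [hP kP mP]]]]]]] := start _ _ kh.
have hd : h \in [:: k, n & d] by rewrite in_cons mem_last orbT.
have {}hP : h \notin flatten P3 by apply: hP; apply/negbTE/nD.
have {}kP := kP kC.
have gP : g \notin flatten P3 by apply/negP=> /mP; rewrite mem_cat (negPf gC') (negPf gD').
have kend : k \in endss P3.
  by apply: (state_end S kP); rewrite (perm_mem pD1) (nD k) ?mem_head // orbT.
(* If both neighbours of [g] on [C] were in the component of [k], that component would have three
   ends. *)
have [c0 [pc0 ec0 lc0]] : exists c0, [/\ perm_eq c0 c, ce (g :: c0) =1 ce C & ~~ same P3 k (last g c0)].
  case: (boolP (same P3 k (last g c))) => s1; last by exists c.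
  exists c'; split=> // [e|]; first by rewrite ec' ec.
  apply/negP=> s2.
  have lin x : x \in c -> same P3 k x -> (x \in endss P3) && (k != x).
    move=> xc skx; apply/andP; split; last by apply: contraNneq kc => ->.
    apply: (state_end S); last by rewrite (perm_mem sC1.1) (nC x xc).
    by case/sameP: skx => K [KP _ xK]; apply/flattenP; exists K.
  have lc : last g c \in c by case: (c) sc => // a l _; rewrite /= mem_last.
  have lc2 : last g c' \in c.
    by rewrite -(perm_mem pc'); case: (c') (sz _ pc') => // a l _; rewrite /= mem_last.
  have /andP[e1 n1] := lin _ lc s1; have /andP[e2 n2] := lin _ lc2 s2.
  apply: (state_not_three S (x := k) (y := last g c) (z := last g c')) => //.
    by move=> z; rewrite !inE => /or3P[]/eqP->.
  by rewrite /= !inE negb_or n1 n2 eq_sym lc'.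
have [uc0 pc0C] := cutg _ pc0.
have [P3a [Fa [Sa fa ka _]]] := state_addC S uc0 (last_neq uc0 (sz _ pc0)) (disC _ _ pc0 sC1.1) (same_out _ gP).
set oa := (_ (+) _) in Sa.
have gPa : g \in flatten P3a by rewrite fa mem_head.
have kPa : k \in flatten P3a by rewrite fa !inE kP !orbT.
have hl : h != last g c0.
  apply/eqP=> hl; apply: (ed _ _ [set g; h] CCC DDD) => //.
  by rewrite hl; apply: gc.
have hg : h != g by apply: contraNneq gd => <-.
have hPa : h \notin flatten P3a by rewrite fa !inE !negb_or hP hg hl.
have skg : ~~ same P3a g k.
  have /flattenP[K KP kK] := kP.
  have gK : g \notin K by apply: contra gP => gK; apply/flattenP; exists K.
  have lK : last g c0 \notin K by apply: contra lc0 => lK; apply/sameP; exists K.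
  by rewrite sameC (state_same_keep Sa (ka K KP gK lK)).
(* Cutting at [g k], with both ends on [P3a], keeps the parity; cutting at [g h], with [h] new,
   changes it. *)
have [dd [pdd edd ldd]] : exists dd, [/\ perm_eq dd [:: k, n & d], ce (g :: dd) =1 ce D
    & last g dd = if oa then k else h].
  case: (oa); last by exists [:: k, n & d].
  by exists d'; split=> // e; rewrite ed' eD.
have [udd pddD] : uniq (g :: dd) /\ perm_eq (g :: dd) D.
  have pq : perm_eq (g :: dd) [:: g, k, n & d] by rewrite perm_cons.
  by rewrite (perm_uniq pq) (perm_trans pq pd).
have dr : ~~ has (mem (flatten DD1)) (g :: dd).
  apply: contra dD => /hasP[x xs xD]; apply/hasP; exists x; last by rewrite /= -(perm_mem pD1).
  by move: xs; rewrite in_cons (perm_mem pdd).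
have sdd : 1 < size dd by rewrite (perm_size pdd).
have [|P3b [Fb [Sb _ _]]] := state_addD Sa udd (last_neq udd sdd) dr.
  by rewrite ldd; case: (oa) => //; rewrite sameC same_out.
apply: (odd_system_build (P3 := P3b) (F := Fb) pC pD pc0C ec0 pddD edd sC1 pD1 eD1).
by move: Sb; rewrite ldd gPa; case: (oa); rewrite ?kPa ?(negPf hPa).
Qed.

(** Either some vertex lies on cycles of one family only, or both families cover the same vertices
    and any of these is a crossing point. *)
Lemma odd_systemP CC DD : cycles CC -> cycles DD -> edge_disjoint CC DD ->
  CC ++ DD != [::] -> odd_system CC DD.
Proof.
move=> cC cD ed nCD.
case: (boolP (all (mem (flatten CC)) (flatten DD))) => [/allP DC|]; last first.
  by rewrite -has_predC => /hasP[k kD kC]; apply: (odd_system_uncovered (k := k)).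
case: (boolP (all (mem (flatten DD)) (flatten CC))) => [/allP CD|]; last first.
  rewrite -has_predC => /hasP[k kC kD]; apply: odd_system_sym.
  exact: (odd_system_uncovered (k := k)).
have [g gC] : exists g, g \in flatten CC.
  case: CC DD nCD cC cD DC {CD ed} => [|C CC] [|D DD] // _.
  - move=> _ /cycles_cons[_ + _ _]; case: D => [|g D] // _ /(_ g).
    by rewrite mem_flatten_cons mem_head => /(_ isT).
  - by case/cycles_cons; case: C => [|g C] //; exists g; rewrite mem_flatten_cons mem_head.
  - by case/cycles_cons; case: C => [|g C] //; exists g; rewrite mem_flatten_cons mem_head.
by apply: (odd_system_crossing (g := g)) => //; exact: CD.
Qed.

End OddSystems.

(** * Three cycles *)

Section ThreeCycles.

Variable T : finType.
Implicit Types (s t c d p C D K W E F A : seq T) (P Q CC DD : seq (seq T)) (e : {set T}).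
Implicit Types (x y k h g v m : T) (M : pred T).

Definition three_cycles CC DD := exists c1 c2 c3, [/\ uniq c1, uniq c2, uniq c3
    & forall e, ce c1 e (+) ce c2 e (+) ce c3 e = ces CC e (+) ces DD e].

Lemma odd_system_triple CC DD : odd_system CC DD ->
  exists V1 V2 V3, [/\ triple V1 V2 V3 (fun e => ces CC e (+) ces DD e),
    [/\ uniq V1, uniq V2 & uniq V3] &
    {subset V1 ++ V2 ++ V3 <= flatten CC ++ flatten DD}].
Proof.
move=> [CC' [DD' [P3 [F [[P1 [P2 [W [E [S o]]]]] sC sD eq]]]]].
have sP3 : {subset flatten P3 <= flatten CC' ++ flatten DD'}.
  by apply: (@state_sub _ _ _ _ F true); exists P1, P2, W, E.
case: S => [lk [q1 q2 _] _ _ eS]; have [z1 [z2 [z3 [a [b [c [p l ez]]]]]]] := linked_triple lk o.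
exists (flatten P1), (flatten P2), (flatten P3); split.
- by exists z1, z2, z3, a, b, c; split=> // e; rewrite ez eS eq.
- by case: lk => [[u1 _ _] [u2 _ _] [u3 _ _] _].
- move=> x; rewrite [x \in flatten P1 ++ _]mem_cat (perm_mem q1) => /orP[/sC //|].
  rewrite mem_cat (perm_mem q2) => /orP[/sD //|/sP3].
  by rewrite mem_cat => /orP[/sC|/sD].
Qed.

Lemma two_odd_systems CC1 DD1 CC2 DD2 : odd_system CC1 DD1 -> odd_system CC2 DD2 ->
  ~~ has (mem (flatten CC1 ++ flatten DD1)) (flatten CC2 ++ flatten DD2) ->
  three_cycles (CC1 ++ CC2) (DD1 ++ DD2).
Proof.
move=> /odd_system_triple[U1 [U2 [U3 [tU [u1 u2 u3] sU]]]].
move=> /odd_system_triple[V1 [V2 [V3 [tV [v1 v2 v3] sV]]]] dis.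
have uc (U V : seq T) : uniq U -> uniq V -> {subset U <= U1 ++ U2 ++ U3} ->
    {subset V <= V1 ++ V2 ++ V3} -> uniq (U ++ V).
  move=> uU uV iU iV; rewrite cat_uniq uU uV andbT; apply: contra dis => /hasP[x xV xU].
  by apply/hasP; exists x; [apply/sV/iV | apply/sU/iU].
have [||| c1 [c2 [c3 [w1 w2 w3 ec]]]] := two_triples_cycles tU tV.
- by apply: uc => // x xx; rewrite !mem_cat xx.
- by apply: uc => // x xx; rewrite !mem_cat xx orbT.
- by apply: uc => // x xx; rewrite !mem_cat xx !orbT.
by exists c1, c2, c3; split=> // e; rewrite ec !ces_cat; xring.
Qed.

Lemma state_even_cycles CC DD P3 F K : state CC DD P3 F false -> K \in P3 -> EF_piece F K ->
  three_cycles CC DD.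
Proof.
move=> [P1 [P2 [W [E [S o]]]]] KP eK.
by have [|c1 [c2 [c3 ?]]] := sys_even_cycles S _ KP eK; [rewrite o | exists c1, c2, c3].
Qed.

Lemma state_EF_piece CC DD P3 F : state CC DD P3 F true -> exists2 K, K \in P3 & EF_piece F K.
Proof. by move=> [P1 [P2 [W [E [S o]]]]]; apply: sys_EF_piece S o. Qed.

(** The toggle with the families exchanged: [k] moves from [E] to both [W] and [F]. *)
Lemma state_toggleE CC DD P3 F o k : state CC DD P3 F o -> k \in flatten P3 -> k \notin flatten DD ->
  exists F', state CC ([:: k] :: DD) P3 F' (~~ o) /\ (forall z, z != k -> (z \in F') = (z \in F)).
Proof.
move=> [P1 [P2 [W [E [S o']]]]] kP kD.
have kE : k \in E by rewrite -(sys_contact (sys_sym S)).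
exists (k :: F); split; last by move=> z zk; rewrite inE (negPf zk).
exists P1, ([:: k] :: P2), (k :: W), (rem k E); split; last by rewrite /= o'.
exact/sys_sym/sys_toggle/kD/kE/sys_sym.
Qed.

Lemma EF_piece_eq F F' K : {in ends K, F =i F'} -> EF_piece F K = EF_piece F' K.
Proof.
by case: K => [|x s] //= eF; rewrite !eF // !inE eqxx ?orbT.
Qed.

Lemma split_first M p : has M p -> exists p1 m p2, [/\ p = p1 ++ m :: p2, M m & ~~ has M p1].
Proof.
move=> hM; have := hM; rewrite has_find => lt.
case: p hM lt => [|x0 p] // hM lt; set q := x0 :: p in hM lt *.
exists (take (find M q) q), (nth x0 q (find M q)), (drop (find M q).+1 q); split.
- by rewrite -drop_nth // cat_take_drop.
- exact: nth_find.
- by rewrite has_take_leq ?ltnn ?find_size.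
Qed.

(** From the unmarked vertex [v] take the first marked vertex in each direction and cut just before
    it. Two different marked vertices on [C] prevent these from coinciding. *)
Lemma two_boundaries C M v g g' : uniq C -> v \in C -> g \in C -> g' \in C -> g != g' ->
  ~~ M v -> M g -> M g' ->
  exists m1 s1 m2 s2, [/\ m1 != m2,
    [/\ perm_eq (m1 :: s1) C, ce (m1 :: s1) =1 ce C, M m1 & ~~ M (last m1 s1)] &
    [/\ perm_eq (m2 :: s2) C, ce (m2 :: s2) =1 ce C, M m2 & ~~ M (last m2 s2)]].
Proof.
move=> uC /rot_mem[p [pC eC]] gC g'C gg nv Mg Mg'.
have gp x : x \in C -> M x -> x \in p.
  by rewrite -(perm_mem pC) inE => /orP[/eqP->|//]; rewrite (negPf nv).
have [|p1 [m1 [p2 [ep Mm1 np1]]]] := @split_first M p; first by apply/hasP; exists g; rewrite ?gp.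
have : has M p2.
  have [eg|ng] := eqVneq g m1.
    apply/hasP; exists g' => //; have := gp _ g'C Mg'; rewrite ep mem_cat inE -eg eq_sym (negPf gg) /=.
    by case/orP=> // xp; case/hasP: np1; exists g'.
  apply/hasP; exists g => //; have := gp _ gC Mg; rewrite ep mem_cat inE (negPf ng).
  by case/orP=> // xp; case/hasP: np1; exists g.
rewrite -has_rev => /split_first[q2 [m2 [q1 [eq2 Mm2 nq2]]]].
have {}eq2 : p2 = rev q1 ++ m2 :: rev q2.
  by rewrite -[p2]revK eq2 rev_cat rev_cons -cats1 -catA.
exists m1, (p2 ++ v :: p1), m2, (rev (rev q2 ++ v :: p1 ++ m1 :: rev q1)).
have e1 : m1 :: p2 ++ v :: p1 = rot (size (v :: p1)) (v :: p).
  by rewrite ep -[v :: p1 ++ _]/((v :: p1) ++ _) rot_size_cat.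
have e2 : rcons (rev q2 ++ v :: p1 ++ m1 :: rev q1) m2 = rot (size (v :: p1 ++ m1 :: rev q1 ++ [:: m2])) (v :: p).
  rewrite ep eq2 (_ : v :: p1 ++ m1 :: rev q1 ++ m2 :: rev q2 =
     (v :: p1 ++ m1 :: rev q1 ++ [:: m2]) ++ rev q2); last by rewrite /= -!catA /= -!catA.
  by rewrite rot_size_cat -cats1 -!catA /= -!catA /= -?catA.
have m2p : m2 \in p2 by rewrite eq2 mem_cat mem_head orbT.
split.
- have : uniq (v :: p) by rewrite (perm_uniq pC).
  rewrite ep cons_uniq => /andP[_]; rewrite cat_uniq => /and3P[_ _ /= /andP[+ _]].
  by apply: contraNneq => ->.
- split=> // [|e|]; rewrite ?e1 ?perm_rot ?ce_rot //.
  rewrite last_cat /=; case/lastP: (p1) np1 => [|q y] //; rewrite last_rcons has_rcons.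
  by case/norP.
- rewrite -rev_rcons e2; split=> // [|e|]; rewrite ?perm_rev ?ce_rev ?perm_rot ?ce_rot //.
  rewrite -has_rev in nq2; case: (rev q2) nq2 => [|y q] /=; first by rewrite rev_cons last_rcons.
  by rewrite rev_cons last_rcons => /norP[].
Qed.

End ThreeCycles.

(** * Adding a family while keeping one vertex off the removed edges *)

Section ThreeCycles2.

Variable T : finType.
Implicit Types (s t c d p C D K W E F A : seq T) (P Q CC DD : seq (seq T)) (e : {set T}).
Implicit Types (x y k h g v m : T) (M : pred T).

(** A stage at which the cycles [DDa] of [DD] are already in the system and [DDr] are still to be
    added. *)
Definition progress CC DD P3 F o DDa DDr :=
  [/\ state CC DDa P3 F o, cycles DDr, perm_eq (flatten DDa ++ flatten DDr) (flatten DD),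
      uniq (flatten DD) & forall e, ces DDa e (+) ces DDr e = ces DD e].

Lemma progress_step CC DD P3 F o DDa DDr D DDr' x s : progress CC DD P3 F o DDa DDr ->
  perm_eq DDr (D :: DDr') -> perm_eq (x :: s) D -> ce (x :: s) =1 ce D -> ~~ same P3 x (last x s) ->
  exists P3' F' o', progress CC DD P3' F' o' ((x :: s) :: DDa) DDr' /\
     flatten P3' =i [:: x, last x s & flatten P3].
Proof.
move=> [S cD pD uD eD] pr ps es ns.
have [uD0 sD cr dr] := cycles_cons (cycles_perm pr cD).
have us : uniq (x :: s) by rewrite (perm_uniq ps).
have ss : 1 < size s by rewrite -ltnS -[(size s).+1]/(size (x :: s)) (perm_size ps).
have ds : ~~ has (mem (flatten DDa)) (x :: s).
  have : uniq (flatten DDa ++ flatten DDr) by rewrite (perm_uniq pD).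
  rewrite cat_uniq => /and3P[_ dis _]; apply: contra dis => /hasP[y ys yD].
  apply/hasP; exists y => //; rewrite (perm_mem (perm_flatten pr)) mem_flatten_cons.
  by rewrite -(perm_mem ps) ys.
have [P3' [F' [S' f' _]]] := state_addD S us (last_neq us ss) ds ns.
exists P3', F', ((x \in flatten P3) (+) (last x s \in flatten P3) (+) o); split=> //.
split=> // [|e].
- apply: perm_trans pD; rewrite flatten_cons -catA perm_catCA perm_cat2l.
  apply: (@perm_trans _ (flatten (D :: DDr'))); last by rewrite perm_sym perm_flatten.
  by rewrite flatten_cons perm_cat2r.
- by rewrite -eD (ces_perm _ pr) !ces_cons es; xring.
Qed.

(* A single-edge analogue of safe_cut, avoiding v: at this stage P3 consists of
   edges of CC only, and those are not edges of DD. *)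
Lemma progress_avoid CC0 CC DD P3 F o v g : cycles DD -> edge_disjoint CC0 DD ->
  state CC [::] P3 F o -> v != g -> v \notin flatten P3 -> g \notin flatten P3 ->
  (forall x y, x != y -> same P3 x y -> exists2 C, C \in CC0 & ce C [set x; y]) ->
  exists DDa DDr P3' F' o', [/\ progress CC DD P3' F' o' DDa DDr,
    {subset flatten P3 <= flatten P3'}, {subset flatten P3' <= flatten P3 ++ flatten DD},
    v \notin flatten P3' & (v \notin flatten DDr) && ((g \in flatten P3') || (g \notin flatten DDa))].
Proof.
move=> cD ed S vg vP gP cP.
have pr0 : progress CC DD P3 F o [::] DD.
  by split=> //; [case/andP: cD | move=> e; rewrite ces_nil].
case: (boolP (v \in flatten DD)) => vD; last first.
  exists [::], DD, P3, F, o; split=> //; first by move=> x xP; rewrite mem_cat xP.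
  by rewrite vD orbT.
have [D [s [DD' [pD ps es [us ss cD' dis]]]]] := pick_cycle cD vD.
have DDD : D \in DD by rewrite (perm_mem pD) mem_head.
have vD' : v \notin flatten DD' by apply: contra dis => vD'; apply/hasP; exists v; rewrite ?mem_head.
suff [x [s' [ps' es' ns nv ng]]] : exists x s', [/\ perm_eq (x :: s') D, ce (x :: s') =1 ce D,
   ~~ same P3 x (last x s'), v \notin [:: x; last x s'] & (g \in [:: x; last x s']) || (g \notin D)].
  have [P3' [F' [o' [pr' f']]]] := progress_step pr0 pD ps' es' ns.
  exists [:: x :: s'], DD', P3', F', o'; split=> //.
  - by move=> y yP; rewrite f' !inE yP !orbT.
  - move=> y; rewrite f' mem_cat (perm_mem (perm_flatten pD)) mem_flatten_cons -(perm_mem ps').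
    by rewrite !in_cons => /or3P[->|/eqP->|->]; rewrite -?in_cons ?mem_last ?orbT.
  - by move: nv; rewrite f' !inE !negb_or (negPf vP) andbT.
  - rewrite vD' f' /= cats0 -(perm_mem ps') in ng *.
    by case/orP: ng => [|->]; rewrite ?orbT // !inE => /orP[->|->]; rewrite ?orbT.
case: (boolP (g \in D)) => gD.
  have [t [pt et]] := rot_mem gD.
  have ut : uniq (g :: t) by rewrite (perm_uniq pt) -(perm_uniq ps).
  have st : 1 < size t by rewrite -ltnS -[(size t).+1]/(size (g :: t)) (perm_size pt) -(perm_size ps).
  have [t' [pt' et' lt' _]] := two_cuts ut st.
  have [lv|lv] := eqVneq (last g t) v.
    exists g, t'; split=> //.
    - by apply: perm_trans pt; rewrite perm_cons.
    - by move=> e; rewrite et' et.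
    - exact: same_out.
    - by rewrite !inE negb_or vg eq_sym -lv.
    - by rewrite mem_head.
  exists g, t; split=> //; first exact: same_out.
  - by rewrite !inE negb_or vg eq_sym.
  - by rewrite mem_head.
case: s ps es us ss dis => [|d1 [|d2 s]] // ps es us _ _.
have rt : [:: d2 & rcons (rcons s v) d1] = rot 2 [:: v, d1, d2 & s] by rewrite /rot /= -!cats1 -catA.
exists d2, (rcons (rcons s v) d1); rewrite rt perm_rot last_rcons; split=> //.
- by move=> e; rewrite ce_rot es.
- have u1 : uniq [:: d1, d2 & rcons s v] by rewrite -!rcons_cons -rot1_cons rot_uniq.
  apply/negP=> s12; have [|C CC0C eC] := cP _ _ _ s12.
    by move: u1; rewrite cons_uniq inE eq_sym => /andP[/norP[]].
  apply: (ed C D _ CC0C DDD eC); rewrite -es setUC.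
  have := ce_head u1; rewrite size_rcons => /(_ isT).
  by rewrite -!rcons_cons ce_rcons.
- by move: us; rewrite cons_uniq !inE !negb_or => /andP[/and3P[-> -> _] _].
- by rewrite orbT.
Qed.

(** The cycle through [v] is added before the others, at a cut away from [v]; no remaining cycle
    contains [v], so later cuts avoid it. The cycle through [g], if not yet added, comes next and is
    cut at [g]. *)
Lemma state_addD_avoid CC0 CC DD P3 F o v g : cycles DD -> edge_disjoint CC0 DD ->
  state CC [::] P3 F o -> v != g -> v \notin flatten P3 -> g \notin flatten CC ->
  (forall x y, x != y -> same P3 x y -> exists2 C, C \in CC0 & ce C [set x; y]) ->
  exists DD' P3' F' o', [/\ state CC DD' P3' F' o', perm_eq (flatten DD') (flatten DD),
    ces DD' =1 ces DD, {subset flatten P3 <= flatten P3'} &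
    [/\ {subset flatten P3' <= flatten P3 ++ flatten DD},
    v \notin flatten P3' & g \in flatten DD -> g \in flatten P3']].
Proof.
move=> cD ed S vg vP gC cP.
have gP : g \notin flatten P3 by apply/negP => /(state_sub S); rewrite mem_cat orbF (negPf gC).
have [DDa [DDr [P3a [Fa [oa [pra la ma va /andP[vr ga]]]]]]] := progress_avoid cD ed S vg vP gP cP.
have [DDb [DDr' [P3b [Fb [ob [prb lb mb vb /andP[vr' gb]]]]]]] : exists DDb DDr' P3b Fb ob,
   [/\ progress CC DD P3b Fb ob DDb DDr', {subset flatten P3a <= flatten P3b},
   {subset flatten P3b <= flatten P3 ++ flatten DD},
   v \notin flatten P3b & (v \notin flatten DDr') && ((g \in flatten P3b) || (g \notin flatten DD))].
  have [Sa cr pD uD eD] := pra.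
  case: (boolP (g \in flatten DDr)) => gr; last first.
    exists DDa, DDr, P3a, Fa, oa; split=> //; rewrite vr /=.
    by rewrite -(perm_mem pD) mem_cat (negPf gr) orbF; case/orP: ga => ->; rewrite ?orbT.
  have [D [s [DD' [pr ps es [us ss cD' dis]]]]] := pick_cycle cr gr.
  have gPa : g \notin flatten P3a.
    apply/negP => /(state_sub Sa); rewrite mem_cat (negPf gC) /=; apply/negP.
    have : uniq (flatten DDa ++ flatten DDr) by rewrite (perm_uniq pD).
    by rewrite cat_uniq => /and3P[_ /hasPn/(_ g gr)].
  have [P3b [Fb [ob [prb fb]]]] := progress_step pra pr ps es (same_out _ gPa).
  have sr y : y \in g :: s -> y \in flatten DDr.
    by rewrite (perm_mem (perm_flatten pr)) mem_flatten_cons -(perm_mem ps) => ->.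
  have nv y : y \in g :: s -> v != y by move=> /sr yr; apply: contraNneq vr => ->.
  exists ((g :: s) :: DDa), DD', P3b, Fb, ob; split=> //.
  - by move=> y yP; rewrite fb !inE yP !orbT.
  - move=> y; rewrite fb !inE => /or3P[/eqP->|/eqP->|/ma //].
    + by rewrite mem_cat -(perm_mem pD) mem_cat gr !orbT.
    + by rewrite mem_cat -(perm_mem pD) mem_cat sr ?mem_last ?orbT.
  - by rewrite fb !inE !negb_or va !nv ?mem_head ?mem_last.
  - rewrite fb mem_head andbT; apply: contra vr => vD'.
    by rewrite (perm_mem (perm_flatten pr)) mem_flatten_cons vD' orbT.
have [Sb cr pD uD eD] := prb.
have [|DD' [P3' [F' [o' [S' p' e' l' m']]]]] := state_addD_all Sb cr.
  by have := uD; rewrite -(perm_uniq pD) cat_uniq => /and3P[_ ].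
exists DD', P3', F', o'; split=> //.
- by apply: perm_trans p' _; rewrite perm_catC.
- by move=> e; rewrite e' -eD addbC.
- by move=> y /la/lb/l'.
split.
- move=> y /m'; rewrite mem_cat => /orP[/mb //|yr].
  by rewrite mem_cat -(perm_mem pD) mem_cat yr !orbT.
- by apply/negP=> /m'; rewrite mem_cat (negPf vb) (negPf vr').
- by case/orP: gb => [/l' //|/negPf->].
Qed.

End ThreeCycles2.

(** * Two crossing cycles *)

Section ThreeCycles3.

Variable T : finType.
Implicit Types (s t c d p C D K W E F A : seq T) (P Q CC DD : seq (seq T)) (e : {set T}).
Implicit Types (x y k h g v m : T) (M : pred T).

(** Follow [D] from a vertex of [C] to the first vertex outside [C]. *)
Lemma exit_edge C D : has (mem C) D -> ~~ all (mem C) D ->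
  exists g k d, [/\ perm_eq [:: g, k & d] D, ce [:: g, k & d] =1 ce D, g \in C & k \notin C].
Proof.
move=> /hasP[x xD xC] nall; have [p [pD eD]] := rot_mem xD.
have : has (predC (mem C)) p.
  move: nall; rewrite -(perm_all _ pD) -has_predC => /hasP[y].
  by rewrite inE => /orP[/eqP->|yp yC]; [move/negP; case | apply/hasP; exists y].
move=> /split_first[p1 [k [p2 [ep nk hp1]]]].
have : all (mem C) (x :: p1).
  by apply/allP => y; rewrite inE => /orP[/eqP->//|yp]; apply: contraNT hp1 => yC; apply/hasP; exists y.
have [q [g eq]] : exists q g, x :: p1 = rcons q g.
  by case/lastP: {ep hp1}(x :: p1) (mem_head x p1) => // q g _; exists q, g.
rewrite eq all_rcons => /andP[gC _]; exists g, k, (p2 ++ q).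
have eL : x :: p = q ++ (g :: k :: p2) by rewrite ep -cat_cons eq cat_rcons.
split=> // [|e].
- by apply: perm_trans pD; rewrite eL -!cat_cons perm_catC.
- by rewrite -eD eL -!cat_cons ce_cat.
Qed.

(** Otherwise [C] is the triangle on [g], [g2], [h] and contains the edge [g h]. *)
Lemma third_vertex C g g2 h : uniq C -> 2 < size C -> g \in C -> g2 \in C -> g != g2 ->
  g != h -> (h \in C -> ~~ ce C [set g; h]) ->
  exists v, [/\ v \in C, v != g, v != g2 & v != h].
Proof.
move=> uC sC gC g2C gg2 gh nadj.
case: (boolP (all (mem [:: g; g2; h]) C)) => [/allP sub|]; last first.
  rewrite -has_predC => /hasP[v vC]; rewrite /= !inE !negb_or => /and3P[v1 v2 v3].
  by exists v.
have hC : h \in C by have [_ ->] := uniq_min_size uC sub sC; rewrite !inE eqxx !orbT.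
have sC3 : size C = 3 by have [-> _] := uniq_min_size uC sub sC.
have [s [ps es]] := rot_mem gC; case/negP: (nadj hC); rewrite -es.
have us : uniq (g :: s) by rewrite (perm_uniq ps).
have : size (g :: s) = 3 by rewrite (perm_size ps).
move: hC; rewrite -(perm_mem ps); case: s ps es us => [|a [|b [|]]] // _ _ us.
rewrite !inE [h == g]eq_sym (negPf gh) orFb => /orP[/eqP->|/eqP->] _; first by apply: ce_head.
by apply: ce_last.
Qed.

(** [C] is kept for last. The other cycles, with [D] as the last of them, are cut so that the parity
    is odd; this yields a component [K] with ends in [E] and [F]. Then [C] is cut away from [K] so
    that the parity becomes even, and [K] splits the system. The edge [g k] of [D] leaving [C]
    serves to make the first parity odd, and the vertex [g2] of [C] outside [D] helps with the
    second. *)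
Lemma three_cycles_exit CC DD C D : cycles CC -> cycles DD -> edge_disjoint CC DD ->
  C \in CC -> D \in DD -> has (mem C) D -> ~~ all (mem C) D -> ~~ all (mem D) C ->
  three_cycles CC DD.
Proof.
move=> cC cD ed CCC DDD hCD nDC nCD.
have [g [k [d [pd eD gC kC]]]] := exit_edge hCD nDC.
have [g2 g2C g2D] : exists2 g2, g2 \in C & g2 \notin D by apply/hasP; move: nCD; rewrite -has_predC.
have pC := perm_to_rem CCC; have pD := perm_to_rem DDD.
set CC' := rem C CC in pC; set DD' := rem D DD in pD.
have [uC sC cC' dC] := cycles_cons (cycles_perm pC cC).
have [uD sD cD' dD] := cycles_cons (cycles_perm pD cD).
have gD : g \in D by rewrite -(perm_mem pd) mem_head.
have kD : k \in D by rewrite -(perm_mem pd) !inE eqxx orbT.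
have ud : uniq [:: g, k & d] by rewrite (perm_uniq pd).
have sd : 0 < size d by have := perm_size pd; rewrite /= => eqs; move: sD; rewrite -eqs !ltnS.
pose h := last k d.
have hD : h \in D by rewrite -(perm_mem pd) -[h]/(last g [:: k & d]) mem_last.
have gh : g != h by exact: (last_neq ud).
have kh : k != h.
  have uk : uniq (k :: d) by move: ud; rewrite cons_uniq => /andP[].
  by case: (d) sd uk @h {pd eD ud hD gh} => // y d' _ uk; apply: contraTneq uk => -> /=; rewrite -/(last y d') mem_last.
have gg2 : g != g2 by apply: contraTneq gD => ->.
have gk : g != k by move: ud; rewrite cons_uniq inE => /andP[/norP[]].
have [|v [vC vg vg2 vh]] := third_vertex uC sC gC g2C gg2 gh.
  move=> _; apply/negP => eC; apply: (ed C D _ CCC DDD eC).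
  by rewrite -eD; apply: ce_last.
have out C0 CC0 x : ~~ has (mem (flatten CC0)) C0 -> x \in C0 -> x \notin flatten CC0.
  by move=> dis xC; apply: contra dis => xCC; apply/hasP; exists x.
have ed' : edge_disjoint CC' DD'.
  by move=> C0 D0 e C0C D0D; apply: ed; [rewrite (perm_mem pC)|rewrite (perm_mem pD)]; rewrite inE ?C0C ?D0D orbT.
have [CC1 [P3 [S [pC1 eC1] hP kP cP]]] := state_start cC' kh.
have vP : v \notin flatten P3.
  by apply/negP => /(state_sub S); rewrite mem_cat orbF (perm_mem pC1); apply/negP/out/vC.
have g2C1 : g2 \notin flatten CC1 by rewrite (perm_mem pC1) (out C).
have [DD1 [P31 [F1 [o1 [S1 pD1 eD1 l1 [m1 v1 g21]]]]]] := state_addD_avoid cD' ed' S vg2 vP g2C1 cP.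
have gP1 : g \notin flatten P31.
  apply/negP => /m1; rewrite mem_cat (negPf (out _ _ _ dD gD)) orbF => /(state_sub S).
  by rewrite mem_cat orbF (perm_mem pC1) (negPf (out _ _ _ dC gC)).
have hP1 : h \notin flatten P31.
  by apply/negP => /m1; rewrite mem_cat (negPf (out _ _ _ dD hD)) (negPf hP).
have [d' [pd' ed'' _ hd']] := two_cuts ud sd.
(* The end [g] is new to [P31]. If the parity is odd, [D] is cut at [g h], with [h] new as well; if
   it is even, at [g k]. *)
have [dd [pdd edd ldd]] : exists dd, [/\ perm_eq (g :: dd) D, ce (g :: dd) =1 ce D
    & last g dd = if o1 then h else k].
  case: (o1); first by exists [:: k & d].
  exists d'; split=> // [|e]; first by apply: perm_trans pd; rewrite perm_cons.
  by rewrite ed'' eD.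
have udd : uniq (g :: dd) by rewrite (perm_uniq pdd).
have dr : ~~ has (mem (flatten DD1)) (g :: dd).
  rewrite (perm_has _ pdd); apply: contra dD => /hasP[x xs xD]; apply/hasP; exists x => //.
  by rewrite /= -(perm_mem pD1).
have [|P32 [F2 [S2 f2 _]]] := state_addD S1 udd _ dr (same_out _ gP1).
  by rewrite ldd; case: (o1).
rewrite (negPf gP1) ldd addFb in S2; rewrite ldd in f2.
have v2 : v \notin flatten P32.
  rewrite f2 !inE !negb_or vg v1 andbT; case: (o1) => //.
  by apply: contraTneq vC => ->.
have g2m : g2 \in flatten DD' -> g2 \in flatten P32 by move=> /g21 g2P; rewrite f2 !inE g2P !orbT.
have gP2 : g \in flatten P32 by rewrite f2 mem_head.
(* In the even case the cut at [g k] has changed the parity if [k] was on [P31], in particular if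
   [k] is on a cycle of [CC']. Otherwise [k] is an end in [F] outside [CC1] and is toggled; as [k]
   is not on [C], the one-vertex cycle does not block [C]. *)
have [CC3 [F3 [S3 eC3 C3]]] : exists CC3 F3, [/\ state CC3 ((g :: dd) :: DD1) P32 F3 true,
    ces CC3 =1 ces CC' & ~~ has (mem (flatten CC3)) C].
  have C1 : ~~ has (mem (flatten CC1)) C.
    by apply: contra dC => /hasP[x xs xD]; apply/hasP; exists x => //; rewrite /= -(perm_mem pC1).
  case: (boolP (k \in flatten CC')) => kCC.
    exists CC1, F2; split=> //; move: S2; case: (o1); first by rewrite (negPf hP1).
    by rewrite l1 ?kP.
  move: S2 f2; case: (o1) => S2 f2; first by exists CC1, F2; split=> //; rewrite (negPf hP1) in S2.
  have kC1 : k \notin flatten CC1 by rewrite (perm_mem pC1).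
  have kP1 : k \notin flatten P31.
    apply/negP => /m1; rewrite mem_cat (negPf (out _ _ _ dD kD)) orbF => /(state_sub S).
    by rewrite mem_cat orbF (negPf kC1).
  rewrite (negPf kP1) /= in S2.
  have [||F3 [S3 _]] := @state_toggle _ _ _ _ _ _ k S2 => //.
    by rewrite -(state_contact S2) // f2 !inE eqxx orbT.
  exists ([:: k] :: CC1), F3; split=> // [e|]; first by rewrite ces_cons /= xexx eC1.
  by apply/hasPn => x xC; rewrite /= inE negb_or (out _ _ _ C1 xC) andbT; apply: contraNneq kC => <-.
(* A cut of [C] between a marked and an unmarked vertex can change the parity: at once if the marked
   vertex is on [P32], and by a toggle if it is [g2] and new. *)
pose M x := (x \in flatten P32) || (x == g2).
have Cout x s : perm_eq (x :: s) C -> ~~ has (mem (flatten CC3)) (x :: s) by move=> ps; rewrite (perm_has _ ps).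
have [|||m1' [s1 [m2 [s2 [m12 [ps1 es1 M1 N1] [ps2 es2 M2 N2]]]]]] :=
    two_boundaries (M := M) uC vC gC g2C gg2.
- by rewrite /M negb_or v2.
- by rewrite /M gP2.
- by rewrite /M eqxx orbT.
have memC m s : perm_eq (m :: s) C -> m \in C by move=> ps; rewrite -(perm_mem ps) mem_head.
(* One of the two boundary vertices is off [K]: both would be ends of [K] in [F], but [K] has only
   one end there. *)
have [K [m [s [KP eK mK [ps es Mm Nm]]]]] : exists K m s, [/\ K \in P32, EF_piece F3 K, m \notin K
    & [/\ perm_eq (m :: s) C, ce (m :: s) =1 ce C, M m & ~~ M (last m s)]].
  have [K KP eK] := state_EF_piece S3.
  case: (boolP (m1' \in K)) => m1K; last by exists K, m1', s1.
  case: (boolP (m2 \in K)) => m2K; last by exists K, m2, s2.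
  have inF m s : perm_eq (m :: s) C -> m \in K -> (m \in F3) && (m \in ends K).
    move=> ps mK; have mC := out _ _ _ C3 (memC _ _ ps).
    have mP : m \in flatten P32 by apply/flattenP; exists K.
    rewrite -(state_contact S3) // mP.
    have mE : m \in endss P32 by apply: (state_end S3 mP); rewrite mC.
    by case: S3 => P1 [P2 [W [E [[[_ _ [u3 _ _] _] _ _ _ _] _]]]]; apply: end_in mE.
  have /andP[F1' E1] := inF _ _ ps1 m1K; have /andP[F2' E2] := inF _ _ ps2 m2K.
  case: K KP eK E1 E2 {m1K m2K inF} => [|x t] // KP /= eK; rewrite !inE.
  case/orP=> /eqP q1; case/orP => /eqP q2; subst m1' m2; rewrite ?eqxx // in m12.
  - by rewrite F1' F2' in eK.
  - by rewrite F1' F2' in eK.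
have uP : last m s \notin flatten P32 by case/norP: Nm.
have us : uniq (m :: s) by rewrite (perm_uniq ps).
have ss : 1 < size s by rewrite -ltnS -[(size s).+1]/(size (m :: s)) (perm_size ps).
have [|P34 [F4 [S4 f4 k4 F4E]]] := state_addC S3 us (last_neq us ss) (Cout _ _ ps).
  by rewrite sameC same_out.
have lK : last m s \notin K by apply: contra uP => lK; apply/flattenP; exists K.
have KP4 : K \in P34 by exact: k4.
have eK4 : EF_piece F4 K.
  rewrite (EF_piece_eq (F' := F3)) // => z zK; apply: F4E; rewrite !inE negb_or.
  by apply/andP; split; [apply: contraNneq mK|apply: contraNneq lK] => <-; apply: mem_ends.
have eT e : ces ((m :: s) :: CC3) e (+) ces ((g :: dd) :: DD1) e = ces CC e (+) ces DD e.
  by rewrite (ces_perm _ pC) (ces_perm _ pD) !ces_cons es edd eC3 eD1.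
rewrite (negPf uP) /= in S4.
case: (boolP (m \in flatten P32)) => mP; rewrite ?mP ?(negPf mP) /= in S4.
  have [c1 [c2 [c3 [u1 u2 u3 ec]]]] := state_even_cycles S4 KP4 eK4.
  by exists c1, c2, c3; split=> // e; rewrite ec eT.
have eg2 : m = g2 by apply/eqP; move: Mm; rewrite /M (negPf mP).
(* A cycle of [DD'] through [g2] would have put it on [P32], and [D] avoids [g2]; hence [g2] may be
   toggled as a one-vertex cycle of [DD]. *)
have mD : m \notin flatten ((g :: dd) :: DD1).
  rewrite mem_flatten_cons (perm_mem pdd) (perm_mem pD1) negb_or eg2 g2D.
  by apply/negP => /g2m; rewrite -eg2 (negPf mP).
have [||F5 [S5 F5E]] := @state_toggleE _ _ _ _ _ _ m S4 => //.
  by rewrite f4 mem_head.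
have eK5 : EF_piece F5 K.
  rewrite (EF_piece_eq (F' := F4)) // => z zK; apply: F5E.
  by apply: contraNneq mK => <-; apply: mem_ends.
have [c1 [c2 [c3 [u1 u2 u3 ec]]]] := state_even_cycles S5 KP4 eK5.
by exists c1, c2, c3; split=> // e; rewrite ec -eT (ces_cons [:: m]) [ce [:: m] e]/= xexx.
Qed.

End ThreeCycles3.

(** * Nested cycles and the general case *)

Section ThreeCycles4.

Variable T : finType.
Implicit Types (s t c d p C D K W E F A : seq T) (P Q CC DD : seq (seq T)) (e : {set T}).
Implicit Types (x y k h g v m : T) (M : pred T).

Lemma cycles_filter (b : pred (seq T)) CC : cycles CC -> cycles (filter b CC).
Proof.
move=> /andP[u a]; apply/andP; split; last by rewrite all_filter; apply: sub_all a => s /= ->; rewrite implybT.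
by have := perm_uniq (perm_flatten_filterC b CC); rewrite u cat_uniq => /and3P[].
Qed.

Lemma edge_disjoint_sub CC DD CC' DD' : edge_disjoint CC DD ->
  {subset CC' <= CC} -> {subset DD' <= DD} -> edge_disjoint CC' DD'.
Proof. by move=> ed sC sD C D e CC0 DD0; apply: ed; [apply: sC|apply: sD]. Qed.

Lemma three_cycles_sym CC DD : three_cycles CC DD -> three_cycles DD CC.
Proof.
by move=> [c1 [c2 [c3 [u1 u2 u3 ec]]]]; exists c1, c2, c3; split=> // e; rewrite ec addbC.
Qed.

(** The predicates divide the two families into two vertex-disjoint nonempty parts. Each part has an
    odd system by itself, so the even case does not arise. *)
Lemma three_cycles_split (b b' : pred (seq T)) CC DD :
  cycles CC -> cycles DD -> edge_disjoint CC DD ->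
  has b CC || has b' DD -> ~~ all b CC || ~~ all b' DD ->
  (forall C D, C \in CC -> D \in DD -> has (mem C) D -> b C = b' D) ->
  three_cycles CC DD.
Proof.
move=> cC cD ed ne1 ne2 sep.
have [uC uD] : uniq (flatten CC) /\ uniq (flatten DD) by move: cC cD => /andP[? _] /andP[? _].
have mf (a : pred (seq T)) L : {subset filter a L <= L} by move=> x; rewrite mem_filter => /andP[].
have odd1 : odd_system (filter b CC) (filter b' DD).
  apply: odd_systemP; rewrite ?cycles_filter //; first exact: edge_disjoint_sub ed _ _.
  move: ne1; rewrite !has_count -!size_filter.
  by case: (filter b CC) => [|? ?]; case: (filter b' DD).
have odd2 : odd_system (filter (predC b) CC) (filter (predC b') DD).
  apply: odd_systemP; rewrite ?cycles_filter //; first exact: edge_disjoint_sub ed _ _.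
  move: ne2; rewrite -!has_predC !has_count -!size_filter.
  by case: (filter (predC b) CC) => [|? ?]; case: (filter (predC b') DD).
have sepf x C D : C \in CC -> D \in DD -> x \in C -> x \in D -> b C = b' D.
  by move=> CCC DDD xC xD; apply: sep => //; apply/hasP; exists x.
have [|c1 [c2 [c3 [u1 u2 u3 ec]]]] := two_odd_systems odd1 odd2.
  apply/hasPn => x; rewrite [x \in _ ++ _]mem_cat => xV.
  rewrite -[~~ _]/(x \notin _ ++ _) mem_cat.
  apply/negP => xU; move: xU xV.
  have same_b L a (u : uniq (flatten L)) s t : s \in filter a L -> t \in filter (predC a) L -> x \in s -> x \in t -> False.
    rewrite !mem_filter => /andP[as_ sL] /andP[at_ tL] xs xt.
    by move: at_; rewrite /= -(flatten_uniq_eq u sL tL xs xt) as_.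
  case/orP => /flattenP[s sf xs]; case/orP => /flattenP[t tf xt].
  - exact: same_b uC _ _ sf tf xs xt.
  - move: sf tf; rewrite !mem_filter /= => /andP[bs sL] /andP[bt tL].
    by rewrite -(sepf x s t) // bs in bt.
  - move: sf tf; rewrite !mem_filter /= => /andP[bs sL] /andP[bt tL].
    by rewrite (sepf x t s) // bs in bt.
  - exact: same_b uD _ _ sf tf xs xt.
exists c1, c2, c3; split=> // e; rewrite ec.
by rewrite (ces_perm _ (permEl (perm_filterC b CC))) (ces_perm _ (permEl (perm_filterC b' DD))).
Qed.

(** A single cycle stands for itself, and the other family is a sum of two cycles. *)
Lemma three_cycles_few CC DD : cycles CC -> cycles DD -> size CC <= 1 -> three_cycles CC DD.
Proof.
move=> /andP[uC _] /andP[uD sD] sC; have nD : [::] \notin DD by apply/negP => /(allP sD).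
have uE : uniq (endss DD).
  have [] := sys_start uD; first by apply: sub_all sD => s /ltnW.
  by move=> [_ _ _ []].
case: CC uC sC => [|C [|]] // uC _.
  by exists [::], (flatten DD), (endss DD); split=> // e; rewrite -(ce_join e nD) ces_nil [ce [::] e]/=; xring.
rewrite /= cats0 in uC.
by exists C, (flatten DD), (endss DD); split=> // e; rewrite -(ce_join e nD) ces_cons ces_nil; xring.
Qed.

(** When no cycles cross, meeting cycles are nested. One part consists of an outer cycle, namely
    [C1] or a cycle [D1] containing its vertices, together with the cycles of the other family that
    meet it. A second cycle in the family of the outer one makes the other part nonempty. *)
Lemma three_cyclesP CC DD : cycles CC -> cycles DD -> edge_disjoint CC DD -> three_cycles CC DD.
Proof.
move=> cC cD ed; case: (leqP (size CC) 1) => sC; first exact: three_cycles_few.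
case: (leqP (size DD) 1) => sD; first by apply/three_cycles_sym/three_cycles_few.
pose exits C D := [&& has (mem C) D, ~~ all (mem C) D & ~~ all (mem D) C].
case: (boolP (has (fun C => has (exits C) DD) CC)) => [/hasP[C CCC /hasP[D DDD /and3P[h1 h2 h3]]]|].
  exact: three_cycles_exit cC cD ed CCC DDD h1 h2 h3.
move=> /hasPn lam.
have {lam} lam C D : C \in CC -> D \in DD -> has (mem C) D -> all (mem C) D || all (mem D) C.
  by move=> /lam/hasPn l /l; rewrite /exits negb_and negb_and !negbK => /orP[/negbTE->|].
have [uC uD] : uniq (flatten CC) /\ uniq (flatten DD) by move: cC cD => /andP[? _] /andP[? _].
case: CC cC ed sC lam uC => [|C1 [|C2 CC]] // cC ed _ lam uC; set CCs := [:: C1, C2 & CC] in cC ed lam uC *.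
have C1C : C1 \in CCs := mem_head _ _.
have [nC1 nC2] : C1 != [::] /\ C2 != [::].
  by move: cC => /andP[_ /and3P[]]; case: (C1); case: (C2).
have disj L s t : uniq (flatten L) -> s \in L -> t \in L -> has (mem s) t -> s = t.
  by move=> u sL tL /hasP[x xt xs]; apply: flatten_uniq_eq u sL tL xs xt.
case: (boolP (has (fun D => all (mem D) C1) DD)) => [/hasP[D1 D1D C1D1]|/hasPn nD1].
  have C1m : has (mem D1) C1.
    by case: (C1) nC1 C1D1 => // x s _ /= /andP[-> _].
  have sub C : C \in CCs -> has (mem D1) C -> all (mem D1) C.
    move=> CCC hC; have /(lam C D1 CCC D1D)/orP[D1C|//] : has (mem C) D1 by rewrite has_sym.
    suff <- : C1 = C by [].
    apply: disj CCC _ => //; rewrite has_sym; apply/hasP.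
    case: (C1) nC1 C1D1 => // x s _ /= /andP[xD _]; exists x; rewrite ?mem_head //.
    exact: (allP D1C).
  apply: (three_cycles_split (b := fun C => has (mem D1) C) (b' := pred1 D1)) => //.
  - by rewrite /= C1m.
  - apply/orP; right; apply/allPn.
    case: DD cD ed sD D1D lam uD {nC1 nC2 disj sub} => [|Da [|Db DD]] // cD _ _ _ _ uD.
    have : uniq [:: Da, Db & DD].
      by apply: uniq_components => //; apply/negP => /(allP (proj2 (andP cD))).
    rewrite cons_uniq inE => /andP[/norP[nab _] _].
    have [e1|] := eqVneq Da D1; last by exists Da; rewrite ?mem_head.
    by exists Db; rewrite ?inE ?eqxx ?orbT //= -e1 eq_sym.
  - move=> C D CCC DDD hCD /=; apply/idP/eqP => [hC|e1]; last by rewrite -e1 has_sym.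
    apply/esym; apply: (disj DD) => //; move/hasP: hCD => [x xD xC].
    by apply/hasP; exists x => //; apply: (allP (sub C CCC hC)).
apply: (three_cycles_split (b := pred1 C1) (b' := fun D => has (mem C1) D)) => //.
- by rewrite /= eqxx.
- apply/orP; left; apply/allPn; exists C2; first by rewrite !inE eqxx orbT.
  have : uniq CCs by apply: uniq_components => //; apply/negP => /(allP (proj2 (andP cC))).
  by rewrite cons_uniq inE => /andP[/norP[nab _] _]; rewrite /= eq_sym.
move=> C D CCC DDD hCD /=; apply/eqP/idP => [<- //|hD].
have := lam C1 D C1C DDD hD; rewrite (negPf (nD1 D DDD)) orbF => /allP sD1.
apply/esym; apply: (disj CCs) => //; move/hasP: hCD => [x xD xC].
by apply/hasP; exists x => //; apply: sD1.
Qed.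

Lemma three_pathsP CC DD : cycles CC -> cycles DD -> edge_disjoint CC DD ->
  exists z1 z2 z3, [/\ uniq z1, uniq z2, uniq z3 &
    forall e, pe z1 e (+) pe z2 e (+) pe z3 e = ces CC e (+) ces DD e].
Proof.
move=> cC cD ed; have [/nilP|ne] := boolP (nilp (CC ++ DD)).
  case: CC {cC ed} => //; case: DD {cD} => // _.
  by exists [::], [::], [::]; split=> // e; rewrite ces_nil.
have [|V1 [V2 [V3 [[z1 [z2 [z3 [a [b [c [[p1 p2 p3] _ ez]]]]]]] [u1 u2 u3] _]]]] :=
  odd_system_triple (odd_systemP cC cD ed _).
  by apply: contra ne => /eqP->.
by exists (a :: z1), (b :: z2), (c :: z3); split; rewrite ?(perm_uniq p1) ?(perm_uniq p2) ?(perm_uniq p3).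
Qed.

End ThreeCycles4.

(** * Families of disjoint cycles and paths *)

Section Factors.

Variable T : finType.
Implicit Types (s t p q r C D K : seq T) (P Q L CC DD : seq (seq T)) (e : {set T}).
Implicit Types (x y k h g v m a b c d : T).

Lemma cycles_nil CC : cycles CC -> [::] \notin CC.
Proof. by move=> /andP[_ /allP sC]; apply/negP=> /sC. Qed.

Lemma cycles_uniq CC : cycles CC -> uniq (flatten CC).
Proof. by case/andP. Qed.

Lemma cycles_endss CC : cycles CC -> uniq (endss CC).
Proof.
move=> /andP[uC sC]; have [] := sys_start uC; first by apply: sub_all sC => s /ltnW.
by move=> [_ _ _ []].
Qed.

(** Used, like its path version, for the family left over when the number of families is odd. *)
Lemma two_cyclesP CC : cycles CC ->
  exists (c1 c2 : seq T), [/\ uniq c1, uniq c2 & forall e, ce c1 e (+) ce c2 e = ces CC e].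
Proof.
move=> cC; exists (flatten CC), (endss CC).
split; [exact: cycles_uniq | exact: cycles_endss | move=> e].
by rewrite ce_join ?cycles_nil.
Qed.

Lemma two_pathsP CC : cycles CC ->
  exists z1 z2, [/\ uniq z1, uniq z2 & forall e, pe z1 e (+) pe z2 e = ces CC e].
Proof.
move=> cC; exists (flatten CC), (endss CC).
split; [exact: cycles_uniq | exact: cycles_endss | move=> e]; have := cycles_nil cC.
case: CC {cC} => [|[|x s] CC]; rewrite ?inE ?ces_nil //= => nC.
have := pth_join (last x s) [::] e nC; rewrite !cats0 ces_cons ceE pth_cat -/(endss CC) => <-.
by rewrite (xeC x) /=; xring.
Qed.

(** Both walks go from [x] to [y], one through all vertices of [L] and one through the ends only, so
    these portions sum to the cycles of [L]; after [y] they continue independently. *)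
Lemma pth_bridge x L y s t e : [::] \notin L ->
  pth x (flatten L ++ y :: s) e (+) pth x (endss L ++ y :: t) e =
  ces L e (+) pth y s e (+) pth y t e.
Proof.
move=> nL; rewrite -(pth_join x [:: y] e nL) -!(cat_rcons y) -!cats1 !pth_cat !last_cat /=; xring.
Qed.

Definition factor L Q := [&& uniq (flatten L ++ flatten Q), all (fun s => 2 < size s) L & [::] \notin Q].

Lemma factorP L Q : factor L Q ->
  [/\ cycles L, uniq (flatten Q), [::] \notin Q & ~~ has (mem (flatten L)) (flatten Q)].
Proof.
by move=> /and3P[]; rewrite cat_uniq => /and3P[uL dis uQ] sL nQ; split=> //; apply/andP.
Qed.

(** One sequence runs along [q] and then through all cycles; the other starts at the last vertex of
    [q] and visits only the ends of the cuts. *)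
Lemma factor_one L q : factor L [:: q] -> exists z1 z2, [/\ uniq z1, uniq z2
  & forall e, pe z1 e (+) pe z2 e = ces L e (+) pe q e].
Proof.
move=> /factorP[cL]; rewrite /= cats0; case: q => [|x s] // uq _ dis.
exists ((x :: s) ++ flatten L), (last x s :: endss L); split.
- by rewrite cat_uniq uq cycles_uniq // andbT has_sym.
- rewrite cons_uniq cycles_endss // andbT; apply/negP => /mem_endss lL.
  by case/hasP: dis; exists (last x s); rewrite ?mem_last.
- move=> e; rewrite cat_cons /= pth_cat -(cats0 (flatten L)) -(cats0 (endss L)).
  by rewrite -(pth_join (last x s) [::] e (cycles_nil cL)); xring.
Qed.

(** Both sequences pass from the end of [q] through the cycles to the first vertex of [r]. The first
    contains [q] and the second [r], so each path occurs once. *)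
Lemma factor_two L q r : factor L [:: q; r] -> exists z1 z2, [/\ uniq z1, uniq z2
  & forall e, pe z1 e (+) pe z2 e = ces L e (+) pe q e (+) pe r e].
Proof.
move=> /factorP[cL]; rewrite /= cats0; case: q => [|x s]; case: r => [|y r] // + _.
rewrite cat_uniq has_cat => /and3P[uq dqr ur] /norP[dq dr].
have out (u : seq T) z : z \in u -> ~~ has (mem (flatten L)) u -> z \notin flatten L.
  by move=> zu; apply: contra => zL; apply/hasP; exists z.
exists ((x :: s) ++ flatten L ++ [:: y]), (last x s :: endss L ++ (y :: r)); split.
- rewrite cat_uniq uq cat_uniq cycles_uniq // has_cat /= orbF andbT negb_or has_sym dq /=.
  by rewrite orbF (out (y :: r)) ?mem_head // andbT; apply: contra dqr => yx; apply/hasP; exists y; rewrite ?mem_head.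
- rewrite cons_uniq cat_uniq cycles_endss // ur andbT mem_cat negb_or -andbA; apply/and3P; split.
  + by apply/negP => /mem_endss; apply/negP/(out (x :: s)); rewrite ?mem_last.
  + by apply: contra dqr => lr; apply/hasP; exists (last x s); rewrite /= ?mem_last.
  + by apply: contra dr => /hasP[z zr /mem_endss zL]; apply/hasP; exists z.
- move=> e; rewrite cat_cons /= pth_cat.
  have := pth_bridge (last x s) y [::] r e (cycles_nil cL) => /= eb.
  by rewrite -addbA eb; xring.
Qed.

Lemma uniq_part (z r w : seq T) : perm_eq (z ++ r) w -> uniq w -> uniq z.
Proof. by move=> /perm_uniq <-; rewrite cat_uniq => /andP[]. Qed.

(** The construction for one path has room for one further edge [c d]. If both [c] and [d] are on
    [q], the path is divided at [c] and its pieces are traversed from the extremities [a] and [b];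
    otherwise an end of the edge lies off [q] and the edge is attached there. *)
Lemma factor_one_edge L q c d : factor L [:: q] -> c != d -> c \notin ends q -> d \notin ends q ->
  exists z1 z2, [/\ uniq z1, uniq z2
  & forall e, pe z1 e (+) pe z2 e = ces L e (+) pe q e (+) xe c d e].
Proof.
move=> /factorP[cL]; rewrite /= cats0 => uq; rewrite inE eq_sym => nq dis.
wlog /orP cq : c d / (c \notin q) || [&& c \in q, d \in q & index c q < index d q].
  move=> th cd cE dE.
  case: (boolP (c \in q)) => cq; last by apply: th; rewrite ?cq.
  case: (boolP (d \in q)) => dq; last first.
    have [||||z1 [z2 [u1 u2 ez]]] := th d c => //; rewrite ?dq // 1?eq_sym //.
    by exists z1, z2; split=> // e; rewrite ez xeC.
  case: (ltngtP (index c q) (index d q)) => lcd.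
  - by apply: th; rewrite ?cq ?dq ?lcd ?orbT.
  - have [||||z1 [z2 [u1 u2 ez]]] := th d c; rewrite ?cq ?dq ?lcd ?orbT 1?eq_sym //.
    by exists z1, z2; split=> // e; rewrite ez xeC.
  - by rewrite -(nth_index c cq) lcd nth_index ?eqxx in cd.
move=> cd cE dE; case: cq => [cq|/and3P[cq dq lcd]]; last first.
  have [A [B [D eq]]] : exists A B D, q = A ++ c :: B ++ d :: D.
    case/splitPr: cq lcd dq uq {nq dis cE dE} => A R lcd dq uq.
    have dR : d \in R.
      move: dq; rewrite mem_cat inE eq_sym (negPf cd) /= => /orP[dA|//].
      move: lcd; rewrite !index_cat dA; case: ifP => [cA|_].
        by move: uq; rewrite cat_uniq => /and3P[_ /hasPn/(_ c (mem_head _ _))/negP []].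
      by rewrite /= eqxx addn0 ltnNge (ltnW _) // index_mem.
    by case/splitPr: dR => B D; exists A, B, D.
  subst q; case: A uq nq dis cE dE {cq dq lcd} => [|a A] uq nq dis cE dE; first by rewrite mem_head in cE.
  case/lastP: D uq nq dis cE dE => [|D b] uq nq dis cE dE.
    by rewrite /= last_cat /= last_cat !inE eqxx orbT in dE.
  set q := (a :: A) ++ _ in uq dis.
  have [U1 U2] : uniq (q ++ flatten L) /\ uniq (q ++ endss L).
    split; first by rewrite cat_uniq uq cycles_uniq // andbT has_sym.
    rewrite cat_uniq uq cycles_endss // andbT.
    by apply: contra dis => /hasP[z /mem_endss zL zq]; apply/hasP; exists z.
  (* With [q] running [a], [c], [d], [b]: the first sequence takes [d c], the piece from [c] back to
     [a], then the cycles and [b]; the second goes from [a] by the ends of the cycles to [b] and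
     back to [c]. *)
  exists (d :: c :: rev (a :: A) ++ flatten L ++ [:: b]), (a :: endss L ++ rev (c :: B ++ d :: rcons D b)); split.
  - apply: (uniq_part (r := B ++ D)) U1; rewrite /q; clear; apply/permP => f.
    by rewrite -cats1; do 6! rewrite ?(count_cat, count_rev) /=; lia.
  - apply: (uniq_part (r := A)) U2; rewrite /q; clear; apply/permP => f.
    by rewrite -cats1; do 6! rewrite ?(count_cat, count_rev) /=; lia.
  - move=> e; have := pth_join a [:: b] e (cycles_nil cL).
    have -> : pe q e = pe (c :: rev (a :: A)) e (+) pe (rev (c :: B ++ d :: rcons D b)) e.
      by rewrite pe_rev /q pe_cat -[pe (rcons _ _) e]pe_rev rev_rcons.
    have -> : pe [:: d, c & rev (a :: A) ++ flatten L ++ [:: b]] e =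
       xe d c e (+) pe (c :: rev (a :: A)) e (+) pth a (flatten L ++ [:: b]) e.
      by rewrite /= pth_cat rev_cons last_rcons; xring.
    have -> : pe (a :: endss L ++ rev (c :: B ++ d :: rcons D b)) e =
       pth a (endss L ++ [:: b]) e (+) pe (rev (c :: B ++ d :: rcons D b)) e.
      rewrite -rcons_cons -rcons_cat -rcons_cons rev_rcons.
      by rewrite -cat_rcons -cats1 -[pe (a :: _) e]/(pth _ _ _) pth_cat last_cat /=.
    by move=> <-; rewrite (xeC c); xring.
(* the end c of the extra edge is not on q; it is joined to d and the cycle of c, if
   any, is opened there *)
have nc : d != c by rewrite eq_sym.
have [s [L' [pL eL cL' ls es]]] : exists s L', [/\ perm_eq (c :: s ++ flatten L') (undup (c :: flatten L)),
    forall e, ces L e = ce (c :: s) e (+) ces L' e, cycles L', last c s != d & d \notin endss L'].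
  have ucL : c \in flatten L -> perm_eq (flatten L) (undup (c :: flatten L)).
    by move=> cL0; rewrite /= cL0 undup_id ?cycles_uniq.
  case: (boolP (c \in flatten L)) => cL0; last first.
    have [L' [cL' [pL' eL'] dL' _ _]] := cut_all cL cd.
    exists [::], L'; split=> // [|e]; last by rewrite eL' /= xexx.
    by rewrite /= (negPf cL0) undup_id ?cycles_uniq // perm_cons.
  have [C [s [L1 [pL1 ps es [us ss cL1 dis1]]]]] := pick_cycle cL cL0.
  have [L' [cL' [pL' eL'] dL' _ _]] := cut_all cL1 cd.
  have [s' [ps' es' ls' _]] := two_cuts us ss.
  have pp : perm_eq (c :: s ++ flatten L') (undup (c :: flatten L)).
    apply: perm_trans (ucL cL0); rewrite perm_sym; apply: perm_trans (perm_flatten pL1) _.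
    by rewrite flatten_cons -cat_cons perm_sym perm_cat.
  have ee e : ces L e = ce (c :: s) e (+) ces L' e by rewrite (ces_perm _ pL1) ces_cons es eL'.
  have [ld|ld] := eqVneq (last c s) d; last by exists s, L'.
  exists s', L'; split=> // [|e|]; last by rewrite -ld.
    by apply: perm_trans pp; rewrite perm_cons perm_cat2r.
  by rewrite es' ee.
case: q nq uq dis cE dE cq => [|a q] // _ uq dis cE dE cq.
have uL : uniq (c :: s ++ flatten L') by rewrite (perm_uniq pL) undup_uniq.
have mL z : z \in c :: s ++ flatten L' -> z \notin a :: q.
  rewrite (perm_mem pL) mem_undup inE => /orP[/eqP->//|zL].
  by apply: contra dis => zq; apply/hasP; exists z.
have uE : uniq (c :: s ++ endss L').
  move: uL; rewrite -!cat_cons !cat_uniq => /and3P[-> dd _]; rewrite cycles_endss // andbT.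
  by apply: contra dd => /hasP[z /mem_endss zL zq]; apply/hasP; exists z.
have da : d != a by apply: contraNneq dE => ->; rewrite mem_head.
(* If [c] lies on no cycle, [s] is empty and [last c s] is [c] itself, which must not be
   repeated. *)
pose c2 := if s is [::] then [::] else [:: last c s].
exists ((c :: s) ++ flatten L' ++ (a :: q)), ([:: d, c & c2] ++ endss L' ++ [:: a]); split.
- rewrite catA cat_uniq uL uq andbT; apply/hasPn => z zq; apply/negP => /mL.
  by rewrite zq.
- have u2 : uniq (c :: c2 ++ endss L') /\ {subset c :: c2 ++ endss L' <= c :: s ++ flatten L'}.
    rewrite /c2; case: (s) uE => [|x t] uE.
      by split=> // z; rewrite /= !inE => /orP[->//|/mem_endss ->]; rewrite orbT.
    split.
      apply: (uniq_part (r := belast x t)) uE; rewrite [x :: t]lastI; clear; apply/permP => f.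
      by rewrite ?last_rcons -cats1; do 4! rewrite ?count_cat /=; lia.
    move=> z; rewrite in_cons => /orP[/eqP->|]; first by rewrite mem_head.
    rewrite in_cons => /orP[/eqP->|/mem_endss zL].
      by rewrite -cat_cons mem_cat; apply/orP; left; rewrite -[X in X \in _]/(last c (x :: t)) mem_last.
    by rewrite -cat_cons mem_cat zL orbT.
  have [v2 sub2] := u2.
  have -> : [:: d, c & c2] ++ endss L' ++ [:: a] = rcons (d :: (c :: c2 ++ endss L')) a.
    by rewrite -cats1 /= catA.
  rewrite rcons_uniq cons_uniq v2 andbT inE negb_or eq_sym da /=; apply/andP; split.
    by apply/negP=> /sub2/mL; rewrite mem_head.
  rewrite inE mem_cat !negb_or nc es andbT /=.
  by rewrite /c2; case: (s) ls => [|x t] //= ls; rewrite inE eq_sym.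
- move=> e; rewrite eL ceE.
  have br := pth_bridge (last c s) a q [::] e (cycles_nil cL').
  have -> : pe ((c :: s) ++ flatten L' ++ a :: q) e = pth c s e (+) pth (last c s) (flatten L' ++ a :: q) e.
    by rewrite cat_cons /= pth_cat.
  have -> : pe ([:: d, c & c2] ++ endss L' ++ [:: a]) e =
    xe d c e (+) xe c (last c s) e (+) pth (last c s) (endss L' ++ [:: a]) e.
    by rewrite /c2; case: (s) => [|x t] /=; rewrite ?xexx ?addbF ?addbA.
  have -> : pe (c :: s) e = pth c s e by [].
  have -> : pe (a :: q) e = pth a q e by [].
  move: br => /= br; rewrite (xeC (last c s)) (xeC d c).
  move: br; set u := pth _ (flatten L' ++ _) e; set v := pth _ (endss L' ++ _) e => br.
  have -> : pth c s e (+) u (+) (xe c d e (+) xe c (last c s) e (+) v) =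
      pth c s e (+) (xe c d e (+) xe c (last c s) e) (+) (u (+) v) by xring.
  by rewrite br; xring.
Qed.

End Factors.

(** * Factors of even graphs *)

Section Hall.

Variable T : finType.
Implicit Types (R : {set T * T}) (X : {set T}) (x y : T).

Definition nbhd R X := [set y | [exists x, (x \in X) && ((x, y) \in R)]].

Lemma nbhdP R X y : reflect (exists2 x, x \in X & (x, y) \in R) (y \in nbhd R X).
Proof.
rewrite inE; apply: (iffP existsP) => [[x /andP[xX xy]]|[x xX xy]]; first by exists x.
by exists x; rewrite xX.
Qed.

(* Rado's argument: a relation minimal for Hall's condition is a function. *)
Lemma hall R : (forall X, #|X| <= #|nbhd R X|) ->
  exists f : T -> T, injective f /\ forall x, (x, f x) \in R.
Proof.
have [n] := ubnP #|R|; elim: n R => // n IH R ltn hR.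
have noX x y X : x \notin X -> nbhd (R :\ (x, y)) X = nbhd R X.
  move=> xX; apply/setP => z; apply/nbhdP/nbhdP => -[w wX].
    by rewrite !inE => /andP[_ wz]; exists w.
  by move=> wz; exists w => //; rewrite !inE wz andbT; apply: contraNneq xX => -[<-].
case: (boolP [exists x, [exists y1, [exists y2, [&& y1 != y2, (x, y1) \in R & (x, y2) \in R]]]]).
  move=> /existsP[x /existsP[y1 /existsP[y2 /and3P[y12 xy1 xy2]]]].
  have small y : (x, y) \in R -> (forall X, #|X| <= #|nbhd (R :\ (x, y)) X|) ->
      exists f : T -> T, injective f /\ forall x, (x, f x) \in R.
    move=> xy hy; have [||f [fi fR]] := IH (R :\ (x, y)) => //.
      by move: ltn; rewrite (cardsD1 (x, y)) xy.
    by exists f; split=> // z; have := fR z; rewrite !inE => /andP[].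
  have viol y : (x, y) \in R -> ~~ [forall X : {set T}, #|X| <= #|nbhd (R :\ (x, y)) X|] ->
      exists2 X : {set T}, x \in X & #|nbhd (R :\ (x, y)) X| < #|X|.
    move=> xy /forallPn[X]; rewrite -ltnNge => lt.
    exists X => //; apply: contraLR lt => xX; rewrite noX // -leqNgt; exact: hR.
  case: (boolP [forall X : {set T}, #|X| <= #|nbhd (R :\ (x, y1)) X|]) => [/forallP h1|h1].
    exact: small xy1 h1.
  case: (boolP [forall X : {set T}, #|X| <= #|nbhd (R :\ (x, y2)) X|]) => [/forallP h2|h2].
    exact: small xy2 h2.
  have [X1 xX1 lt1] := viol _ xy1 h1; have [X2 xX2 lt2] := viol _ xy2 h2.
  set N1 := nbhd _ X1 in lt1; set N2 := nbhd _ X2 in lt2.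
  have sU : nbhd R (X1 :|: X2) \subset N1 :|: N2.
    apply/subsetP => z /nbhdP[w]; rewrite !in_setU => wX wz; apply/orP.
    have [e|ne] := eqVneq w x.
      subst w; have [->|zy1] := eqVneq z y1.
        by right; apply/nbhdP; exists x => //; rewrite !inE xy1 andbT xpair_eqE negb_and y12 orbT.
      by left; apply/nbhdP; exists x => //; rewrite !inE wz andbT xpair_eqE negb_and zy1 orbT.
    by case/orP: wX => wX; [left|right]; apply/nbhdP; exists w => //; rewrite !inE wz andbT xpair_eqE negb_and ne.
  have sI : nbhd R ((X1 :&: X2) :\ x) \subset N1 :&: N2.
    apply/subsetP => z /nbhdP[w]; rewrite in_setD1 in_setI => /and3P[ne w1 w2] wz.
    by rewrite in_setI; apply/andP; split; apply/nbhdP; exists w => //; rewrite !inE wz andbT xpair_eqE negb_and ne.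
  have := leq_trans (hR _) (subset_leq_card sU); have := leq_trans (hR _) (subset_leq_card sI).
  have := cardsUI N1 N2; have := cardsUI X1 X2; have := cardsD1 x (X1 :&: X2).
  rewrite in_setI xX1 xX2 /=; move: lt1 lt2; clear; lia.
move=> nex; have uniqR x y1 y2 : (x, y1) \in R -> (x, y2) \in R -> y1 = y2.
  move=> r1 r2; apply/eqP; apply: contraNT nex => y12.
  by apply/existsP; exists x; apply/existsP; exists y1; apply/existsP; exists y2; rewrite y12 r1.
have ex x : exists y, (x, y) \in R.
  have := hR [set x]; rewrite cards1 card_gt0 => /set0Pn[y /nbhdP[w]].
  by rewrite inE => /eqP-> wy; exists y.
have exb x : exists y, (fun y => (x, y) \in R) y := ex x.
pose f x := xchoose (exb x); have fR x : (x, f x) \in R := xchooseP (exb x).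
exists f; split=> // x y fxy; apply/eqP; apply: contraT => xy.
suff /subset_leq_card : nbhd R [set x; y] \subset [set f x].
  by rewrite cards1 => le; have := leq_trans (hR [set x; y]) le; rewrite cards2 xy.
apply/subsetP => z /nbhdP[w]; rewrite !inE => /orP[]/eqP-> wz.
  by apply/eqP/uniqR/fR.
by rewrite fxy; apply/eqP/uniqR/fR.
Qed.

End Hall.

(** * Decomposing a balanced orientation into permutations *)

Section Petersen.

Variable T : finType.
Implicit Types (A G : rel T) (x y : T) (e : {set T}).

Definition outd A x := #|[set y | A x y]|.
Definition ind A x := #|[set y | A y x]|.

Definition arcs A e := \big[addb/false]_x \big[addb/false]_(y | A x y) xe x y e.
Definition turns (f : T -> T) e := \big[addb/false]_x xe x (f x) e.

Lemma outdE A x : outd A x = \sum_y A x y.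
Proof. by rewrite /outd -sum1dep_card big_mkcond. Qed.

Lemma indE A x : ind A x = \sum_y A y x.
Proof. by rewrite /ind -sum1dep_card big_mkcond. Qed.

(** Give every vertex [k - outd A x] loops, so that all outdegrees and indegrees equal [k], and
    apply Hall's theorem. Fixed points come from loops, hence have outdegree below [k]. *)
Lemma balanced_factor A k : irreflexive A -> (forall x, outd A x = ind A x) ->
  (forall x, outd A x <= k) -> 0 < k ->
  exists f : T -> T, [/\ injective f, forall x, f x != x -> A x (f x)
    & forall x, f x = x -> outd A x < k].
Proof.
move=> irr bal le k0.
pose R := [set p : T * T | A p.1 p.2 || ((p.1 == p.2) && (outd A p.1 < k))].
have [X|f [fi fR]] := @hall _ R.
  (* All [k * #|X|] arcs and loops that leave [X] end in [N], which receives [k * #|N|] of them. *)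
  rewrite -(leq_pmul2r k0) -!sum_nat_const; set N := nbhd R X.
  have e1 (Y : {set T}) : \sum_(x in Y) k = \sum_(x in Y) outd A x + \sum_(x in Y) (k - outd A x).
    by rewrite -big_split; apply: eq_bigr => x _; rewrite /= subnKC.
  rewrite !e1 leq_add //.
    have -> : \sum_(x in N) outd A x = \sum_(y in N) \sum_x A x y.
      by apply: eq_bigr => y _; rewrite bal indE.
    rewrite exchange_big /= [leqRHS](bigID (mem X)) /=.
    apply: leq_trans (leq_addr _ _); apply: leq_sum => x xX.
    rewrite outdE (bigID (mem N)) /= [X in _ + X]big1 ?addn0 // => y yN.
    apply/eqP; rewrite eqb0; apply: contra yN => xy.
    by apply/nbhdP; exists x; rewrite // inE /= xy.
  rewrite [leqLHS](bigID (mem N)) /= [X in _ + X]big1 ?addn0; last first.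
    move=> x /andP[xX xN]; apply/eqP; rewrite subn_eq0 leqNgt; apply: contra xN => lt.
    by apply/nbhdP; exists x; rewrite // inE /= eqxx lt orbT.
  rewrite (bigID (mem X) (mem N)) /=; apply: leq_trans (leq_addr _ _).
  by apply: eq_leq; apply: eq_bigl => x; rewrite andbC.
exists f; split=> // x.
- by have := fR x; rewrite inE /= eq_sym => /orP[//|/andP[/eqP-> _]]; rewrite eqxx.
- by move=> fx; have := fR x; rewrite inE /= fx irr eqxx.
Qed.

Lemma balanced_factors A k : (forall x y, A x y -> ~~ A y x) ->
  (forall x, outd A x = ind A x) -> (forall x, outd A x <= k) ->
  exists F : nat -> T -> T,
   [/\ forall i, i < k -> injective (F i),
       forall i x, i < k -> F i x != x -> A x (F i x),
       forall i j x y, i < k -> j < k -> i != j -> F i x != x -> [set x; F i x] != [set y; F j y],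
       forall x, \sum_(i < k) (F i x != x) = outd A x
     & forall e, arcs A e = \big[addb/false]_(i < k) turns (F i) e].
Proof.
elim: k A => [|k IH] A asym bal le.
  have A0 x y : A x y = false.
    apply/negP => xy; have := le x; rewrite leqn0 cards_eq0 => /eqP/setP/(_ y).
    by rewrite !inE xy.
  exists (fun _ => id); split=> //.
    by move=> x; rewrite big_ord0; apply/esym/eqP; rewrite -leqn0 le.
  move=> e; rewrite big_ord0 /arcs big1 // => x _; apply: big1 => y.
  by rewrite A0.
have irr : irreflexive A.
  by move=> x; apply/negP => xx; move: (asym _ _ xx); rewrite xx.
have [f [fi fA fk]] := balanced_factor irr bal le (ltn0Sn k).
pose A' x y := A x y && (f x != y).
have out' x : outd A x = (f x != x) + outd A' x.
  rewrite /outd (cardsD1 (f x)) inE; congr (_ + _).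
    have [fx|/fA ->//] := eqVneq (f x) x; by rewrite fx irr.
  by apply: eq_card => y; rewrite !inE /A' andbC eq_sym.
have in' x : ind A x = (f x != x) + ind A' x.
  have [g fg gf] := injF_bij fi.
  have gx : (g x != x) = (f x != x).
    by rewrite -(inj_eq fi) gf eq_sym.
  rewrite /ind (cardsD1 (g x)) inE -gx; congr (_ + _).
    have [gx0|] := eqVneq (g x) x; first by rewrite gx0 irr.
    by rewrite gx => fx; rewrite -{2}(gf x) fA // gf eq_sym gx.
  apply: eq_card => y; rewrite !inE /A' andbC; congr (_ && _).
  by rewrite -(inj_eq fi y) gf.
have [|x|x|F [Fi FA Fd Fs Fe]] := IH A'.
- by move=> x y /andP[/asym xy _]; rewrite /A' negb_and xy.
- by have := bal x; rewrite out' in' => /addnI.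
- have := le x; rewrite out'; have [fx|_] := eqVneq (f x) x; last by rewrite add1n.
  by have := fk x fx; rewrite out' fx eqxx /= add0n ltnS.
exists (fun i => if i < k then F i else f); split.
- by move=> i ik; case: ifP => // /Fi.
- by move=> i x ik; case: ifP => [/FA Fx /Fx /andP[]|_ /fA].
- have fF i x y : i < k -> F i x != x -> [set x; F i x] != [set y; f y].
    move=> ik Fx; have /andP[Axy nf] := FA i x ik Fx.
    apply: contra nf => /eqP es.
    have : x \in [set y; f y] by rewrite -es !inE eqxx.
    rewrite !inE => /orP[/eqP exy|/eqP exf].
      have : F i x \in [set y; f y] by rewrite -es !inE eqxx orbT.
      by rewrite !inE -exy (negPf Fx) /= eq_sym.
    have [fy|fy] := eqVneq (f y) y.
      have : F i x \in [set y; f y] by rewrite -es !inE eqxx orbT.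
      have exy : x = y by rewrite exf fy.
      by rewrite fy setUid inE -exy (negPf Fx).
    have : F i x \in [set y; f y] by rewrite -es !inE eqxx orbT.
    rewrite !inE -exf (negPf Fx) orbF => /eqP Fy.
    by have := asym _ _ (fA y fy); rewrite -exf -Fy Axy.
  move=> i j x y; rewrite !ltnS => ik jk ij; case: ifP => ik'; case: ifP => jk'.
  + exact: Fd.
  + exact: fF.
  + move=> fx; rewrite eq_sym; have [Fy|Fy] := eqVneq (F j y) y; last exact: fF.
    rewrite Fy setUid; apply: contra fx => /eqP/setP es.
    have := es x; have := es (f x); rewrite !inE !eqxx orbT.
    by move=> /eqP-> /eqP->.
  + by exfalso; move: ij ik jk ik' jk'; clear; lia.
- move=> x; rewrite big_ord_recr /= ltnn out' addnC -Fs; congr (_ + _).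
  by apply: eq_bigr => i _; rewrite ltn_ord.
- move=> e; rewrite big_ord_recr /= ltnn.
  under eq_bigr => i _ do rewrite ltn_ord.
  rewrite -Fe /arcs /turns -big_split; apply: eq_bigr => x _ /=.
  have [fx|fx] := eqVneq (f x) x.
    rewrite fx xexx addbF; apply: eq_bigl => y; rewrite /A' fx.
    by have [<-|] := eqVneq x y; rewrite ?irr ?andbT.
  rewrite (bigD1 (f x)) ?fA //= addbC; congr (_ (+) _).
  by apply: eq_bigl => y; rewrite /A' eq_sym.
Qed.

End Petersen.

(** * Balanced orientations and the cycles of a permutation *)

Section Orientation.

Variable T : finType.
Implicit Types (A G : rel T) (x y : T) (e : {set T}) (s c : seq T).

Lemma next_next c x : uniq c -> 2 < size c -> x \in c -> next c (next c x) != x.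
Proof.
move=> uc sc /rot_to[i s es]; rewrite -!(next_rot i uc) es.
have : uniq (x :: s) by rewrite -es rot_uniq.
have : 2 < size (x :: s) by rewrite -es size_rot.
case: s {es} => [|y [|z s]] // _ /=; rewrite !inE !negb_or eqxx -!andbA.
by case/and5P=> xy xz _ yz _; rewrite [y == x]eq_sym (negPf xy) eqxx eq_sym.
Qed.

Lemma maximal_path G x0 y0 : irreflexive G -> G x0 y0 ->
  exists x s, [/\ uniq (x :: s), path G x s, 0 < size s & forall y, G y x -> y \in x :: s].
Proof.
move=> irr G0; have ne : x0 != y0 by apply: contraTneq G0 => ->; rewrite irr.
suff : forall n x s, #|T| - size s < n -> uniq (x :: s) -> path G x s -> 0 < size s ->
   exists x s, [/\ uniq (x :: s), path G x s, 0 < size s & forall y, G y x -> y \in x :: s].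
  by move=> /(_ _ x0 [:: y0] (ltnSn _)); apply; rewrite /= ?inE ?andbT ?G0 ?ne.
elim=> // n IH x s lt u p s0.
case: (boolP [forall y, G y x ==> (y \in x :: s)]) => [/forallP h|].
  by exists x, s; split=> // y; apply/implyP.
move=> /forallPn[y]; rewrite negb_imply => /andP[yx ys].
apply: (IH y (x :: s)); rewrite /= ?yx -/(uniq (x :: s)) ?u ?ys //.
have : size (x :: s) <= #|T| by rewrite -(card_uniqP u) max_card.
by move: lt => /=; clear; lia.
Qed.

(** All neighbours of the first vertex of a maximal path lie on the path. Even degree gives one
    besides its successor, which closes a cycle of length at least three. *)
Lemma even_cycle G x0 y0 : symmetric G -> irreflexive G -> (forall x, ~~ odd (deg G x)) ->
  G x0 y0 -> exists c, [/\ uniq c, 2 < size c & cycle G c].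
Proof.
move=> sym irr ev /(maximal_path irr)[x [[|z s] [u p // _ mx]]].
have [y yx yz] : exists2 y, G x y & y != z.
  have xz : G x z by case/andP: p.
  have := ev x; rewrite /deg (cardsD1 z) inE xz /= negbK => od.
  have : 0 < #|[set y | G x y] :\ z| by case: #|_| od.
  by rewrite card_gt0 => /set0Pn[y]; rewrite !inE => /andP[yz xy]; exists y.
have yP : y \in x :: z :: s by apply: mx; rewrite sym.
have yx' : y != x by apply: contraTneq yx => ->; rewrite irr.
move: yP; rewrite !inE (negPf yx') (negPf yz) /= => ys.
case/splitPr: ys u p mx => s1 s2 u p mx.
exists (x :: rcons (z :: s1) y); split.
- move: u; rewrite -[x :: _]/((x :: z :: s1) ++ y :: s2) -cat_rcons cat_uniq => /andP[+ _].
  by rewrite rcons_cons.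
- by rewrite /= size_rcons.
- rewrite /= rcons_path last_rcons (sym y) yx andbT; move: p.
  by rewrite -[_ :: _ ++ _]/((z :: s1) ++ y :: s2) -cat_rcons cat_path => /andP[].
Qed.

(** Orient one cycle along its direction, remove it and proceed by induction; all degrees remain
    even. *)
Lemma orientation G : symmetric G -> irreflexive G -> (forall x, ~~ odd (deg G x)) ->
  exists A, [/\ forall x y, A x y -> ~~ A y x, forall x y, G x y = A x y || A y x
    & forall x, outd A x = ind A x].
Proof.
have [n] := ubnP #|[set p : T * T | G p.1 p.2]|; elim: n G => // n IH G ltn sym irr ev.
case: (boolP [exists x, [exists y, G x y]]) => [/existsP[x0 /existsP[y0 xy0]]|nG]; last first.
  exists (fun _ _ => false); split=> // x y.
  by apply: contraNF nG => xy; apply/existsP; exists x; apply/existsP; exists y.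
have [c [uc sc cG]] := even_cycle sym irr ev xy0.
pose N x y := (x \in c) && (y == next c x).
have NG x y : N x y -> G x y by move=> /andP[xc /eqP->]; exact: next_cycle.
have Nas x y : N x y -> ~~ N y x.
  move=> /andP[xc /eqP->]; rewrite /N negb_and eq_sym next_next ?orbT //.
pose G' x y := [&& G x y, ~~ N x y & ~~ N y x].
have cardN x : #|[set y | N x y || N y x]| = (x \in c).*2.
  case: (boolP (x \in c)) => xc; last first.
    apply/eqP; rewrite cards_eq0; apply/eqP/setP => y; rewrite !inE /N (negPf xc) /=.
    by apply/negP => /andP[yc /eqP xn]; case/negP: xc; rewrite xn mem_next.
  rewrite (_ : [set y | _] = [set next c x; prev c x]).
    rewrite cards2; suff -> : next c x != prev c x by [].
    apply: contraTneq (next_next uc sc xc) => ->; by rewrite next_prev // eqxx.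
  apply/setP => y; rewrite !inE /N xc /=; congr orb.
  apply/andP/eqP => [[yc /eqP->]|->]; first by rewrite prev_next.
  by rewrite mem_prev next_prev.
have degG x : deg G x = deg G' x + (x \in c).*2.
  rewrite -cardN /deg -[in LHS](cardsID [set y | N x y || N y x]) addnC; congr (_ + _).
    by apply: eq_card => y; rewrite !inE /G' negb_or andbC.
  apply: eq_card => y; rewrite !inE; case: (boolP (N x y)) => [/NG->//|_].
  by case: (boolP (N y x)) => [/NG|]; rewrite ?andbF // sym => ->.
have [||||A [As AG Ab]] := IH G'.
- rewrite -ltnS; apply: leq_trans ltn; rewrite ltnS; apply: proper_card; apply/properP; split.
    by apply/subsetP => p; rewrite !inE => /andP[].
  have [x xc] : exists x, x \in c by case: (c) sc => // x s _; exists x; rewrite mem_head.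
  exists (x, next c x); rewrite !inE /= ?(next_cycle cG) //.
  by rewrite /G' /N xc eqxx andbF.
- by move=> x y; rewrite /G' sym [~~ N x y && _]andbC.
- by move=> x; rewrite /G' irr.
- by move=> x; have := ev x; rewrite degG oddD odd_double addbF.
have AG' x y : A x y -> G' x y by rewrite AG => ->.
exists (fun x y => A x y || N x y); split.
- move=> x y /orP[xy|xy]; rewrite negb_or.
    by rewrite As //=; have /and3P[] := AG' _ _ xy.
  rewrite Nas // andbT; apply/negP => /AG'/and3P[_ _]; by rewrite xy.
- move=> x y; apply/idP/idP => [Gxy|].
    case: (boolP (N x y)) => nxy; first by rewrite orbT.
    case: (boolP (N y x)) => nyx; first by rewrite !orbT.
    by have : G' x y by [rewrite /G' Gxy nxy]; rewrite AG !orbF.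
  move=> /orP[/orP[/AG'/andP[]//|/NG//]|/orP[/AG'/andP[+ _]|/NG]]; by rewrite sym.
have out x : outd (fun x y => A x y || N x y) x = outd A x + (x \in c).
  rewrite !outdE -(_ : \sum_y N x y = (x \in c)).
    rewrite -big_split; apply: eq_bigr => y _ /=; case: (boolP (N x y)) => nxy; last by rewrite orbF addn0.
    by rewrite orbT; case: (boolP (A x y)) => // /AG'/and3P[_]; rewrite nxy.
  rewrite (bigD1 (next c x)) //= /N eqxx andbT big1 ?addn0 // => y /negPf->.
  by rewrite andbF.
have inn x : ind (fun x y => A x y || N x y) x = ind A x + (x \in c).
  rewrite !indE -(_ : \sum_y N y x = (x \in c)).
    rewrite -big_split; apply: eq_bigr => y _ /=; case: (boolP (N y x)) => nxy; last by rewrite orbF addn0.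
    by rewrite orbT; case: (boolP (A y x)) => // /AG'/and3P[_]; rewrite nxy.
  rewrite (bigD1 (prev c x)) //= /N mem_prev next_prev // eqxx andbT big1 ?addn0 // => y yp.
  apply/eqP; rewrite eqb0; apply: contra yp => /andP[yc /eqP->]; by rewrite prev_next.
by move=> x; rewrite out inn Ab.
Qed.

Lemma arcs_edges G A e : irreflexive G -> (forall x y, A x y -> ~~ A y x) ->
  (forall x y, G x y = A x y || A y x) -> arcs A e = (e \in edges G).
Proof.
move=> irr As AG.
have neq x y : A x y -> x != y.
  by move=> xy; apply: contraTneq xy => ->; have := irr y; rewrite AG orbb => ->.
rewrite /arcs pair_big_dep /=; apply/idP/idP => [|/imsetP[[a b]]].
  apply: contraLR => eG; rewrite big1 // => -[x y] /= xy; apply/negbTE.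
  apply: contra eG => /andP[_ /eqP->]; apply/imsetP; exists (x, y) => //.
  by rewrite inE /= AG xy.
rewrite inE /= AG => ab ->.
wlog {ab} ab : a b / A a b.
  by move=> th; case/orP: ab => [/th //|/th]; rewrite setUC.
rewrite (bigD1 (a, b)) //= big1 ?addbF; first by rewrite /xe neq // eqxx.
move=> [x y] /= /andP[xy ne]; apply/negbTE; apply: contra ne => /andP[_ /eqP es].
have xs : x \in [set a; b] by rewrite es !inE eqxx.
have ys : y \in [set a; b] by rewrite es !inE eqxx orbT.
have nxy := neq _ _ xy; rewrite xpair_eqE; move: xs ys; rewrite !inE.
case/orP=> /eqP ex; case/orP=> /eqP ey; subst x y; rewrite ?eqxx // in nxy *.
by have := As _ _ ab; rewrite xy.
Qed.

Lemma pth_turns (f : T -> T) x s e : fpath f x s ->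
  pth x s e = \big[addb/false]_(y <- belast x s) xe y (f y) e.
Proof.
elim: s x => [|y s IH] x /=; first by rewrite big_nil.
by move=> /andP[/eqP <- p]; rewrite big_cons IH.
Qed.

Lemma ce_orbit (f : T -> T) x e : injective f ->
  ce (orbit f x) e = \big[addb/false]_(y in orbit f x) xe y (f y) e.
Proof.
move=> fi; rewrite -big_uniq ?orbit_uniq //.
have := cycle_orbit fi x; case: (orbit f x) => [|y s]; first by rewrite big_nil.
by rewrite ceEr /= => /pth_turns->; rewrite belast_rcons.
Qed.

(** The nontrivial orbits are the cycles. Orbits of size two are excluded, as they would use one
    edge twice. *)
Lemma turns_cycles (f : T -> T) : injective f -> (forall x, f x != x -> f (f x) != x) ->
  exists L, [/\ cycles L, forall e, ces L e = turns f e,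
    forall x, (x \in flatten L) = (f x != x)
   & forall C e, C \in L -> ce C e -> exists2 x, f x != x & e = [set x; f x]].
Proof.
move=> fi f2.
suff : forall n (S : {set T}), #|S| < n -> (forall x, x \in S -> f x \in S) ->
  exists L, [/\ cycles L, forall e, ces L e = \big[addb/false]_(x in S) xe x (f x) e,
    forall x, (x \in flatten L) = (x \in S) && (f x != x)
   & forall C e, C \in L -> ce C e -> exists2 x, f x != x & e = [set x; f x]].
  move=> /(_ _ [set: T] (ltnSn _))[|L [cL eL mL dL]]; first by move=> x; rewrite !inE.
  exists L; split=> // [e|x]; last by rewrite mL inE.
  by rewrite eL; apply: eq_bigl => x; rewrite inE.
elim=> // n IH S ltn clo.
case: (boolP [exists x, (x \in S) && (f x != x)]) => [/existsP[x /andP[xS fx]]|nS]; last first.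
  exists [::]; split=> //.
  - move=> e; rewrite ces_nil big1 // => x xS.
    have -> : f x = x; last by rewrite xexx.
    by apply/eqP; apply: contraNT nS => fx; apply/existsP; exists x; rewrite xS.
  - move=> x; apply/esym/negbTE; apply: contra nS => fx; apply/existsP; exists x; exact: fx.
have OS y : y \in orbit f x -> y \in S.
  by rewrite -fconnect_orbit => /iter_findex <-; elim: (findex _ _ _) => //= m; exact: clo.
have fO y : (f y \in orbit f x) = (y \in orbit f x).
  by rewrite -!fconnect_orbit -same_fconnect1_r.
have mO y : y \in orbit f x -> f y != y.
  rewrite -fconnect_orbit => /iter_findex <-; elim: (findex _ _ _) => //= m.
  by apply: contra => /eqP/fi->.
pose S' := S :\: [set y in orbit f x].
have [||L [cL eL mL dL]] := IH S'.
- rewrite -ltnS; apply: leq_trans ltn; rewrite ltnS; apply: proper_card; apply/properP; split.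
    by apply/subsetP => y; rewrite !inE => /andP[].
  by exists x => //; rewrite !inE -fconnect_orbit connect0.
- by move=> y; rewrite !inE fO => /andP[-> /clo].
have sO : 2 < size (orbit f x).
  have u3 : uniq [:: x; f x; f (f x)].
    by rewrite /= !inE !negb_or eq_sym fx eq_sym f2 //= eq_sym mO // fO -fconnect_orbit connect0.
  apply: (uniq_leq_size u3) => y; rewrite !inE => /or3P[]/eqP->; by rewrite ?fO -fconnect_orbit connect0.
exists (orbit f x :: L); split.
- case/andP: cL => uL sL; apply/andP; split; last by rewrite /= sO.
  rewrite flatten_cons cat_uniq orbit_uniq uL andbT; apply/hasPn => y.
  by rewrite mL !inE -andbA => /andP[].
- move=> e; rewrite ces_cons ce_orbit // eL (bigID (mem (orbit f x)) (mem S)) /=.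
  congr addb; apply: eq_bigl => y; last by rewrite !inE andbC.
  by apply/idP/andP => [yO|[]//]; split=> //; apply: OS.
- move=> y; rewrite mem_flatten_cons mL !inE.
  case: (boolP (y \in orbit f x)) => //= yO; by rewrite (OS y yO) mO.
- move=> C e; rewrite in_cons => /orP[/eqP->|CL]; last exact: dL.
  rewrite ce_orbit // => ce1.
  have : [exists y in orbit f x, xe y (f y) e].
    apply: contraT => nex; move: ce1; rewrite big1 // => y yO.
    apply/negbTE; apply: contra nex => h; by apply/exists_inP; exists y.
  by case/exists_inP=> y _ /andP[yf /eqP->]; exists y; rewrite // eq_sym.
Qed.

End Orientation.

Lemma finite_choice (A : Type) (a : A) (P : nat -> A -> Prop) k :
  (forall i, i < k -> exists x, P i x) -> exists f, forall i, i < k -> P i (f i).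
Proof.
elim: k => [|k IH] h; first by exists (fun _ => a).
have [|f fP] := IH; first by move=> i ik; apply: h; exact: ltnW.
have [x xP] := h k (ltnSn k).
exists (fun i => if i == k then x else f i) => i; rewrite ltnS leq_eqVlt.
by case: eqVneq => [-> //|_ /= /fP].
Qed.

(** * Path and cycle decompositions of even graphs *)

Section EvenGraphs.

Variable T : finType.
Implicit Types (A G : rel T) (x y : T) (e : {set T}) (s c : seq T) (L : nat -> seq (seq T)).

Lemma deg_arcs G A x : (forall x y, A x y -> ~~ A y x) ->
  (forall x y, G x y = A x y || A y x) -> deg G x = outd A x + ind A x.
Proof.
move=> As AG; rewrite outdE indE -big_split /= /deg -sum1dep_card big_mkcond.
apply: eq_bigr => y _; rewrite AG.
by case: (boolP (A x y)) => [/As/negPf->//|_]; case: (A y x).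
Qed.

(** The last clause counts the families that cover a vertex. Applied to a new vertex, it later gives
    the number of paths created by its deletion. *)
Lemma even_factors G k : symmetric G -> irreflexive G -> (forall x, ~~ odd (deg G x)) ->
  (forall x, deg G x <= k.*2) ->
  exists L, [/\ forall i, i < k -> cycles (L i),
    forall i j, i < k -> j < k -> i != j -> edge_disjoint (L i) (L j),
    forall e, (e \in edges G) = \big[addb/false]_(i < k) ces (L i) e
   & forall x, deg G x = (\sum_(i < k) (x \in flatten (L i))).*2].
Proof.
move=> sym irr ev le; have [A [As AG Ab]] := orientation sym irr ev.
have dA x : deg G x = (outd A x).*2 by rewrite (deg_arcs x As AG) Ab addnn.
have [|F [Fi FA Fd Fo Fe]] := balanced_factors As Ab (k := k).
  by move=> x; rewrite -leq_double -dA.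
have [|L LP] := @finite_choice (seq (seq T)) [::] (fun i (L : seq (seq T)) => [/\ cycles L, forall e, ces L e = turns (F i) e,
    forall x, (x \in flatten L) = (F i x != x)
   & forall C e, C \in L -> ce C e -> exists2 x, F i x != x & e = [set x; F i x]]) k.
  move=> i ik; apply: turns_cycles (Fi i ik) _ => x fx.
  apply: contra (As _ _ (FA _ _ ik fx)) => /eqP fx'.
  by rewrite -{2}fx' FA // fx' eq_sym.
exists L; split.
- by move=> i /LP[].
- move=> i j ik jk ij C D e Ci Dj Ce De.
  have [_ _ _ /(_ C e Ci Ce)[x fx ex]] := LP i ik.
  have [_ _ _ /(_ D e Dj De)[y _ ey]] := LP j jk.
  by move: (Fd i j x y ik jk ij fx); rewrite -ex -ey eqxx.
- move=> e; rewrite -(arcs_edges e irr As AG) Fe; apply: eq_bigr => i _.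
  by have [_ ->] := LP i (ltn_ord i).
- move=> x; rewrite dA -Fo; congr _.*2; apply: eq_bigr => i _.
  by have [_ _ ->] := LP i (ltn_ord i).
Qed.

(** [phi] stands for [pe] or [ce], so that both Eulerian bounds come from one induction. Two
    families cost three sequences and a last single one costs two. *)
Lemma cover_closed (phi : seq T -> {set T} -> bool) k L :
  (forall CC, cycles CC -> exists z1 z2, [/\ uniq z1, uniq z2
     & forall e, phi z1 e (+) phi z2 e = ces CC e]) ->
  (forall CC DD, cycles CC -> cycles DD -> edge_disjoint CC DD ->
     exists z1 z2 z3, [/\ uniq z1, uniq z2, uniq z3
     & forall e, phi z1 e (+) phi z2 e (+) phi z3 e = ces CC e (+) ces DD e]) ->
  (forall i, i < k -> cycles (L i)) ->
  (forall i j, i < k -> j < k -> i != j -> edge_disjoint (L i) (L j)) ->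
  exists Z, [/\ all uniq Z, size Z <= uphalf (3 * k)
    & forall e, \big[addb/false]_(z <- Z) phi z e = \big[addb/false]_(i < k) ces (L i) e].
Proof.
move=> h2 h3; have [n] := ubnP k; elim: n k L => // n IH [|[|k]] L ltn cL dL.
- by exists [::]; split=> // e; rewrite big_nil big_ord0.
- have [//|z1 [z2 [u1 u2 ez]]] := h2 (L 0); first exact: cL.
  exists [:: z1; z2]; split=> [||e] //=; first by rewrite u1 u2.
  by rewrite !big_cons big_nil addbF ez big_ord1.
- have [||Z [uZ sZ eZ]] := IH k (fun i => L i.+2) (ltnW ltn).
  + by move=> i ik; apply: cL.
  + by move=> i j ik jk ij; apply: dL.
  have [|||z1 [z2 [z3 [u1 u2 u3 ez]]]] := h3 (L 0) (L 1); [exact: cL| exact: cL| exact: dL|].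
  exists [:: z1, z2, z3 & Z]; split=> [||e].
  + by rewrite /= u1 u2 u3.
  + by move: sZ => /=; clear; lia.
  + by rewrite !big_cons eZ 2!big_ord_recl /= !addbA ez.
Qed.

(** Lists permit repetitions and sequences too short to be paths or cycles; both are disposed of
    when a list is turned into a cover. *)
Definition decomposes (phi : seq T -> {set T} -> bool) (E : {set T} -> bool) n :=
  exists Z, [/\ all uniq Z, size Z <= n & forall e, \big[addb/false]_(z <- Z) phi z e = E e].

Lemma even_decomposes G k : symmetric G -> irreflexive G -> (forall x, ~~ odd (deg G x)) ->
  (forall x, deg G x <= k.*2) ->
  decomposes (@pe T) (fun e => e \in edges G) (uphalf (3 * k)) /\
  decomposes (@ce T) (fun e => e \in edges G) (uphalf (3 * k)).
Proof.
move=> sym irr ev le; have [L [cL dL eL _]] := even_factors sym irr ev le.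
split.
- have [Z [uZ sZ eZ]] := cover_closed (@two_pathsP T) (@three_pathsP T) cL dL.
  by exists Z; split=> // e; rewrite eZ -eL.
- have [Z [uZ sZ eZ]] := cover_closed (@two_cyclesP T) (@three_cyclesP T) cL dL.
  by exists Z; split=> // e; rewrite eZ -eL.
Qed.

End EvenGraphs.

(** * Vertices of odd degree *)

Section RemoveVertex.

Variable T : finType.
Implicit Types (s t q : seq T) (P Q L : seq (seq T)) (e : {set T}) (v x y a b : T).

Lemma xe_out v x e : v \notin e -> xe v x e = false.
Proof. by move=> ve; apply: contraNF ve => /andP[_ /eqP->]; rewrite !inE eqxx. Qed.

Lemma pe_notin x s e : x \in e -> x \notin s -> pe s e = false.
Proof. by case: s => // y s; apply: pth_notin. Qed.

Lemma ce_notin x s e : x \in e -> x \notin s -> ce s e = false.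
Proof.
move=> xe0; case: s => // y s xs; rewrite ceE (pe_notin xe0 xs) /xe; apply/negP => /andP[_ /eqP ee].
move: xe0 xs; rewrite ee !inE => /orP[/eqP->|/eqP->]; last by rewrite eqxx.
by rewrite -in_cons mem_last.
Qed.

Lemma pes_notin x P e : x \in e -> x \notin flatten P -> pes P e = false.
Proof.
move=> xe0; elim: P => [|s P IH]; rewrite ?pes_nil // mem_flatten_cons negb_or => /andP[xs xP].
by rewrite pes_cons (pe_notin xe0 xs) IH.
Qed.

Lemma ces_notin x P e : x \in e -> x \notin flatten P -> ces P e = false.
Proof.
move=> xe0; elim: P => [|s P IH]; rewrite ?ces_nil // mem_flatten_cons negb_or => /andP[xs xP].
by rewrite ces_cons (ce_notin xe0 xs) IH.
Qed.

Lemma ends_split a b s t : {subset ends (rcons s a) <= a :: ends (rcons s a ++ t)} /\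
  {subset ends (b :: t) <= b :: ends (s ++ b :: t)}.
Proof.
split=> x.
  rewrite ends_rcons !inE => /orP[/eqP->|->//]; case: s => [|y s] /=; rewrite ?eqxx //.
  by rewrite !inE eqxx !orbT.
rewrite !inE => /orP[->//|/eqP->]; case: s => [|y s] /=; first by rewrite !inE eqxx !orbT.
by rewrite last_cat !inE eqxx !orbT.
Qed.

(** Deleting [v] opens its cycle or splits its path in two, and as [v] is not an end this creates
    exactly one more path. The new ends are the neighbours of [v] in the factor. *)
Lemma factor_remove L Q v : factor L Q -> v \notin endss Q ->
  exists L' Q', [/\ factor L' Q',
    perm_eq (flatten L' ++ flatten Q') [seq x <- flatten L ++ flatten Q | x != v],
    size Q' = size Q + (v \in flatten L ++ flatten Q),
    forall e, v \notin e -> ces L' e (+) pes Q' e = ces L e (+) pes Q e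
  & forall x, x \in endss Q' -> x \in endss Q \/ ces L [set v; x] (+) pes Q [set v; x]].
Proof.
move=> fLQ vE; have := fLQ => /and3P[]; rewrite cat_uniq => /and3P[uL dis uQ] sL nQ.
have filt (w s : seq T) : uniq w -> perm_eq w (v :: s) -> perm_eq s [seq x <- w | x != v].
  move=> uw pw; have := uw; rewrite (perm_uniq pw) /= => /andP[vs us].
  rewrite perm_sym; apply: perm_trans (perm_filter _ pw) _; rewrite /= eqxx /=.
  suff -> : [seq x <- s | x != v] = s by [].
  by apply/all_filterP/allP => x xs; apply: contraNneq vs => <-.
have uLQ : uniq (flatten L ++ flatten Q) by case/and3P: fLQ.
case: (boolP (v \in flatten L)) => vL.
  have cL : cycles L by apply/andP.
  have [C [s [L' [pL ps es [us ss cL' dis']]]]] := pick_cycle cL vL.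
  have pp : perm_eq (flatten L ++ flatten Q) (v :: (flatten L' ++ s ++ flatten Q)).
    apply: (@perm_trans _ ((v :: s) ++ flatten L' ++ flatten Q)); last first.
      by rewrite /= perm_cons perm_catCA.
    rewrite catA perm_cat2r; apply: perm_trans (perm_flatten pL) _.
    by rewrite flatten_cons perm_cat2r perm_sym.
  have vv : v \notin flatten L' ++ s ++ flatten Q by move: uLQ; rewrite (perm_uniq pp) => /andP[].
  have eL e : ces L e = ce (v :: s) e (+) ces L' e by rewrite (ces_perm _ pL) ces_cons es.
  move: vv; rewrite !mem_cat !negb_or => /and3P[vL' vs vQ].
  exists L', (s :: Q); split.
  - apply/and3P; split; last by rewrite inE negb_or nQ andbT; case: (s) ss.
      by move: uLQ; rewrite (perm_uniq pp) => /andP[].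
    by case/andP: cL'.
  - exact: filt.
  - by rewrite vL addn1.
  - move=> e ve; rewrite eL pes_cons; suff -> : ce (v :: s) e = pe s e by xring.
    case: (s) ss => [|y t] // _; rewrite ceE /= xe_out // xeC xe_out //; xring.
  - move=> x xE; have {xE} [xs|] : x \in ends s \/ x \in endss Q.
      by apply/orP; rewrite -mem_cat.
      right; have vx : v \in [set v; x] by rewrite !inE eqxx.
      rewrite eL (ces_notin vx vL') (pes_notin vx vQ) !addbF.
      case: (s) us ss xs => [|y t] // us ss; rewrite !inE => /orP[/eqP->|/eqP->].
        exact: ce_head.
      exact: (ce_last us).
    by left.
case: (boolP (v \in flatten Q)) => vQ; last first.
  exists L, Q; split=> //.
  - suff -> : [seq x <- flatten L ++ flatten Q | x != v] = flatten L ++ flatten Q by [].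
    apply/all_filterP/allP => x; apply: contraTneq => ->; by rewrite mem_cat (negPf vL).
  - by rewrite mem_cat (negPf vL) (negPf vQ) addn0.
  - by move=> x; left.
have /flattenP[q qQ vq] := vQ.
have pQ := perm_to_rem qQ; set R := rem q Q in pQ.
have vq' : v \notin ends q by apply: contra vE => h; apply/endssP; exists q.
have [s [a [b [t eq]]]] : exists s a b t, q = rcons s a ++ v :: b :: t.
  case/splitPr: vq vq' => p1 p2; case/lastP: p1 => [|s a]; first by rewrite mem_head.
  case: p2 => [|b t] h; last by exists s, a, b, t.
  by move: h; rewrite cats1 ends_rcons !inE eqxx orbT.
have pp : perm_eq (flatten L ++ flatten Q) (v :: (flatten L ++ rcons s a ++ (b :: t) ++ flatten R)).
  apply: (@perm_trans _ (flatten L ++ flatten (q :: R))); first by rewrite perm_cat2l perm_flatten.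
  rewrite eq; clear; apply/permP => f; rewrite flatten_cons -cats1.
  by do 4! rewrite ?count_cat /=; lia.
have uu : uniq (v :: (flatten L ++ rcons s a ++ (b :: t) ++ flatten R)) by rewrite -(perm_uniq pp).
have := uu; rewrite cons_uniq => /andP[vv uu'].
have ab : a != b.
  have := uu'; rewrite cat_uniq => /and3P[_ _]; rewrite cat_uniq => /and3P[_ dd _].
  by apply: contraNneq dd => ->; apply/hasP; exists b; rewrite /= ?mem_rcons mem_head.
have vs : v \notin rcons s a by apply: contra vv => h; rewrite !mem_cat h !orbT.
have vt : v \notin b :: t by apply: contra vv => h; rewrite !mem_cat h !orbT.
have vR : v \notin flatten R by apply: contra vv => h; rewrite !mem_cat h !orbT.
exists L, (rcons s a :: (b :: t) :: R); split.
- apply/and3P; split=> //.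
  by move: nQ; rewrite (perm_mem pQ) !inE !negb_or => /andP[_ ->]; case: (s).
- exact: filt.
- have -> : v \in flatten L ++ flatten Q by rewrite (perm_mem pp) mem_head.
  by rewrite addn1 (perm_size pQ).
- move=> e ve; rewrite (pes_perm e pQ) !pes_cons eq pe_rcat.
  have -> : pe [:: v, b & t] e = xe v b e (+) pe (b :: t) e by [].
  by rewrite (xeC a) !xe_out //; xring.
move=> x xE; have {xE} [xs|xs|xR] : [\/ x \in ends (rcons s a), x \in ends (b :: t) | x \in endss R].
- by have : x \in ends (rcons s a) ++ ends (b :: t) ++ endss R by []; rewrite !mem_cat => /or3P.
- have [sub _] := ends_split a b s (v :: b :: t).
  move: (sub x xs); rewrite in_cons -eq => /orP[/eqP->|xq]; last by left; apply/endssP; exists q.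
  right; have va : v \in [set v; a] by rewrite !inE eqxx.
  rewrite (ces_notin va vL) (pes_perm _ pQ) pes_cons (pes_notin va vR) eq pe_rcat (pe_notin va vs).
  have -> : pe [:: v, b & t] [set v; a] = xe v b [set v; a] (+) pe (b :: t) [set v; a] by [].
  rewrite (pe_notin va vt) /xe (_ : [set v; a] == [set v; b] = false); last first.
    apply/negP => /eqP/setP/(_ b); rewrite !inE eqxx orbT => /orP[/eqP bv|/eqP ba].
      by rewrite bv mem_head in vt.
    by rewrite ba eqxx in ab.
  have -> : a != v by apply: contraNneq vs => ->; rewrite mem_rcons mem_head.
  by rewrite setUC eqxx andbF.
- have [_ sub] := ends_split a b (rcons s a ++ [:: v]) t.
  move: (sub x xs); rewrite in_cons -catA -eq => /orP[/eqP->|xq]; last by left; apply/endssP; exists q.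
  right; have va : v \in [set v; b] by rewrite !inE eqxx.
  rewrite (ces_notin va vL) (pes_perm _ pQ) pes_cons (pes_notin va vR) eq pe_rcat (pe_notin va vs).
  have -> : pe [:: v, b & t] [set v; b] = xe v b [set v; b] (+) pe (b :: t) [set v; b] by [].
  rewrite (pe_notin va vt) /xe (_ : [set v; b] == [set a; v] = false); last first.
    apply/negP => /eqP/setP/(_ a); rewrite !inE eqxx => /orP[/eqP av|/eqP ba].
      by move: vs; rewrite -av mem_rcons mem_head.
    by rewrite ba eqxx in ab.
  have -> : v != b by apply: contraNneq vt => ->; rewrite mem_head.
  by rewrite eqxx andbF.
- left; apply/endssP; case/endssP: xR => r rR xr; exists r => //; by rewrite (perm_mem pQ) inE rR orbT.
Qed.

End RemoveVertex.

Lemma mem_edges (T : finType) (G : rel T) x y : symmetric G -> ([set x; y] \in edges G) = G x y.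
Proof.
move=> sym; apply/imsetP/idP => [[[a b]]|xy]; last by exists (x, y); rewrite ?inE.
rewrite inE /= => ab exy.
have /set2P : x \in [set a; b] by rewrite -exy !inE eqxx.
have /set2P : y \in [set a; b] by rewrite -exy !inE eqxx orbT.
have /set2P : b \in [set x; y] by rewrite exy !inE eqxx orbT.
have /set2P : a \in [set x; y] by rewrite exy !inE eqxx.
case=> ea; case=> eb; case=> ey; case=> ex; subst; rewrite // sym //.
Qed.

Lemma cesP (T : finType) (P : seq (seq T)) e : ces P e -> exists2 C, C \in P & ce C e.
Proof.
elim: P => [|C P IH]; rewrite ?ces_nil // ces_cons; case: (boolP (ce C e)) => cC.
  by exists C; rewrite ?mem_head.
by move=> /IH[D DP cD]; exists D; rewrite // inE DP orbT.
Qed.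

Lemma seq_preimage (A B : eqType) (g : A -> B) (t : seq B) :
  (forall u, u \in t -> exists x, u = g x) -> exists s, t = map g s.
Proof.
elim: t => [|u t IH] h; first by exists [::].
have [x ->] := h u (mem_head _ _).
have [|s ->] := IH; last by exists (x :: s).
by move=> w wt; apply: h; rewrite inE wt orbT.
Qed.

(** * Transport along an injection of vertices *)

Section Injections.

Variables (T U : finType) (f : T -> U).
Hypothesis fi : injective f.
Implicit Types (s : seq T) (P L Q : seq (seq T)) (e : {set T}).

Lemma imset_pair x y : f @: [set x; y] = [set f x; f y].
Proof. by rewrite imsetU1 imset_set1. Qed.

Lemma xe_map x y e : xe (f x) (f y) (f @: e) = xe x y e.
Proof.
rewrite /xe (inj_eq fi) -imset_pair; congr andb.
by apply/eqP/eqP => [/(imset_inj fi)|->].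
Qed.

Lemma pe_map s e : pe (map f s) (f @: e) = pe s e.
Proof.
case: s => // x s /=; elim: s x => [|y s IH] x //=.
by rewrite xe_map IH.
Qed.

Lemma ce_map s e : ce (map f s) (f @: e) = ce s e.
Proof. by case: s => // x s; rewrite [map _ _]/= !ceE -map_cons pe_map last_map xe_map. Qed.

Lemma pes_map P e : pes (map (map f) P) (f @: e) = pes P e.
Proof. by rewrite /pes big_map; apply: eq_bigr => s _; rewrite pe_map. Qed.

Lemma ces_map P e : ces (map (map f) P) (f @: e) = ces P e.
Proof. by rewrite /ces big_map; apply: eq_bigr => s _; rewrite ce_map. Qed.

Lemma ends_map s : ends (map f s) = map f (ends s).
Proof. by case: s => //= x s; rewrite last_map. Qed.

Lemma endss_map P : endss (map (map f) P) = map f (endss P).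
Proof. by rewrite /endss map_flatten -!map_comp; congr flatten; apply: eq_map => s /=; rewrite ends_map. Qed.

Lemma factor_map L Q : factor (map (map f) L) (map (map f) Q) -> factor L Q.
Proof.
rewrite /factor -!map_flatten -map_cat map_inj_uniq // all_map => /and3P[-> s3 nQ] /=.
apply/andP; split; first by apply: sub_all s3 => s /=; rewrite size_map.
by apply: contra nQ => nQ; apply/mapP; exists [::].
Qed.

Lemma seqs_preimage (P : seq (seq U)) :
  (forall u, u \in flatten P -> exists x, u = f x) -> exists P', P = map (map f) P'.
Proof.
move=> h; apply: seq_preimage => t tP; apply: seq_preimage => u ut.
by apply: h; apply/flattenP; exists t.
Qed.

End Injections.

(** * Joining the vertices of odd degree to two new vertices *)

Section OddFactors.

Variables (T : finType) (G : rel T) (O : bool -> {set T}).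
Implicit Types (x y : T) (e : {set T}).

(** One new vertex could get a degree above [2k], hence two. They are not adjacent, so that deleting
    the first does not turn the second into an end of a path. *)
Definition extend (u v : T + bool) : bool :=
  match u, v with
  | inl x, inl y => G x y
  | inl x, inr b | inr b, inl x => x \in O b
  | _, _ => false
  end.

Lemma deg_extend : (forall x, deg extend (inl x) = deg G x + (x \in O true) + (x \in O false)) /\
  (forall b, deg extend (inr b) = #|O b|).
Proof.
have degE H u : deg H u = \sum_(v : T + bool) H u v by rewrite /deg -sum1dep_card big_mkcond.
split=> [x|b]; rewrite degE big_sumType big_bool /=.
  by rewrite -addnA; congr addn; rewrite /deg -sum1dep_card [RHS]big_mkcond.
by rewrite !addn0 -sum1_card [RHS]big_mkcond.
Qed.

Lemma edges_extend e : (inl @: e \in edges extend) = (e \in edges G).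
Proof.
apply/imsetP/imsetP => [[[u v]]|[[x y] xy ->]]; last first.
  by exists (inl x, inl y); [move: xy; rewrite !inE | exact: imset_pair].
rewrite inE /= => uv es.
have /imsetP[x xe0 ux] : u \in inl @: e by rewrite es !inE eqxx.
have /imsetP[y ye vy] : v \in inl @: e by rewrite es !inE eqxx orbT.
exists (x, y); first by rewrite inE /=; rewrite ux vy in uv.
by apply: (imset_inj (f := @inl T bool)) => [z w []|]; rewrite ?imset_pair ?es ?ux ?vy.
Qed.

(** Every path end left by the deletions was joined to a new vertex. A vertex of odd degree has only
    one such edge, which lies in a single family; therefore different factors share no ends. *)
Lemma odd_factors k : symmetric G -> irreflexive G -> (forall x, deg G x <= k.*2) ->
  (forall x, x \in O true -> x \notin O false) ->
  (forall x, odd (deg G x) = (x \in O true) || (x \in O false)) ->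
  (forall b, ~~ odd #|O b|) -> (forall b, #|O b| <= k.*2) ->
  exists S : nat -> seq (seq T) * seq (seq T),
  [/\ forall i, i < k -> factor (S i).1 (S i).2, forall i, i < k -> size (S i).2 <= 2,
      (\sum_(i < k) size (S i).2).*2 = #|O true| + #|O false|,
      forall e, (e \in edges G) = \big[addb/false]_(i < k) (ces (S i).1 e (+) pes (S i).2 e)
    & forall i j x, i < k -> j < k -> i != j -> x \in endss (S i).2 -> x \notin endss (S j).2].
Proof.
move=> sym irr le dis od ev leO.
have esym : symmetric extend by move=> [x|b] [y|c] //=; rewrite sym.
have eirr : irreflexive extend by move=> [x|b] //=; rewrite irr.
have [dl dr] := deg_extend.
have [||L [cL dL eL degL]] := @even_factors _ extend k esym eirr.
- case=> [x|b]; rewrite ?dl ?dr // !oddD od.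
  by have := dis x; case: (x \in O true) => [/(_ isT)/negPf->|_] //; case: (x \in O false).
- case=> [x|b]; rewrite ?dl ?dr //.
  (* An odd degree is strictly below [2k], which leaves room for the edge to a new vertex. *)
  have : odd (deg G x) -> deg G x < k.*2.
    by move=> o; rewrite ltn_neqAle le andbT; apply: contraTneq o => ->; rewrite odd_double.
  rewrite od; have := dis x; case: (x \in O true) => [/(_ isT)/negPf->|_] /= h; first by rewrite addn0 addn1 h.
  by rewrite addn0; move: h; case: (x \in O false) => h; rewrite ?addn0 ?addn1 ?h.
have ed u v i : i < k -> ces (L i) [set u; v] -> extend u v.
  move=> ik ce1; rewrite -mem_edges // eL (bigD1 (Ordinal ik)) //= ce1 big1 // => j ji.
  apply: contraTF ce1 => ce2; apply/negP => ce1.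
  have [C CL cC] := cesP ce1; have [D DL cD] := cesP ce2.
  by apply: (dL i j) CL DL cC cD; rewrite // eq_sym.
have [|S SP] := @finite_choice (seq (seq T) * seq (seq T)) ([::], [::])
  (fun i S => [/\ factor S.1 S.2,
     size S.2 = (inr true \in flatten (L i)) + (inr false \in flatten (L i)),
     forall e, ces S.1 e (+) pes S.2 e = ces (L i) (inl @: e)
   & forall x, x \in endss S.2 -> exists b, ces (L i) [set inr b; inl x]]) k.
  move=> i ik; have fL : factor (L i) [::].
    by have /andP[u s] := cL i ik; rewrite /factor /= cats0 u s.
  have [//|L1 [Q1 [f1 p1 s1 e1 n1]]] := @factor_remove _ _ _ (inr true) fL.
  rewrite cats0 in p1 s1.
  have n1' u : u \in endss Q1 -> exists2 x, u = inl x & ces (L i) [set inr true; inl x].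
    move=> /n1[//|]; rewrite pes_nil addbF => cu; have := ed _ _ _ ik cu.
    by case: u cu => // x cu _; exists x.
  have [|L2 [Q2 [f2 p2 s2 e2 n2]]] := @factor_remove _ _ _ (inr false) f1.
    by apply/negP => /n1'[].
  have m1 u : (u \in flatten L1 ++ flatten Q1) = (u != inr true) && (u \in flatten (L i)).
    by rewrite (perm_mem p1) mem_filter.
  have m2 u : u \in flatten L2 ++ flatten Q2 -> exists x, u = inl x.
    rewrite (perm_mem p2) mem_filter m1; case: u => [x _|[]]; rewrite ?eqxx ?andbF //.
    by exists x.
  have [|L3 eL3] := @seqs_preimage _ _ (@inl T bool) L2.
    by move=> u uL; apply: m2; rewrite mem_cat uL.
  have [|Q3 eQ3] := @seqs_preimage _ _ (@inl T bool) Q2.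
    by move=> u uQ; apply: m2; rewrite mem_cat uQ orbT.
  have inl_inj : injective (@inl T bool) by move=> x y [].
  have nr b e : inr b \notin [set inl x | x in e] by apply/imsetP => -[].
  exists (L3, Q3); split=> /=.
  - by apply: (factor_map inl_inj); rewrite -eL3 -eQ3.
  - have <- : size Q2 = size Q3 by rewrite eQ3 size_map.
    by rewrite s2 s1 m1.
  - by move=> e; rewrite -(ces_map inl_inj) -(pes_map inl_inj) -eL3 -eQ3 e2 ?nr // e1 ?nr // pes_nil addbF.
  - move=> x; rewrite -(mem_map inl_inj) -endss_map -eQ3 => /n2[/n1'[y [->] cy]|cx].
      by exists true.
    by exists false; move: cx; rewrite e1 ?pes_nil ?addbF // !inE.
exists S; split.
- by move=> i /SP[].
- by move=> i /SP[_ -> _ _]; case: (_ \in _); case: (_ \in _).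
- rewrite -!dr !degL -doubleD -big_split; congr _.*2; apply: eq_bigr => i _.
  by have [_ -> _ _] := SP i (ltn_ord i).
- move=> e; rewrite -edges_extend eL; apply: eq_bigr => i _.
  by have [_ _ -> _] := SP i (ltn_ord i).
- move=> i j x ik jk ij xi; apply/negP => xj.
  have [_ _ _ /(_ x xi)[b cb]] := SP i ik; have [_ _ _ /(_ x xj)[c cc]] := SP j jk.
  have xb : x \in O b := ed _ _ _ ik cb; have xc : x \in O c := ed _ _ _ jk cc.
  have bc : b = c.
    by case: b c xb xc {cb cc} => [] [] // xb xc; have := dis x; rewrite xb xc => /(_ isT).
  rewrite bc in cb; have [C CL cC] := cesP cb; have [D DL cD] := cesP cc.
  exact: (dL i j) CL DL cC cD.
Qed.

End OddFactors.

(** * Sums of cycle families as even graphs *)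

Section EdgeFunctions.

Variable T : finType.
Implicit Types (s t q : seq T) (P Q L CC : seq (seq T)) (e : {set T}) (v x y a b : T).
Implicit Types (E : {set T} -> bool) (CL : seq (seq (seq T))).

Definition graph_of E : rel T := fun x y => E [set x; y].

Lemma graph_of_sym E : symmetric (graph_of E).
Proof. by move=> x y; rewrite /graph_of setUC. Qed.

Lemma graph_of_irr E : (forall e, E e -> #|e| = 2) -> irreflexive (graph_of E).
Proof. by move=> E2 x; apply/negP => /E2; rewrite setUid cards1. Qed.

Lemma edges_graph_of E e : (forall e, E e -> #|e| = 2) -> (e \in edges (graph_of E)) = E e.
Proof.
move=> E2; apply/idP/idP => [/imsetP[[x y]]|Ee]; first by rewrite inE /= => ? ->.
by have /eqP/cards2P[x [y [_ e_xy]]] := E2 e Ee; rewrite e_xy mem_edges ?/graph_of -?e_xy //; exact: graph_of_sym.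
Qed.

Lemma deg_graph_of E x : deg (graph_of E) x = \sum_y E [set x; y].
Proof. by rewrite /deg -sum1dep_card big_mkcond. Qed.

Lemma odd_sum_addb (u v : pred T) :
  odd (\sum_y (u y (+) v y)) = odd (\sum_y u y) (+) odd (\sum_y v y).
Proof.
rewrite -oddD -big_split !(big_morph odd oddD (erefl _)); apply: eq_bigr => y _ /=.
by case: (u y); case: (v y).
Qed.

Lemma leq_sum_addb (u v : pred T) : \sum_y (u y (+) v y) <= \sum_y u y + \sum_y v y.
Proof. by rewrite -big_split; apply: leq_sum => y _ /=; case: (u y); case: (v y). Qed.

Lemma sum_eq1 a : \sum_y (y == a) = 1.
Proof. by rewrite (bigD1 a) //= eqxx big1 ?addn0 // => y /negPf->. Qed.

Lemma sum_edge a b x : a != b -> \sum_y xe a b [set x; y] = (x == a) + (x == b).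
Proof.
move=> ab; have E y : xe a b [set x; y] = (x == a) && (y == b) || (x == b) && (y == a).
  rewrite /xe ab; apply/eqP/orP => [ee|[]/andP[/eqP-> /eqP->] //]; last by rewrite setUC.
  have /set2P : x \in [set a; b] by rewrite -ee !inE eqxx.
  have /set2P : y \in [set a; b] by rewrite -ee !inE eqxx orbT.
  have /set2P : b \in [set x; y] by rewrite ee !inE eqxx orbT.
  have /set2P : a \in [set x; y] by rewrite ee !inE eqxx.
  case=> ea; case=> eb; case=> ey; case=> ex; subst; rewrite ?eqxx ?andbT ?orbT; auto;
  by rewrite eqxx in ab.
rewrite (eq_bigr _ (fun y _ => congr1 nat_of_bool (E y))).
case: (eqVneq x a) => [->|xa]; rewrite /= ?(negPf ab) /=.
  by rewrite (eq_bigr (fun y => y == b : nat)) ?sum_eq1 // => y _; rewrite orbF.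
case: (eqVneq x b) => [_|xb]; first by rewrite sum_eq1.
by rewrite big1.
Qed.

Lemma xe_card a b e : xe a b e -> #|e| = 2.
Proof. by move=> /andP[ab /eqP->]; rewrite cards2 ab. Qed.

Lemma pth_card x s e : pth x s e -> #|e| = 2.
Proof.
elim: s x => [|y s IH] x //=; case: (boolP (xe x y e)) => [/xe_card//|_]; exact: IH.
Qed.

Lemma ces_card CC e : ces CC e -> #|e| = 2.
Proof.
move=> /cesP[[|x s] // _]; rewrite ceE /=.
by case: (boolP (pth x s e)) => [/pth_card//|_ /xe_card].
Qed.

Lemma sum_closed CC x : cycles CC ->
  odd (\sum_y ces CC [set x; y]) = false /\ \sum_y ces CC [set x; y] <= 2.
Proof.
move=> cC; case: (boolP (x \in flatten CC)) => xC; last first.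
  by rewrite big1 // => y _; rewrite (@ces_notin _ x) // !inE eqxx.
have [C [s [CC' [pC ps es [us ss cC' dis]]]]] := pick_cycle cC xC.
have xs : x \notin s by move: us; rewrite cons_uniq => /andP[].
case: s us ss es ps dis xs => [|a s] // us ss es ps dis xs.
have E y : ces CC [set x; y] = xe x a [set x; y] (+) xe (last a s) x [set x; y].
  have xe0 : x \in [set x; y] by rewrite !inE eqxx.
  rewrite (ces_perm _ pC) ces_cons -es ceE (@ces_notin _ x) //; last first.
    by apply: contra dis => h; apply/hasP; exists x; rewrite ?mem_head.
  have -> : pe [:: x, a & s] [set x; y] = xe x a [set x; y] (+) pe (a :: s) [set x; y] by [].
  by rewrite (pe_notin xe0 xs) /=; xring.
rewrite (eq_bigr _ (fun y _ => congr1 nat_of_bool (E y))).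
have xa : x != a by apply: contraNneq xs => ->; rewrite mem_head.
have lx : last a s != x by apply: contraNneq xs => <-; rewrite mem_last.
split; first by rewrite odd_sum_addb !sum_edge // eqxx (negPf xa) eq_sym (negPf lx).
by apply: leq_trans (leq_sum_addb _ _) _; rewrite !sum_edge // eqxx (negPf xa) eq_sym (negPf lx).
Qed.

(** Closing edges may make the families overlap, so they cannot be paired as they stand. Their sum
    is an even graph with degrees at most twice their number, and it is decomposed afresh. *)
Lemma closed_decomposes CL : all (@cycles T) CL ->
  decomposes (@pe T) (fun e => \big[addb/false]_(CC <- CL) ces CC e) (uphalf (3 * size CL)).
Proof.
move=> cCL; set E := fun e => _.
have E2 e : E e -> #|e| = 2.
  rewrite /E; elim: CL {cCL E} => [|CC CL IH]; rewrite ?big_nil // big_cons.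
  by case: (boolP (ces CC e)) => [/ces_card//|_ /IH].
have dE x : odd (\sum_y E [set x; y]) = false /\ \sum_y E [set x; y] <= (size CL).*2.
  rewrite /E; elim: CL cCL {E E2} => [|CC CL IH] /=.
    by move=> _; rewrite big1 // => y _; rewrite big_nil.
  move=> /andP[cC /IH[o le]]; have [oC leC] := sum_closed x cC.
  set F := fun y => \big[addb/false]_(DD <- CL) ces DD [set x; y] in o le.
  have -> : \sum_y \big[addb/false]_(DD <- CC :: CL) ces DD [set x; y] = \sum_y (ces CC [set x; y] (+) F y).
    by apply: eq_bigr => y _; rewrite big_cons.
  rewrite odd_sum_addb o oC; split=> //.
  apply: leq_trans (leq_sum_addb _ _) _; rewrite doubleS -add2n; exact: leq_add.
have [] := @even_decomposes _ (graph_of E) (size CL).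
- exact: graph_of_sym.
- exact: graph_of_irr.
- by move=> x; rewrite deg_graph_of; have [-> _] := dE x.
- by move=> x; rewrite deg_graph_of; have [] := dE x.
by move=> [Z [uZ sZ eZ]] _; exists Z; split=> // e; rewrite eZ edges_graph_of.
Qed.

End EdgeFunctions.

(** * Combining families that contain paths *)

Section Combine.

Variable T : finType.
Implicit Types (S : seq (seq (seq T) * seq (seq T))) (p : option (seq (seq T) * seq (seq T))).

Definition factor_edges F (e : {set T}) := ces F.1 e (+) pes F.2 e.

(* p is a factor with a single path that waits for a second one of this kind: closing
   one of the two paths by an edge, and adding this edge to the other factor, leaves
   a sum of two paths and a family of cycles. *)
Lemma combine_factors S : all (fun F => factor F.1 F.2 && (size F.2 <= 2)) S ->
  pairwise (fun F F' => ~~ has (mem (endss F.2)) (endss F'.2)) S ->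
  exists Z CL p, [/\ all uniq Z, all (@cycles T) CL,
    forall e, \big[addb/false]_(F <- S) factor_edges F e =
      pes Z e (+) \big[addb/false]_(CC <- CL) ces CC e (+) oapp (factor_edges^~ e) false p,
    size Z + p = \sum_(F <- S) size F.2 /\ (size CL).*2 + size Z + p.*2 = (size S).*2
  & if p is Some F then F \in S /\ size F.2 = 1 else True].
Proof.
elim: S => [|[L Q] S IH] /=.
  by move=> _ _; exists [::], [::], None; split=> // [e|]; rewrite ?pes_nil !big_nil.
move=> /andP[/andP[fF sQ] fS] /andP[dF dS].
have [Z [CL [p [uZ cCL eS [s1 s2] hp]]]] := IH fS dS.
have [cL uQ nQ _] := factorP fF.
have sumS : \sum_(F <- (L, Q) :: S) size F.2 = size Q + \sum_(F <- S) size F.2 by rewrite big_cons.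
have eFS e : \big[addb/false]_(F <- (L, Q) :: S) factor_edges F e =
   ces L e (+) pes Q e (+) \big[addb/false]_(F <- S) factor_edges F e by rewrite big_cons.
case: Q sQ fF dF uQ nQ sumS eFS => [|q [|r [|//]]] _ fF dF uQ nQ sumS eFS.
- exists Z, (L :: CL), p; split=> //; first by rewrite /= cL.
  + by move=> e; rewrite eFS eS pes_nil big_cons; xring.
  + by rewrite sumS -s1; split=> //; move: s2 => /=; clear; lia.
  + by case: (p) hp => // F [FS sF]; rewrite inE FS orbT.
- case: p eS s1 s2 hp => [[L' Q']|] /= eS s1 s2 hp; last first.
    exists Z, CL, (Some (L, [:: q])); split=> //=.
    + by move=> e; rewrite eFS eS /factor_edges; xring.
    + by rewrite sumS -s1; move: s2 => /=; clear; split; lia.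
    + by rewrite mem_head.
  have [FS sQ'] := hp; case: Q' FS sQ' eS s1 s2 {hp} => [|r [|//]] // FS _ eS s1 s2.
  have /andP[/= fF' _] := allP fS _ FS; have [cL' ur nr dr] := factorP fF'.
  case: r FS eS fF' ur nr dr => [|c s] // FS eS fF' ur nr dr; set d := last c s.
  have [z1 [z2 [u1 u2 ez]]] : exists z1 z2, [/\ uniq z1, uniq z2 &
     forall e, pe z1 e (+) pe z2 e = ces L e (+) pe q e (+) xe c d e].
    (* A one-vertex path needs no closing edge. Otherwise [c] and [d] are not ends of [q], because
       different factors share no ends. *)
    have [cd|cd] := eqVneq c d.
      have [z1 [z2 [u1 u2 ez]]] := factor_one fF; exists z1, z2; split=> // e.
      by rewrite ez -cd xexx addbF.
    have dq : ~~ has (mem (ends q)) [:: c; d].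
      have e1 u : endss [:: u] = ends u by rewrite /endss /= cats0.
      by have := allP dF _ FS; rewrite !e1.
    move: dq => /=; rewrite orbF negb_or => /andP[cq dq].
    exact: factor_one_edge fF cd cq dq.
  (* On at most two vertices the closing edge cancels the path, and nothing is added to the
     cycles. *)
  pose CC := if size (c :: s) > 2 then (c :: s) :: L' else L'.
  have cCC : cycles CC.
    rewrite /CC; case: ifP => // sz; case/andP: cL' => uL' sL'; apply/andP; split; last by rewrite /= sz.
    have e1 : flatten [:: c :: s] = c :: s by rewrite /= cats0.
    by rewrite e1 in ur dr; rewrite flatten_cons cat_uniq uL' andbT has_sym ur dr.
  have eCC e : ces CC e = ces L' e (+) pe (c :: s) e (+) xe c d e.
    have : ce (c :: s) e = pe (c :: s) e (+) xe c d e by rewrite ceE xeC.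
    rewrite -addbA /CC; case: ifP => [_ <-|sz <-]; first by rewrite ces_cons addbC.
    by case: (s) sz => [|y [|//]] _; rewrite ceE /= ?xexx ?addbF // (xeC y) addbb addbF.
  exists [:: z1, z2 & Z], (CC :: CL), None; split=> //=.
  + by rewrite u1 u2.
  + by rewrite cCC.
  + move=> e; rewrite eFS eS /= /factor_edges /= !pes_cons !pes_nil big_cons eCC.
    have -> : pe z2 e = pe z1 e (+) (ces L e (+) pe q e (+) xe c d e) by rewrite -ez; xring.
    by xring.
  + by rewrite sumS -s1; move: s2 => /=; clear; split; lia.
- have [z1 [z2 [u1 u2 ez]]] := factor_two fF.
  exists [:: z1, z2 & Z], CL, p; split=> //=.
  + by rewrite u1 u2.
  + move=> e; rewrite eFS eS !pes_cons pes_nil.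
    have -> : pe z2 e = pe z1 e (+) (ces L e (+) pe q e (+) pe r e) by rewrite -ez; xring.
    by xring.
  + by rewrite sumS -s1; move: s2 => /=; clear; split; lia.
  + by case: (p) hp => // F [FS sF]; rewrite inE FS orbT.
Qed.

(** Let [z = size Z], let [p] be 0 or 1, let [m = z + p] be the number of paths and [k] that of
    factors. There are [k - z/2 - p] cycle families, so the total is at most the ceiling of
    [(6k + z + 2p)/4]. As [z] is even, replacing [2p] by [p] does not change this ceiling, which
    gives [(6k + m)/4] rounded up. *)
Lemma factors_decompose S : all (fun F => factor F.1 F.2 && (size F.2 <= 2)) S ->
  pairwise (fun F F' => ~~ has (mem (endss F.2)) (endss F'.2)) S ->
  decomposes (@pe T) (fun e => \big[addb/false]_(F <- S) factor_edges F e)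
    ((\sum_(F <- S) size F.2 + 6 * size S + 3) %/ 4).
Proof.
move=> fS dS; have [Z [CL [p [uZ cCL eS [s1 s2] hp]]]] := combine_factors fS dS.
have [Z1 [uZ1 sZ1 eZ1]] := closed_decomposes cCL.
have [Z2 [uZ2 sZ2 eZ2]] : exists Z2, [/\ all uniq Z2, size Z2 = p.*2
    & forall e, pes Z2 e = oapp (factor_edges^~ e) false p].
  case: p hp {eS s1 s2} => [[L Q]|] /=; last by exists [::]; split=> // e; rewrite pes_nil.
  case: Q => [|q [|? ?]] [FS] //= _; have /andP[fF _] := allP fS _ FS.
  have [z1 [z2 [u1 u2 ez]]] := factor_one fF; exists [:: z1; z2]; split=> //=.
    by rewrite u1 u2.
  by move=> e; rewrite /factor_edges /= !pes_cons !pes_nil !addbF ez.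
exists (Z ++ Z1 ++ Z2); split.
- by rewrite !all_cat uZ uZ1 uZ2.
- rewrite !size_cat sZ2 -s1; move: s2 sZ1; clear; case: p => [?|] /=; lia.
- by move=> e; rewrite eS -eZ2 -eZ1 -!/(pes _ e) !pes_cat addbA.
Qed.

End Combine.

(** * Graphs with vertices of odd degree *)

Section OddGraphs.

Variable T : finType.
Implicit Types (G : rel T) (x y a b : T) (A B : {set T}) (e : {set T}).

Lemma subset_of_card A n : n <= #|A| -> exists2 B : {set T}, B \subset A & #|B| = n.
Proof.
move=> nA; exists [set x in take n (enum A)].
  by apply/subsetP => x; rewrite inE => /mem_take; rewrite mem_enum.
by rewrite cardsE (card_uniqP (take_uniq n (enum_uniq _))) size_take_min -cardE (minn_idPl nA).
Qed.

Lemma handshake G : symmetric G -> irreflexive G -> ~~ odd (v_odd G).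
Proof.
move=> sym irr; rewrite /v_odd -sum1dep_card big_mkcond.
have -> : odd (\sum_x (if odd (deg G x) then 1 else 0)) = odd (\sum_x deg G x).
  rewrite !(big_morph odd oddD (erefl _)); apply: eq_bigr => x _.
  by case: (odd (deg G x)).
have -> : \sum_x deg G x = \sum_x \sum_y G x y.
  by apply: eq_bigr => x _; rewrite /deg -sum1dep_card big_mkcond.
have -> : \sum_x \sum_y G x y = (\sum_x \sum_(y | enum_rank x < enum_rank y) G x y).*2.
  rewrite -addnn [X in _ = _ + X](exchange_big_dep xpredT) //= -big_split; apply: eq_bigr => x _ /=.
  rewrite (bigID (fun y => enum_rank x < enum_rank y)) /=; congr addn.
  rewrite [LHS](bigID (fun y => y == x)) /= [X in X + _]big1 ?add0n; last first.
    by move=> y /andP[_ /eqP->]; rewrite irr.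
  apply: eq_big => y; last by rewrite sym.
  rewrite -leqNgt ltn_neqAle andbC; congr andb.
  by rewrite -(inj_eq (@enum_rank_inj T)).
by rewrite odd_double.
Qed.

Lemma odd_decomposes_dense G k m : symmetric G -> irreflexive G ->
  (forall x, deg G x <= k.*2) -> v_odd G = m.*2 -> m <= k.*2 ->
  decomposes (@pe T) (fun e => e \in edges G) ((m + 6 * k + 3) %/ 4).
Proof.
move=> sym irr le vG mk; pose A := [set x | odd (deg G x)].
have cA : #|A| = m.*2 by [].
(* Both [B] and the remaining odd vertices are even in number and at most [2k], since [m] is at most
   [2k]. *)
have [|B BA cB] := @subset_of_card A (minn m k).*2; first by rewrite cA leq_double geq_minl.
have cAB : #|A :\: B| = m.*2 - (minn m k).*2 by rewrite cardsDS // cA cB.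
have [||||F [fF sF cF eF dF]] := @odd_factors _ G (fun c => if c then B else A :\: B) k sym irr le.
- by move=> x xB; rewrite inE xB.
- move=> x; have -> : odd (deg G x) = (x \in A) by rewrite inE.
  by rewrite in_setD; case: (boolP (x \in B)) => //= xB; rewrite (subsetP BA).
- by case; rewrite ?cB ?cAB -?doubleB odd_double.
- case; rewrite ?cB ?cAB -?doubleB leq_double; first by rewrite geq_minr.
  by move: mk; clear; lia.
have [||Z [uZ sZ eZ]] := @factors_decompose T (mkseq F k).
- apply/(all_nthP ([::], [::])) => i; rewrite size_mkseq => ik.
  by rewrite nth_mkseq // fF ?sF.
- apply/(pairwiseP ([::], [::])) => i j; rewrite !inE size_mkseq => ik jk ij.
  rewrite !nth_mkseq //; apply/hasPn => x xj; apply: (dF j i) => //.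
  by rewrite neq_ltn ij orbT.
have iotaE : iota 0 k = index_iota 0 k by rewrite /index_iota subn0.
exists Z; split=> //.
  move: sZ; rewrite size_mkseq big_map iotaE big_mkord.
  suff -> : \sum_(i < k) size (F i).2 = m by [].
  apply: double_inj; rewrite cF cB cAB; clear; lia.
by move=> e; rewrite eZ eF big_map iotaE big_mkord.
Qed.

(** Toggling the edge [a b], whether or not it belongs to [G], makes two odd degrees even. Odd
    degrees are below [2k], so the degree bound persists. For [m] at least [2k] the second term of
    the maximum is at most [m], so the additional path is paid for by the step from [m] to
    [m + 1]. *)
Lemma odd_decomposes G k m : symmetric G -> irreflexive G ->
  (forall x, deg G x <= k.*2) -> v_odd G = m.*2 ->
  decomposes (@pe T) (fun e => e \in edges G) (maxn m ((m + 6 * k + 3) %/ 4)).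
Proof.
elim: m G => [|m IH] G sym irr le vG.
  have [Z [uZ sZ eZ]] := odd_decomposes_dense sym irr le vG (leq0n _).
  by exists Z; split=> //; apply: leq_trans sZ (leq_maxr _ _).
case: (leqP m.+1 k.*2) => mk.
  have [Z [uZ sZ eZ]] := odd_decomposes_dense sym irr le vG mk.
  by exists Z; split=> //; apply: leq_trans sZ (leq_maxr _ _).
have : 1 < #|[set x | odd (deg G x)]| by rewrite -/(v_odd G) vG doubleS.
move=> /card_gt1P[a [b []]]; rewrite !inE => oa ob ab.
pose E e := (e \in edges G) (+) xe a b e.
have E2 e : E e -> #|e| = 2.
  rewrite /E; case: (boolP (xe a b e)) => [/xe_card//|_]; rewrite addbF => /imsetP[[x y]].
  rewrite inE /= => xy ->; rewrite cards2; suff -> : x != y by [].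
  by apply: contraTneq xy => ->; rewrite irr.
have dE x : deg (graph_of E) x = \sum_y (G x y (+) xe a b [set x; y]).
  by rewrite deg_graph_of; apply: eq_bigr => y _; rewrite /E mem_edges.
have dG x : deg G x = \sum_y G x y by rewrite /deg -sum1dep_card big_mkcond.
have oE x : odd (deg (graph_of E) x) = odd (deg G x) (+) odd ((x == a) + (x == b)).
  by rewrite dE odd_sum_addb -dG sum_edge.
have leE x : deg (graph_of E) x <= deg G x + ((x == a) + (x == b)).
  by rewrite dE dG -(sum_edge x ab) leq_sum_addb.
have lt x : odd (deg G x) -> deg G x < k.*2.
  by move=> o; rewrite ltn_neqAle le andbT; apply: contraTneq o => ->; rewrite odd_double.
have ba : b != a by rewrite eq_sym.
have vE : v_odd (graph_of E) = m.*2.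
  have eA : [set x | odd (deg (graph_of E) x)] = [set x | odd (deg G x)] :\ a :\ b.
    apply/setP => x; rewrite !inE oE.
    case: (eqVneq x a) => [->|xa]; first by rewrite (negPf ab) oa.
    by case: (eqVneq x b) => [->|xb]; rewrite ?ob // addbF.
  move: vG; rewrite /v_odd eA (cardsD1 a) (cardsD1 b (_ :\ a)) !inE oa ob ba doubleS !add1n.
  by case.
have [||x||Z [uZ sZ eZ]] := IH (graph_of E); [exact: graph_of_sym|exact: graph_of_irr| |exact: vE|].
  apply: leq_trans (leE x) _.
  case: (eqVneq x a) => [->|xa]; first by rewrite (negPf ab) addn1 lt.
  by case: (eqVneq x b) => [->|xb]; rewrite ?addn0 // addn1 lt.
exists ([:: a; b] :: Z); split.
- by rewrite /= inE ab.
- by move: sZ mk => /=; clear; lia.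
- by move=> e; rewrite big_cons eZ edges_graph_of // /E /=; xring.
Qed.

End OddGraphs.

(** * Odd-covers *)

Section Covers.

Variable T : finType.
Implicit Types (G : rel T) (x y : T) (s : seq T) (e : {set T}) (F : {set {set T}}) (H : {set {set {set T}}}).

(** A cover is a set, so a member that would occur a second time is removed instead of added. *)
Lemma symdiff_toggle H F : exists2 H' : {set {set {set T}}}, #|H'| <= #|H|.+1 &
  {subset H' <= F |: H} /\ forall e, (e \in symdiff H') = (e \in F) (+) (e \in symdiff H).
Proof.
case: (boolP (F \in H)) => FH.
  exists (H :\ F); first by rewrite ltnW // ltnS subset_leq_card // subsetDl.
  split=> [K|e]; first by rewrite !inE => /andP[_ ->]; rewrite orbT.
  rewrite !inE (cardsD1 F [set K in H | e \in K]) !inE FH /= oddD oddb.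
  have -> : [set K in H :\ F | e \in K] = [set K in H | e \in K] :\ F.
    by apply/setP => K; rewrite !inE andbA.
  by rewrite addbA addbb.
exists (F |: H); first by rewrite cardsU1 FH.
split=> // e; rewrite !inE (cardsD1 F [set K in F |: H | e \in K]) !inE eqxx /= oddD oddb.
congr (_ (+) odd _); apply: eq_card => K; rewrite !inE.
by case: eqVneq => [->|] //=; rewrite (negPf FH).
Qed.

(** [n] is the largest size of a degenerate sequence, 1 for paths and 2 for cycles; such sequences
    contribute no edge and are dropped. *)
Lemma odd_cover_of (phi : seq T -> {set T} -> bool) (edges_of : seq T -> {set {set T}}) n Z :
  (forall s e, uniq s -> phi s e = (n < size s) && (e \in edges_of s)) -> all uniq Z ->
  exists H, [/\ forall F, F \in H -> exists s, [/\ uniq s, n < size s & F = edges_of s],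
    #|H| <= size Z & forall e, (e \in symdiff H) = \big[addb/false]_(s <- Z) phi s e].
Proof.
move=> phiE; elim: Z => [|s Z IH] /=.
  move=> _; exists set0; split=> [F|//|e]; rewrite ?inE ?cards0 // big_nil.
  by rewrite (_ : [set F in (set0 : {set {set {set T}}}) | e \in F] = set0) ?cards0 //; apply/setP => F; rewrite !inE.
move=> /andP[us /IH[H [HP sH eH]]]; case: (boolP (n < size s)) => ns; last first.
  exists H; split=> // [|e]; first exact: leqW.
  by rewrite eH big_cons phiE // (negPf ns).
have [H' sH' [sub eH']] := symdiff_toggle H (edges_of s).
exists H'; split=> [F /sub||e].
- by rewrite in_setU1 => /orP[/eqP->|/HP //]; exists s.
- exact: leq_trans sH' _.
- by rewrite eH' eH big_cons phiE // ns.
Qed.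

(** A sequence without repetitions uses no edge twice, so counting modulo 2 agrees with
    membership. *)
Lemma pe_path_edges s e : uniq s -> pe s e = (1 < size s) && (e \in path_edges s).
Proof.
case: s => [|x s] //; elim: s x => [|y s IH] x // u.
have uy : uniq (y :: s) by move: u; rewrite cons_uniq => /andP[].
have xs : x \notin y :: s by move: u; rewrite cons_uniq => /andP[].
have xy : x != y by apply: contraNneq xs => ->; rewrite mem_head.
have -> : pe [:: x, y & s] e = xe x y e (+) pe (y :: s) e by [].
have -> : (e \in path_edges [:: x, y & s]) = (e == [set x; y]) || (e \in path_edges (y :: s)).
  by rewrite !inE.
have -> : (e \in path_edges (y :: s)) = pe (y :: s) e.
  rewrite IH //; case: (s) => [|z t] //=; by rewrite inE.
rewrite /xe xy andTb; case: eqVneq => [->|//].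
by rewrite (@pe_notin _ x) // !inE eqxx.
Qed.

(** From three vertices on, the closing edge differs from all edges of the path; on two vertices it
    cancels the only one. *)
Lemma ce_cycle_edges s e : uniq s -> ce s e = (2 < size s) && (e \in cycle_edges s).
Proof.
case: s => [|x s] // u; have ce_small : size s <= 1 -> ce (x :: s) e = false.
  by case: (s) => [|y [|//]] _; rewrite ceE /= ?xexx // addbF xeC addbb.
case: (leqP (size s) 1) => s1; first by rewrite ce_small //= ltnS ltnNge s1.
rewrite ceE (_ : 2 < size (x :: s)) // andTb.
have zipE (a y : T) : (e \in [seq [set p.1; p.2] | p <- zip (a :: s) (rcons s y)]) =
    (e \in path_edges (a :: s)) || (e == [set last a s; y]).
  rewrite inE; elim: (s) a => [|z t IH] a /=; first by rewrite !inE.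
  by rewrite !in_cons IH orbA.
have -> : (e \in cycle_edges (x :: s)) = (e \in path_edges (x :: s)) || (e == [set last x s; x]).
  by rewrite -zipE inE /rot /= drop0 take0 cats1.
have lx : last x s != x by rewrite eq_sym last_neq.
have pl : pe (x :: s) [set last x s; x] = false.
  have := ce_last u s1; rewrite setUC ceE /xe lx eqxx andbT addbT.
  by move/negbTE.
have -> : (e \in path_edges (x :: s)) = pe (x :: s) e by rewrite pe_path_edges //= ltnS ltnW.
rewrite /xe lx andTb; case: eqVneq => [->|_]; last by rewrite addbF orbF.
by rewrite pl.
Qed.

Lemma path_cover_of G n : decomposes (@pe T) (fun e => e \in edges G) n ->
  exists2 H, path_odd_cover G H & #|H| <= n.
Proof.
move=> [Z [uZ sZ eZ]]; have [H [HP sH eH]] := odd_cover_of pe_path_edges uZ.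
exists H; last exact: leq_trans sZ.
by split; [exact: HP | apply/setP => e; rewrite eH eZ].
Qed.

Lemma cycle_cover_of G n : decomposes (@ce T) (fun e => e \in edges G) n ->
  exists2 H, cycle_odd_cover G H & #|H| <= n.
Proof.
move=> [Z [uZ sZ eZ]]; have [H [HP sH eH]] := odd_cover_of ce_cycle_edges uZ.
exists H; last exact: leq_trans sZ.
by split; [exact: HP | apply/setP => e; rewrite eH eZ].
Qed.

Lemma deg_le_max_deg G x : deg G x <= (uphalf (max_deg G)).*2.
Proof.
apply: (@leq_trans (max_deg G)); first exact: leq_bigmax.
by rewrite -[leqLHS]odd_double_half uphalf_half; lia.
Qed.

Lemma eulerian_max_deg G : eulerian G -> max_deg G = (uphalf (max_deg G)).*2.
Proof.
move=> ev; have : ~~ odd (max_deg G).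
  by rewrite /max_deg; elim/big_ind: _ => // m n em en; rewrite /maxn; case: ifP.
by rewrite uphalf_half => /negPf om; rewrite -[LHS]odd_double_half om.
Qed.

End Covers.

(** * The bounds with rational ceilings *)

Import Order.TTheory GRing.Theory Num.Theory.

Local Open Scope ring_scope.

Lemma le_ceil_frac (n a d : nat) : (0 < d)%N -> (d * n < a + d)%N ->
  n%:Z <= Num.ceil (a%:R / d%:R : rat).
Proof.
move=> d0 lt; have := ceil_ge (a%:R / d%:R : rat); set c := Num.ceil _.
rewrite ler_pdivrMr ?ltr0n // (pmulrn _ a) (pmulrn _ d) -intrM ler_int => le; nia.
Qed.

Theorem theorem1p5 (T : finType) (G : rel T)
    (Gsym : symmetric G) (Girr : irreflexive G) (Gniso : no_isolated G) :
  (exists H : {set {set {set T}}},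
      path_odd_cover G H /\
      (#|H|%:R : rat) <=
        Num.max ((v_odd G)%:R / 2)
          (Num.ceil (((v_odd G)%:R / 2 + 3 * (max_deg_even G)%:R) / 4 : rat))%:~R)
  /\
  (eulerian G ->
    (exists H : {set {set {set T}}},
        path_odd_cover G H /\
        #|H|%:Z <= Num.ceil (3 / 4 * (max_deg G)%:R : rat)) /\
    (exists H : {set {set {set T}}},
        cycle_odd_cover G H /\
        #|H|%:Z <= Num.ceil (3 / 4 * (max_deg G)%:R : rat))).
Proof.
set k := uphalf (max_deg G); have le x : (deg G x <= k.*2)%N := deg_le_max_deg G x.
split.
  have vG : v_odd G = (v_odd G)./2.*2.
    by rewrite -[LHS]odd_double_half (negPf (handshake Gsym Girr)).
  have [H HP sH] := path_cover_of (odd_decomposes Gsym Girr le vG).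
  exists H; split=> //; move: sH; set m := (v_odd G)./2 => sH.
  have -> : (v_odd G)%:R / 2 = m%:R :> rat by rewrite vG -muln2 natrM mulfK.
  rewrite /max_deg_even -/k -natrM -natrD le_max.
  move: sH; rewrite leq_max => /orP[sH|sH]; first by rewrite ler_nat sH.
  apply/orP; right; rewrite pmulrn ler_int; apply: le_ceil_frac => //.
  by move: sH; clear; lia.
move=> ev; have dG : max_deg G = k.*2 := eulerian_max_deg ev.
have bound n : (n <= uphalf (3 * k))%N -> n%:Z <= Num.ceil (3 / 4 * (max_deg G)%:R : rat).
  move=> nk; rewrite mulrAC -natrM dG; apply: le_ceil_frac => //.
  by move: nk; clear; lia.
have [pD cD] := even_decomposes Gsym Girr ev le.
split.
  by have [H HP sH] := path_cover_of pD; exists H; split; [exact: HP | exact: bound].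
by have [H HP sH] := cycle_cover_of cD; exists H; split; [exact: HP | exact: bound].
Qed.
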